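(* Let $(X_1,d_1,m_1)$ and $(X_2,d_2,m_2)$ be two metric measure spaces with the Sobolev-to-Lipschitz property and let $T:X_1\to X_2$ be a Borel map. Assume that both $m_1$ and $m_2$ give finite mass to bounded sets. Then the following are equivalent. (i) Up to a modification on an $m_1$-negligible set, $T$ is an isomorphism of the metric measure spaces, i.e. $T_\sharp m_1=m_2$ and $d_2(T(x),T(y))=d_1(x,y)$ for any $x,y\in\operatorname{supp}(m_1)$. (ii) The following two are true: (ii-a) there exist a Borel $m_1$-negligible set $\mathcal N\subset X_1$ and a Borel map $S:X_2\to X_1$ such that $S(T(x))=x$ for all $x\in X_1\setminus\mathcal N$; (ii-b) the right composition with $T$ produces a bijective isometry of $W^{1,2}(X_2,d_2,m_2)$ in $W^{1,2}(X_1,d_1,m_1)$, i.e. $f\in W^{1,2}(X_2,d_2,m_2)$ if and only if $f\circ T\in W^{1,2}(X_1,d_1,m_1)$ and in this case $\|f\|_{W^{1,2}(X_2)}=\|f\circ T\|_{W^{1,2}(X_1)}$.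
   Context: A metric measure space $(X,d,m)$ is a complete separable metric space with a non-negative Radon measure. $e_t(\gamma):=\gamma_t$ on $C([0,1],X)$. For absolutely continuous curves $|\dot\gamma_t|:=\lim_{h\to0}d(\gamma_{t+h},\gamma_t)/|h|$; $\int_0^1|\dot\gamma_t|^2dt:=+\infty$ if $\gamma$ is not absolutely continuous. An isomorphism of metric measure spaces is an isometry $T:(\operatorname{supp}(m_1),d_1)\to(\operatorname{supp}(m_2),d_2)$ with $T_\sharp m_1=m_2$. Sobolev functions: a test plan is a Borel probability measure $\pi$ on $C([0,1],X)$ with $(e_t)_\sharp\pi\le Cm$ for all $t\in[0,1]$ and some $C>0$, and $\iint_0^1|\dot\gamma_t|^2dt\,d\pi<\infty$. $S^2(X,d,m)$ is the space of Borel $f:X\to\mathbb R$ for which there is a non-negative $G\in L^2(X,m)$ with $\int|f(\gamma_1)-f(\gamma_0)|d\pi\le\iint_0^1G(\gamma_t)|\dot\gamma_t|dt\,d\pi$ for all test plans; $|Df|$ is the $m$-a.e. minimal such $G$. $W^{1,2}(X,d,m):=L^2(X,m)\cap S^2(X,d,m)$ with $\|f\|_{W^{1,2}}^2:=\|f\|_{L^2}^2+\||Df|\|_{L^2}^2$. Sobolev-to-Lipschitz property: every $f\in W^{1,2}(X,d,m)$ with $|Df|\le1$ $m$-a.e. admits a 1-Lipschitz representative, i.e. a 1-Lipschitz map $g:X\to\mathbb R$ with $f=g$ $m$-a.e. *)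

(* Defs.v *)
From HB Require Import structures.
From mathcomp Require Import all_boot all_order all_algebra.
From mathcomp Require Import all_classical all_reals all_analysis.
Import Order.TTheory GRing.Theory Num.Theory.
Import numFieldNormedType.Exports.

Set Implicit Arguments.
Unset Strict Implicit.
Unset Printing Implicit Defensive.

Local Open Scope classical_set_scope.
Local Open Scope ring_scope.

#[short(type="completeMetricType")]
HB.structure Definition CompleteMetric (R : numDomainType) :=
  {T of Metric R T & Complete T}.

Notation borel T := (g_sigma_algebraType (@open T)).

Definition separable (T : topologicalType) : Prop :=
  exists2 D : set T, countable D & dense D.

Definition radon (R : realType) (X : completeMetricType R)
    (m : {measure set (borel X) -> \bar R}) : Prop :=
  (forall x : X, exists2 U : set X, open_nbhs x U & (m U < +oo)%E) /\
  (forall B : set (borel X), measurable B ->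
    m B = ereal_sup [set m K | K in [set K : set X | compact K /\ K `<=` B]]).

(* The carrier of a completeMetricType is pointed, hence non-empty. *)
Record mmSpace (R : realType) := MMSpace {
  mms_sort :> completeMetricType R;
  mms_separable : separable mms_sort;
  mms_measure : {measure set (borel mms_sort) -> \bar R};
  mms_radon : radon mms_measure
}.

Notation "\m_ X" := (mms_measure X) (at level 8, X at level 2, format "\m_ X").

Definition finite_on_bounded (R : realType) (X : mmSpace R) : Prop :=
  forall B : set (borel X), measurable B ->
    (exists (x : X) (r : R), B `<=` ball x r) -> (\m_X B < +oo)%E.

Definition supp (R : realType) (X : mmSpace R) : set X :=
  [set x | forall U : set X, open_nbhs x U -> (0 < \m_X U)%E].

Definition unit_itv (R : realType) : set R := `[0, 1]%classic.
Arguments unit_itv R : clear implicits.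

(* C([0,1], X) *)
Definition curve (R : realType) (X : completeMetricType R) : Type :=
  continuousType (set_type (unit_itv R)) X.

Section curves.
Context {R : realType} {X : completeMetricType R}.

HB.instance Definition _ := Choice.on (curve X).

(* The topology of uniform convergence, i.e. of the sup distance. *)
HB.instance Definition _ := Topological.copy (curve X)
  (initial_topology
     (fun g : curve X => (g : arrow_uniform_type (set_type (unit_itv R)) X))).

Definition cst_curve : curve X :=
  (cst point : continuousType (set_type (unit_itv R)) X).

HB.instance Definition _ := isPointed.Build (curve X) cst_curve.

(* e_t; only meaningful for t in [0,1]: [valL] extends a function on the
   subtype [0,1] to R by an arbitrary constant. *)
Definition curve_eval (t : R) (g : curve X) : X :=
  valL (g : set_type (unit_itv R) -> X) t.

(* There is an integrable h with d(g_s, g_t) <= \int_s^t h for all s <= t. *)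
Definition abs_cont (g : curve X) : Prop :=
  exists h : R -> R,
    lebesgue_measure.-integrable (unit_itv R) (EFin \o h) /\
    forall s t : R, 0 <= s -> s <= t -> t <= 1 ->
      ((mdist (curve_eval s g) (curve_eval t g))%:E <=
        \int[lebesgue_measure]_(r in `[s, t]) (h r)%:E)%E.

(* The limit is over h <> 0 with t + h in [0,1]; it exists for a.e. t when g is
   absolutely continuous, and has a junk value where it does not exist. *)
Definition metric_speed (g : curve X) (t : R) : R :=
  lim ((fun h : R => mdist (curve_eval (t + h) g) (curve_eval t g) / `|h|)
         @ within [set h : R | unit_itv R (t + h)] 0^').

Definition energy (g : curve X) : \bar R :=
  if `[< abs_cont g >] then
    (\int[lebesgue_measure]_(t in unit_itv R) ((metric_speed g t) ^+ 2)%:E)%E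
  else +oo%E.

End curves.

Section sobolev.
Context {R : realType} (X : mmSpace R).

Definition test_plan (pi : probability (borel (curve X)) R) : Prop :=
  (exists2 C : R, 0 < C & forall t : R, 0 <= t <= 1 ->
    forall B : set (borel X), measurable B ->
      (pushforward pi (curve_eval t : borel (curve X) -> borel X) B
        <= C%:E * \m_X B)%E) /\
  (\int[pi]_g energy g < +oo)%E.

Definition weak_upper_gradient (f G : borel X -> R) : Prop :=
  [/\ G \in Lfun \m_X 2%:E, (forall x, 0 <= G x) &
      forall pi : probability (borel (curve X)) R, test_plan pi ->
        (\int[pi]_g `|f (curve_eval 1 g) - f (curve_eval 0 g)|%:E <=
         \int[pi]_g \int[lebesgue_measure]_(t in unit_itv R)
           (G (curve_eval t g) * metric_speed g t)%:E)%E].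

(* S^2(X, d, m) *)
Definition sobolev_class (f : borel X -> R) : Prop :=
  measurable_fun setT f /\ exists G, weak_upper_gradient f G.

Definition is_min_weak_upper_gradient (f G : borel X -> R) : Prop :=
  weak_upper_gradient f G /\
  forall G', weak_upper_gradient f G' -> {ae \m_X, forall x, G x <= G' x}.

(* |Df|: the minimal weak upper gradient is unique up to a.e. equality, and a
   representative is chosen. *)
Definition min_weak_upper_gradient (f : borel X -> R) : borel X -> R :=
  xget (cst 0 : borel X -> R) [set G | is_min_weak_upper_gradient f G].

Definition W12 (f : borel X -> R) : Prop :=
  f \in Lfun \m_X 2%:E /\ sobolev_class f.

Definition W12_norm (f : borel X -> R) : \bar R :=
  (('N[\m_X]_2%:E [EFin \o f] ^+ 2 +
    'N[\m_X]_2%:E [EFin \o min_weak_upper_gradient f] ^+ 2) `^ 2^-1)%E.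

Definition sobolev_to_lipschitz : Prop :=
  forall f : borel X -> R, W12 f ->
    {ae \m_X, forall x, min_weak_upper_gradient f x <= 1} ->
    exists2 g : X -> R, (forall x y, `|g x - g y| <= mdist x y) &
      {ae \m_X, forall x, f x = g x}.

End sobolev.

Section maps.
Context {R : realType} (X1 X2 : mmSpace R).
Implicit Type T : borel X1 -> borel X2.

Definition mm_isomorphism T : Prop :=
  (forall B : set (borel X2), measurable B -> pushforward \m_X1 T B = \m_X2 B) /\
  (forall x y : X1, supp x -> supp y ->
    mdist (T x : X2) (T y : X2) = mdist x y).

Definition iso_up_to_negligible T : Prop :=
  exists T' : borel X1 -> borel X2,
    [/\ measurable_fun setT T', {ae \m_X1, forall x, T' x = T x} &
        mm_isomorphism T'].

Definition ae_left_invertible T : Prop :=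
  exists (N : set (borel X1)) (S : borel X2 -> borel X1),
    [/\ measurable N, \m_X1 N = 0%E, measurable_fun setT S &
        forall x, ~ N x -> S (T x) = x].

(* f ranges over Borel functions, i.e. representatives of the elements of
   W^{1,2}. *)
Definition composition_isometry T : Prop :=
  forall f : borel X2 -> R, measurable_fun setT f ->
    (W12 f <-> W12 (f \o T)) /\ (W12 f -> W12_norm f = W12_norm (f \o T)).

End maps.

(* Main.v *)
Require Import Defs.
From HB Require Import structures.
From mathcomp Require Import all_boot all_order all_algebra.
From mathcomp Require Import all_classical all_reals all_analysis.
From mathcomp Require Import measurable_realfun ring lra.
Import Order.TTheory GRing.Theory Num.Theory.
Import numFieldNormedType.Exports.

(** An isometry f |-> f o T of Sobolev spaces preserves only the sum of the L^2 norms
    of f and |Df|. The two terms are separated, and localized, by testing the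
    isometry on the functions
      h_n = min (dist (f, Z / (n + 1)), chi),   chi >= 0 in W^{1,2},
    which tend to 0, while their slope is |Df| as soon as chi exceeds 1 / (n + 1) and
    0 where chi vanishes. In the limit (trim_energy) the integral of |Df|^2 over
    {chi > 0} equals that of |D(f o T)|^2 over {chi o T > 0}. The sets {chi > 0}, for
    chi a Lipschitz bump, form a pi-system that generates the Borel sets, so
      the integral of |Df|^2 over B = the integral of |D(f o T)|^2 over T^-1(B)
    for every Borel set B (slope_energy). With B = X2 it follows that the L^2 norms
    of f and f o T agree; for bumps f increasing to an indicator function this says
    that T maps m1 to m2 (comp_measure_preserving).

    The left inverse S makes every Borel set of X1 of the form T^-1(B) up to a null
    set. Hence |Df| <= 1 almost everywhere if and only if |D(f o T)| <= 1 almost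
    everywhere. For tents f = (r - d(., z))^+ on X2, the Sobolev-to-Lipschitz property
    of X1 shows that f o T is 1-Lipschitz off a null set, and countably many tents
    recover the distance: d2(Tx, Ty) <= d1(x, y). Tents of X1 composed with S, and
    the Sobolev-to-Lipschitz property of X2, give the reverse inequality
    (ae_isometric). An isometry defined on a set of full measure, which is dense in
    the support, extends to the support by completeness (isometric_extension).

    For the converse, an isomorphism phi has an inverse of the same kind
    (isomorphism_inverse). Almost every curve of a test plan stays in the support, so
    phi transports test plans to test plans with the same speeds, and G o phi is a
    weak upper gradient of f o phi when G is one of f. Composition with phi does not
    increase the Sobolev norm, nor does composition with its inverse.

    Both directions rest on the calculus of minimal weak upper gradients: existence,
    and locality (|Df| = |Dg| almost everywhere on {f = g}). It is derived here from
    the definition by test plans, through one estimate (plan_gradient_switch): if the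
    increments of psi are controlled by those of f1 where phi > c, and by those of f2
    where phi <= c, then the gradients of f1 and f2 can be used on the corresponding
    sets. Restricting a plan to a time interval and to a set of curves is done by
    stopping the curves, which needs neither normalization nor change of time
    (plan_gradient_gate); f need not be continuous along curves, it suffices that its
    values at the 2^-n grid times converge almost everywhere
    (plan_gradient_continuous). Lipschitz functions enter through the existence
    almost everywhere of the speed of an absolutely continuous curve and the bound of
    the distance of its endpoints by its length (metric_derivative_ae,
    abs_cont_mdist_le). *)

Set Implicit Arguments.
Unset Strict Implicit.
Unset Printing Implicit Defensive.

Local Open Scope classical_set_scope.
Local Open Scope ring_scope.

(** * Increments dominated by an integral *)

Section absolutely_continuous_density.
Context {R : realType}.
Local Notation mu := (@lebesgue_measure R).
Variable h : R -> R.
Hypothesis h0 : forall x, 0 <= h x.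
Hypothesis ih : mu.-integrable setT (EFin \o h).

Let H (y : R) : R := \int[mu]_(x in `]-oo, y]) h x.

Let H_itv s t : s <= t -> H t - H s = \int[mu]_(x in `]s, t]) h x.
Proof.
move=> st; rewrite /H Rintegral_itvB ?bnd_simp//.
exact: integrableS ih.
Qed.

Let H_nd : {homo H : x y / x <= y}.
Proof.
by move=> x y xy; rewrite -subr_ge0 H_itv//; exact: Rintegral_ge0.
Qed.

Lemma cumulative_integral_continuous : continuous H.
Proof.
move=> x; apply/cvgrPdist_lt => e e0.
have [d [d0 /= dP]] := integral_normr_continuous ih e0.
suff aux u v : u <= v -> `|u - v| < d -> `|H u - H v| < e.
  near=> y; have xyd : `|x - y| < d by near: y; exact: cvgr_dist_lt.
  have [xy|/ltW yx] := leP x y; first exact: aux.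
  by rewrite distrC aux// distrC.
move: x => _; move=> xy xyd.
rewrite distrC H_itv//.
have /(dP _ _) : (mu `]u, v] < d%:E)%E.
  rewrite lebesgue_measure_itv/= lte_fin; case: ifPn => [xy'|_]; last by rewrite lte_fin.
  by rewrite -EFinD lte_fin (le_lt_trans _ xyd)// distrC ler_norm.
move=> /(_ (measurable_itv _)); apply: le_lt_trans.
by apply: le_normr_Rintegral => //; exact: integrableS ih.
Unshelve. all: by end_near. Qed.

(** Both H + phi and H - phi are nondecreasing, hence cumulative functions of
    measures whose sum is the measure with density 2 h: in particular they are
    absolutely continuous, and the Radon-Nikodym theorem applies. *)
Lemma dominated_increments_density (phi : R -> R) :
  (forall s t, s <= t -> `|phi t - phi s| <= \int[mu]_(x in `]s, t]) h x) ->
  exists g : R -> R, mu.-integrable setT (EFin \o g) /\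
    forall s t, s <= t -> phi t - phi s = \int[mu]_(x in `]s, t]) g x.
Proof.
move=> phiP.
have phiH s t : s <= t -> `|phi t - phi s| <= H t - H s.
  by move=> st; rewrite H_itv//; exact: phiP.
have cphi : continuous phi.
  move=> x; apply/cvgrPdist_lt => e e0.
  have Hx := @cumulative_integral_continuous x.
  near=> y; have : `|H x - H y| < e by near: y; move: e e0; apply/cvgrPdist_lt.
  apply: le_lt_trans.
  have [xy|/ltW yx] := leP x y.
    rewrite distrC (le_trans (phiH _ _ xy))//.
    by rewrite distrC ler_norm.
  by rewrite (le_trans (phiH _ _ yx))// ler_norm.
pose mk (f : R -> R) nd (c : continuous f) : cumulative R R :=
  HB.pack f (@isCumulative.Build R _ R f nd (right_continuousW c)).
have ndF : {homo (H \+ phi) : x y / x <= y}.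
  move=> x y xy /=; rewrite -subr_ge0.
  have := phiH _ _ xy; rewrite ler_norml => /andP[+ _]; lra.
have ndG : {homo (H \- phi) : x y / x <= y}.
  move=> x y xy /=; rewrite -subr_ge0.
  have := phiH _ _ xy; rewrite ler_norml => /andP[_]; lra.
have nd2 : {homo (H \+ H) : x y / x <= y}.
  by move=> x y xy /=; rewrite lerD// H_nd.
have cF : continuous (H \+ phi).
  by move=> x; apply: cvgD; [exact: cumulative_integral_continuous|exact: cphi].
have cG : continuous (H \- phi).
  by move=> x; apply: cvgB; [exact: cumulative_integral_continuous|exact: cphi].
have c2 : continuous (H \+ H).
  by move=> x; apply: cvgD; exact: cumulative_integral_continuous.
(* mk packs a continuous nondecreasing function as a cumulative function. *)
pose F := mk _ ndF cF; pose G := mk _ ndG cG; pose K := mk _ nd2 c2.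
pose muF := lebesgue_stieltjes_measure F.
pose muG := lebesgue_stieltjes_measure G.
have LS (f : cumulative R R) (s t : R) : s <= t ->
    lebesgue_stieltjes_measure f `]s, t]%classic = (f t - f s)%:E.
  move=> st; rewrite /lebesgue_stieltjes_measure/= /measure_extension.
  by rewrite measurable_mu_extE/= ?wlength_itv_bnd//; exact: is_ocitv.
have LS0 (f : cumulative R R) (s t : R) : t <= s ->
    lebesgue_stieltjes_measure f `]s, t]%classic = 0%E.
  by move=> st; rewrite set_itv_ge ?measure0// bnd_simp -leNgt.
have mh : measurable_fun setT h by apply/measurable_EFinP; exact: measurable_int ih.
pose nu := fun A : set (measurableTypeR R) => (\int[mu]_(x in A) (h x + h x)%:E)%E.
have mhh : measurable_fun setT (fun x => (h x + h x)%:E).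
  by apply/measurable_EFinP; exact: measurable_funD.
have nu0 : nu set0 = 0%E by rewrite /nu integral_set0.
have nuge0 A : (0 <= nu A)%E.
  by apply: integral_ge0 => x _; rewrite lee_fin addr_ge0.
have nus : semi_sigma_additive nu.
  by apply: semi_sigma_additive_nng_induced => // x; rewrite lee_fin addr_ge0.
pose Nu : {measure set (measurableTypeR R) -> \bar R} :=
  HB.pack nu (isMeasure.Build _ _ _ nu nu0 nuge0 nus).
have fing (g : R -> R) s t : mu.-integrable setT (EFin \o g) ->
    (\int[mu]_(x in `]s, t]) g x)%:E = (\int[mu]_(x in `]s, t]) (g x)%:E)%E.
  move=> ig; rewrite /Rintegral fineK//.
  apply: integrable_fin_num => //; exact: integrableS ig.
have KNu A : measurable A -> lebesgue_stieltjes_measure K A = Nu A.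
  apply: lebesgue_stieltjes_measure_unique => _ [[s t] _ <-]/=.
  have [st|/ltW ts] := leP s t; last first.
    by rewrite LS0//= /nu set_itv_ge ?integral_set0// bnd_simp -leNgt.
  rewrite LS//= /nu; transitivity ((\int[mu]_(x in `]s, t]) (h x)%:E) +
    (\int[mu]_(x in `]s, t]) (h x)%:E))%E.
    rewrite -fing// -EFinD -H_itv//; congr (_%:E); lra.
  rewrite -ge0_integralD//.
  - by move=> x _; rewrite lee_fin.
  - by apply: measurable_funTS; exact/measurable_EFinP.
  - by move=> x _; rewrite lee_fin.
  - by apply: measurable_funTS; exact/measurable_EFinP.
have KFG A : measurable A -> lebesgue_stieltjes_measure K A = (muF A + muG A)%E.
  move=> mA; rewrite -measure_addE; move: A mA.
  apply: lebesgue_stieltjes_measure_unique => _ [[s t] _ <-].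
  transitivity (muF `]s, t]%classic + muG `]s, t]%classic)%E; last first.
    by rewrite -measure_addE.
  rewrite /muF /muG.
  have [st|/ltW ts] := leP s t; last by rewrite !LS0//= adde0.
  rewrite !LS//= -EFinD; congr (_%:E); lra.
have FNu A : measurable A -> (muF A <= Nu A)%E.
  by move=> mA; rewrite -KNu// KFG// leeDl.
have Nufin : (Nu setT < +oo)%E.
  rewrite /Nu/= /nu; under eq_integral do rewrite EFinD.
  have hoo : (\int[mu]_x (h x)%:E < +oo)%E.
    move/integrableP : (ih) => [_]; apply: le_lt_trans.
    by under [leRHS]eq_integral do rewrite /= ger0_norm//.
  rewrite ge0_integralD//; first by rewrite lte_add_pinfty.
  by move=> x _; rewrite lee_fin.
  exact/measurable_EFinP.
  by move=> x _; rewrite lee_fin.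
  exact/measurable_EFinP.
have muFfin : fin_num_fun muF.
  move=> A mA; rewrite ge0_fin_numE//; apply: le_lt_trans Nufin.
  apply: le_trans (FNu _ mA) _; by apply: (le_measure Nu); rewrite ?inE.
pose MF : {finite_measure set (measurableTypeR R) -> \bar R} :=
  HB.pack (lebesgue_stieltjes_measure F)
   (Measure_isFinite.Build _ _ _ (lebesgue_stieltjes_measure F) muFfin).
have dom : MF `<< (mu : {sigma_finite_measure set (measurableTypeR R) -> \bar R}).
  apply/null_content_dominatesP => A mA muA.
  apply/eqP; rewrite eq_le measure_ge0 andbT.
  rewrite (le_trans (FNu _ mA))//= /nu null_set_integral//.
  exact: measurable_funTS.
have [k [k0 kf ik kE]] := radon_nikodym_sigma_finite dom.
have ikr : mu.-integrable setT (EFin \o (fine \o k)).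
  apply: eq_integrable ik => // x _; by rewrite /= fineK.
exists (fun x => fine (k x) - h x); split.
  have -> : EFin \o (fun x => fine (k x) - h x) = ((EFin \o (fine \o k)) \- (EFin \o h))%E.
    by apply/funext => x /=; rewrite EFinB.
  exact: integrableB.
move=> s t st.
rewrite RintegralB//; [|exact: integrableS ikr|exact: integrableS ih].
rewrite -H_itv//.
have -> : \int[mu]_(x in `]s, t]) fine (k x) = F t - F s.
  rewrite /Rintegral; under eq_integral do rewrite fineK//.
  by rewrite -kE//= LS.
rewrite /=; lra.
Unshelve. all: by end_near. Qed.

End absolutely_continuous_density.

(** * The metric derivative *)

Section distance_lemmas.
Context {R : realType} {X : metricType R}.
Implicit Types x y z : X.

Lemma ler_dist_mdist x y z : `|mdist x z - mdist y z| <= mdist x y.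
Proof.
rewrite ler_norml; apply/andP; split.
  by rewrite lerNl opprB lerBlDr (metric_sym x y) metric_triangle.
by rewrite lerBlDr metric_triangle.
Qed.

Lemma mball_open x (r : R) : open (ball x r).
Proof.
rewrite openE => y; rewrite ballEmdist /= => xyr; apply/nbhs_ballP.
exists (r - mdist x y) => /=; first by rewrite subr_gt0.
move=> z; rewrite !ballEmdist/= ltrBrDl.
exact: le_lt_trans (metric_triangle _ _ _).
Qed.

(** Take u n close to y. *)
Lemma mdist_le_dense (u : nat -> X) x y (a : R) : dense (range u) ->
  (forall n, `|mdist x (u n) - mdist y (u n)| <= a) -> mdist x y <= a.
Proof.
move=> du H; apply/ler_addgt0Pl => e e0.
have e2 : 0 < e / 2 by rewrite divr_gt0.
have [|z [yz [n _ unz]]] := du (ball y (e / 2)) _ (mball_open y (e / 2)).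
  by exists y; exact: ballxx.
subst z; move: yz; rewrite ballEmdist/= => yu.
have := H n; rewrite ler_norml => /andP[_ Hn].
have := metric_triangle x (u n) y.
rewrite (metric_sym (u n) y) => tr.
have := mdist_ge0 y (u n); lra.
Qed.

End distance_lemmas.

Section metric_derivative.
Context {R : realType}.
Local Notation mu := (@lebesgue_measure R).

Lemma ae_difference_quotient (f : R -> R) :
  mu.-integrable setT (EFin \o f) ->
  let F y := \int[mu]_(x in `]-oo, y]) f x in
  {ae mu, forall t, `|F (t + e) - F t| / `|e| @[e --> 0^'] --> `|f t|}.
Proof.
move=> intf F; have FF := ae_filter_ringOfSetsType mu.
have : {ae mu, forall t, derivable F t 1 /\ F^`()%classic t = f t}.
  apply: FTC1Ny => [y|]; first exact: integrableS intf.
  by apply: open_integrable_locally => //; exact: openT.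
apply: filterS => t [dF <-].
have : (fun e => e^-1 *: (F (e + t) - F t)) @ 0^' --> F^`()%classic t.
  rewrite /derive1; apply/cvg_ex.
  move/cvg_ex : dF => [l]; under eq_fun do rewrite [_%:A]mulr1.
  by move=> Fl; exists l.
move/cvg_norm; apply: cvg_trans; apply: near_eq_cvg; near=> e.
by rewrite normrZ normfV (addrC e) mulrC.
Unshelve. all: by end_near. Qed.

Variables (X : completeMetricType R) (u : nat -> X) (c : R -> X) (h : R -> R).
Hypothesis du : dense (range u).
Hypothesis h0 : forall x, 0 <= h x.
Hypothesis ih : mu.-integrable setT (EFin \o h).
Hypothesis ch : forall s t, s <= t ->
  mdist (c s) (c t) <= \int[mu]_(x in `]s, t]) h x.

(** The scalar functions d(c, u_n) have derivatives g_n almost everywhere; the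
    supremum m of the |g_n| controls the increments of c because the u_n are
    dense, and it is at most the lower metric derivative because each d(c, u_n)
    moves no faster than c. *)
Lemma metric_derivative_ae : exists m : R -> R,
  [/\ mu.-integrable setT (EFin \o m), (forall t, 0 <= m t),
    (forall s t, s <= t -> mdist (c s) (c t) <= \int[mu]_(x in `]s, t]) m x) &
    {ae mu, forall t,
      mdist (c (t + e)) (c t) / `|e| @[e --> 0^'] --> m t}].
Proof.
have FF := ae_filter_ringOfSetsType mu.
pose phi n t := mdist (c t) (u n).
have phiP n s t : `|phi n t - phi n s| <= mdist (c s) (c t).
  by rewrite distrC; exact: ler_dist_mdist.
have /choice[g gP] n : exists g : R -> R, mu.-integrable setT (EFin \o g) /\
    forall s t, s <= t -> phi n t - phi n s = \int[mu]_(x in `]s, t]) g x.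
  apply: (dominated_increments_density h0 ih) => s t st.
  exact: le_trans (phiP _ _ _) (ch st).
have ig n := (gP n).1; have gE n := (gP n).2.
have mh : measurable_fun setT h by apply/measurable_EFinP; exact: measurable_int ih.
have mg n : measurable_fun setT (g n).
  by apply/measurable_EFinP; exact: measurable_int (ig n).
have mgn n : measurable_fun setT (fun x => `|g n x|) by exact: measurableT_comp.
(* The cut by h keeps the supremum finite everywhere; almost everywhere it
   changes nothing, since |g n| <= h. *)
pose k n t := Num.min `|g n t| (h t).
have mk n : measurable_fun setT (k n).
  by apply: measurable_minr => //; exact: measurableT_comp.
have k0 n t : 0 <= k n t by rewrite /k le_min normr_ge0 h0.
have kh n t : k n t <= h t by rewrite /k ge_min lexx orbT.
have kub t : has_ubound (range (k^~ t)) by exists (h t) => _ [n _ <-].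
pose m t := sups (k^~ t) 0.
have mm : measurable_fun setT m by exact: measurable_fun_sups.
have mE t : m t = sup (range (k^~ t)).
  by rewrite /m /sups/=; congr sup; apply/seteqP; split => _ [n _ <-]; exists n.
have km n t : k n t <= m t by rewrite mE; apply: ub_le_sup => //; exists n.
have m0 t : 0 <= m t by exact: le_trans (k0 0%N t) (km 0%N t).
have mleh t : m t <= h t.
  by rewrite mE; apply: ge_sup; [exists (k 0%N t); exists 0%N|move=> _ [n _ <-]].
have im : mu.-integrable setT (EFin \o m).
  apply: le_integrable ih => //; first exact/measurable_EFinP.
  by move=> t _; rewrite /= !ger0_norm// lee_fin.
pose P (f : R -> R) y := \int[mu]_(x in `]-oo, y]) f x.
have PB (f : R -> R) s t : mu.-integrable setT (EFin \o f) -> s <= t ->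
    P f t - P f s = \int[mu]_(x in `]s, t]) f x.
  by move=> if_ st; rewrite /P Rintegral_itvB ?bnd_simp//; exact: integrableS if_.
have PBn (f1 f2 : R -> R) : mu.-integrable setT (EFin \o f1) ->
    mu.-integrable setT (EFin \o f2) -> (forall x, 0 <= f2 x) ->
    (forall s t, s <= t -> `|\int[mu]_(x in `]s, t]) f1 x| <=
       \int[mu]_(x in `]s, t]) f2 x) ->
    forall s t, `|P f1 s - P f1 t| <= `|P f2 s - P f2 t|.
  move=> if1 if2 f20 H s t.
  have [st|/ltW ts] := leP s t.
    rewrite distrC (distrC (P f2 s)) !PB// (le_trans (H _ _ st))//.
    by rewrite ger0_norm//; apply: Rintegral_ge0.
  rewrite !PB// (le_trans (H _ _ ts))//.
  by rewrite ger0_norm//; apply: Rintegral_ge0.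
have aeg : {ae mu, forall t, forall n, `|P (g n) (t + e) - P (g n) t| / `|e|
    @[e --> 0^'] --> `|g n t|}.
  by apply: ae_foralln => n; exact: ae_difference_quotient.
have aeh := ae_difference_quotient ih.
have aem := ae_difference_quotient im.
have aegh : {ae mu, forall t, forall n, `|g n t| <= h t}.
  apply: filterS2 aeg aeh => t Hg Hh n.
  rewrite -[leRHS]ger0_norm//.
  apply: (ler_cvg_to (Hg n) Hh); near=> e.
  rewrite ler_wpM2r ?invr_ge0//; apply: PBn => // a b ab.
  by rewrite -gE// (le_trans (phiP _ _ _))// ch.
have gm n s t : s <= t -> `|phi n t - phi n s| <= \int[mu]_(x in `]s, t]) m x.
  move=> st; rewrite gE//.
  rewrite (le_trans (le_normr_Rintegral _ _))//; first exact: integrableS (ig n).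
  rewrite /Rintegral fine_le//.
  - apply: integrable_fin_num => //.
    by apply: integrableS (integrable_norm (ig n)).
  - by apply: integrable_fin_num => //; exact: integrableS im.
  apply: ae_ge0_le_integral => //.
  - by apply/measurable_EFinP; exact: measurable_funTS (mgn n).
  - by move=> x _; rewrite lee_fin.
  - by apply/measurable_EFinP; exact: measurable_funTS.
  - apply: filterS aegh => x /(_ n) gh _; rewrite lee_fin.
    by apply: le_trans (km n x); rewrite /k le_min lexx.
have cm s t : s <= t -> mdist (c s) (c t) <= \int[mu]_(x in `]s, t]) m x.
  move=> st; apply: (mdist_le_dense du) => n.
  by rewrite distrC; exact: gm.
exists m; split => //.
have cmn s t : mdist (c s) (c t) <= `|P m s - P m t|.
  have [st|/ltW ts] := leP s t.
    by rewrite distrC PB// (le_trans (cm _ _ st))// ler_norm.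
  by rewrite metric_sym PB// (le_trans (cm _ _ ts))// ler_norm.
apply: filterS3 aeg aegh aem => t Hg Hgh Hm.
rewrite ger0_norm// in Hm.
apply/cvgrPdist_le => eps eps0.
(* For an index n with |g n t| close to m t, the difference quotient of c lies
   between those of the primitive of g n and of the primitive of m. *)
have hs : has_sup (range (k^~ t)) by split=> //; exists (k 0%N t); exists 0%N.
have e2 : 0 < eps / 2 by rewrite divr_gt0.
have [_ [n _ <-]] := sup_adherent e2 hs; rewrite -mE => /ltW kn.
have gk : `|g n t| = k n t.
  by rewrite /k; apply/esym/min_idPl.
move/cvgrPdist_le : (Hg n) => /(_ _ e2) Hgn.
move/cvgrPdist_le : Hm => /(_ _ e2) Hmn.
near=> e.
have H1 : `| `|g n t| - `|P (g n) (t + e) - P (g n) t| / `|e| | <= eps / 2.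
  by near: e.
have H2 : `|m t - `|P m (t + e) - P m t| / `|e| | <= eps / 2 by near: e.
have H3 : mdist (c (t + e)) (c t) / `|e| <= `|P m (t + e) - P m t| / `|e|.
  by rewrite ler_wpM2r ?invr_ge0.
have H4 : `|P (g n) (t + e) - P (g n) t| / `|e| <= mdist (c (t + e)) (c t) / `|e|.
  rewrite ler_wpM2r ?invr_ge0//.
  have [tt|/ltW tt] := leP t (t + e); first by rewrite PB// -gE// metric_sym.
  by rewrite distrC PB// -gE.
move: H1 H2; rewrite gk !ler_norml => /andP[_ H1] /andP[H2 _].
move: kn H1 H2 H3 H4; clear.
by move=> kn H1 H2 H3 H4; apply/andP; split; lra.
Unshelve. all: by end_near. Qed.

End metric_derivative.

(** * Curves as functions on the line *)

Section clamp.
Context {R : realType}.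

Definition clamp01 (t : R) : R := Num.max 0 (Num.min 1 t).

Lemma clamp01_itv t : 0 <= clamp01 t <= 1.
Proof. by rewrite /clamp01 le_max lexx ge_max ler01 ge_min lexx. Qed.

Lemma clamp01_id t : 0 <= t <= 1 -> clamp01 t = t.
Proof. by move=> /andP[t0 t1]; rewrite /clamp01 (min_idPr t1) (max_idPr t0). Qed.

Lemma le_clamp01 : {homo clamp01 : s t / s <= t}.
Proof.
move=> s t st; rewrite /clamp01 ge_max le_max lexx/= le_max.
by apply/orP; right; rewrite le_min !ge_min lexx st !orbT.
Qed.

Lemma clamp01_idem t : clamp01 (clamp01 t) = clamp01 t.
Proof. by rewrite clamp01_id// clamp01_itv. Qed.

Lemma clamp01_continuous : continuous clamp01.
Proof.
move=> t; rewrite /clamp01.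
have c0 : {for t, continuous (cst 0 : R -> R^o)} by exact: cvg_cst.
have c1 : {for t, continuous (cst 1 : R -> R^o)} by exact: cvg_cst.
have ci : {for t, continuous (id : R -> R^o)} by exact: cvg_id.
exact: (continuous_max c0 (continuous_min c1 ci)).
Qed.

Definition to01 (t : R) : set_type (unit_itv R) :=
  exist _ (clamp01 t) (mem_set (clamp01_itv t)).

Lemma to01_val (u : set_type (unit_itv R)) : to01 (val u) = u.
Proof.
by apply: val_inj; rewrite /= clamp01_id//; case: u => u /= /set_mem; rewrite /unit_itv/= in_itv.
Qed.

Lemma to01_continuous : continuous to01.
Proof.
apply/continuousP => A [B oB <-]; rewrite -comp_preimage.
by move/continuousP : clamp01_continuous; apply.
Qed.

End clamp.

Section curves.
Context {R : realType} {X : completeMetricType R}.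
Implicit Types (g : curve X) (s t : R).

(** Every curve is extended to the whole line by constants, so that it can be
    treated as a continuous function on R. *)
Definition cev g t : X := (g : set_type (unit_itv R) -> X) (to01 t).

Lemma curve_evalE g t : 0 <= t <= 1 -> curve_eval t g = cev g t.
Proof.
move=> t01; rewrite /curve_eval /cev.
have := f_equal (fun F => F (to01 t))
  (valLK point (g : set_type (unit_itv R) -> X)).
rewrite /sigL /= => <-; congr ('valL_ _ _ _).
by rewrite set_valE /= clamp01_id.
Qed.

Lemma cev_clamp g t : cev g (clamp01 t) = cev g t.
Proof. by rewrite /cev; congr (_ _); apply: val_inj; rewrite /= clamp01_idem. Qed.

Lemma curve_eval_clamp g t : curve_eval (clamp01 t) g = cev g t.
Proof. by rewrite curve_evalE ?cev_clamp// clamp01_itv. Qed.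

Lemma cev_continuous g : continuous (cev g).
Proof.
move=> t; apply: (@continuous_comp _ _ _ to01 (g : _ -> X)).
  exact: to01_continuous.
exact: (@cts_fun _ _ g).
Qed.

Lemma mkcurve_subproof (f : R -> X) : continuous f ->
  continuous (f \o (@set_val _ (unit_itv R)) : set_type (unit_itv R) -> X).
Proof.
move=> cf u; apply: continuous_comp; last exact: cf.
exact: initial_continuous.
Qed.

Definition mkcurve (f : R -> X) (cf : continuous f) : curve X :=
  mkcts (mkcurve_subproof cf).

Lemma cev_mkcurve (f : R -> X) (cf : continuous f) t :
  cev (mkcurve cf) t = f (clamp01 t).
Proof. by []. Qed.

(** The neighbourhoods of the sup distance, in terms of the extended curves. *)
Lemma curve_nbhsP g (A : set (curve X)) : nbhs g A <->
  exists2 e : R, 0 < e & [set g' | forall t, mdist (cev g t) (cev g' t) < e] `<=` A.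
Proof.
pose U := arrow_uniform_type (set_type (unit_itv R)) X.
have key (e : R) g' : (fct_ball (g : U) e (g' : U)) <->
    forall t, mdist (cev g t) (cev g' t) < e.
  split=> [H t|H t]; first by have := H (to01 t); rewrite ballEmdist.
  by rewrite ballEmdist/=; have := H (val t); rewrite /cev to01_val.
split.
  rewrite nbhsE => -[_ [[C oC <-] Cg] CA].
  have : nbhs (g : U) C by apply: open_nbhs_nbhs; split.
  have {}CA : [set g' : curve X | C (g' : U)] `<=` A by [].
  move=> /nbhs_ballP[e /= e0 eC]; exists e => // g' /key gg'.
  by apply: CA => /=; apply: eC.
move=> [e e0 eA].
have : nbhs (g : U) (fct_ball (g : U) e).
  by apply/nbhs_ballP; exists e.
move/(@initial_continuous _ U (fun g : curve X => (g : U))) => H.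
apply: (@filterS (curve X) (nbhs g) _ _ _ _ H) => g' /= /key; exact: eA.
Qed.

Lemma cev_eval_continuous t : continuous (fun g => cev g t).
Proof.
move=> g A /nbhs_ballP[e /= e0 eA]; apply/curve_nbhsP; exists e => // g' /(_ t).
by move=> gg'; apply: eA; rewrite ballEmdist.
Qed.

End curves.

Arguments cev : simpl never.

Lemma curve_nbhs_continuous (R : realType) (X Y : completeMetricType R)
    (F : curve X -> curve Y) :
  (forall g g' (e : R), (forall t, mdist (cev g t) (cev g' t) < e) ->
    forall t, mdist (cev (F g) t) (cev (F g') t) < e) -> continuous F.
Proof.
move=> H g A /curve_nbhsP[e e0 eA]; apply/curve_nbhsP; exists e => // g' gg'.
by apply: eA => /= t; exact: H.
Qed.

(** * Borel functions with values in a separable metric space *)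

Section borel_measurability.
Context {R : realType}.

Lemma continuous_borel_measurable (S T : ptopologicalType) (f : S -> T) :
  continuous f -> measurable_fun setT (f : borel S -> borel T).
Proof.
move=> cf; apply: (@measurability _ _ (borel S) (borel T) setT f (@open T)) => //.
move=> _ [B oB <-]; rewrite setTI; apply: sub_sigma_algebra.
by move/continuousP : cf; apply.
Qed.

Lemma continuous_borel_measurableR (S : ptopologicalType) (f : S -> R) :
  continuous f -> measurable_fun setT (f : borel S -> R).
Proof.
move=> cf; apply: (measurability _ (RGenOInfty.measurableE R)).
move=> _ [_ [a ->] <-]; rewrite setTI; apply: sub_sigma_algebra.
by move/continuousP : cf; apply; exact: interval_open.
Qed.

Lemma bigcap_countable_measurable d (Z : measurableType d) (I : countType)
  (F : I -> set Z) : (forall i, measurable (F i)) -> measurable (\bigcap_i F i).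
Proof.
move=> mF; rewrite -[X in measurable X]setCK setC_bigcap.
apply: measurableC; apply: countable_bigcupT_measurable => //.
by move=> i; exact: measurableC.
Qed.

Lemma bigcup_countable_measurable d (Z : measurableType d) (I : countType)
  (F : I -> set Z) : (forall i, measurable (F i)) -> measurable (\bigcup_i F i).
Proof. by move=> mF; apply: countable_bigcupT_measurable. Qed.

Lemma measurable_gt_set d (Z : measurableType d) (f : Z -> R) (c : R) :
  measurable_fun setT f -> measurable [set x | c < f x].
Proof.
move=> mf; have := measurable_fun_ltr (measurable_cst c) mf => /(_ measurableT [set true]).
by rewrite setTI => /(_ Logic.I); congr measurable; apply/seteqP; split => x /=.
Qed.

(** Sampling times: the largest multiple of 2^-n below t. *)
Definition grid (n : nat) (t : R) : R := (Num.floor (t * 2 ^+ n))%:~R / 2 ^+ n.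

Lemma grid_itv n t : grid n t <= t < grid n t + 2^-1 ^+ n.
Proof.
have p : 0 < 2 ^+ n :> R by exact: exprn_gt0.
rewrite /grid ler_pdivrMr// floor_le/=.
rewrite exprVn -[X in _ + X]mul1r -mulrDl ltr_pdivlMr//.
by have := floorD1_gt (t * 2 ^+ n); rewrite intrD.
Qed.

Lemma grid_cvg t : grid n t @[n --> \oo] --> t.
Proof.
apply/cvgrPdist_lt => e e0.
have : (2^-1 ^+ n : R) @[n --> \oo] --> 0.
  by apply: cvg_expr; rewrite ger0_norm ?invr_ge0// invf_lt1// ltr1n.
move/cvgrPdist_lt => /(_ _ e0); apply: filterS => n.
rewrite sub0r normrN ger0_norm; last by rewrite exprn_ge0// invr_ge0.
have /andP[g1 g2] := grid_itv n t => ne.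
rewrite ger0_norm ?subr_ge0//; lra.
Qed.

Lemma measurable_grid n : measurable_fun setT (grid n).
Proof.
apply: measurable_funM; last exact: measurable_cst.
apply: (@nondecreasing_measurable _ setT) => // x y xy.
rewrite ler_int; apply: le_floor.
by rewrite ler_wpM2r// exprn_ge0.
Qed.

(** F z t is the limit of F z (grid n t), and grid n takes countably many values. *)
Lemma measurable_caratheodory d (Z : measurableType d) (F : Z -> R -> R) :
  (forall t, measurable_fun setT (F^~ t)) -> (forall z, continuous (F z)) ->
  measurable_fun setT (fun zt : Z * R => F zt.1 zt.2).
Proof.
move=> mF cF.
apply: (@measurable_fun_cvg _ _ _ _ (fun n zt => F zt.1 (grid n zt.2))) => /=; last first.
  by move=> [z t] _ /=; apply: continuous_cvg; [exact: cF|exact: grid_cvg].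
move=> n _ Y mY; rewrite setTI.
rewrite [X in measurable X](_ : _ = \bigcup_(j : int)
  ((F^~ (j%:~R / 2 ^+ n) @^-1` Y) `*` (grid n @^-1` [set j%:~R / 2 ^+ n]))).
  apply: bigcup_countable_measurable => j; apply: measurableX.
    by rewrite -[X in measurable X]setTI; exact: mF.
  by rewrite -[X in measurable X]setTI; exact: measurable_grid.
apply/seteqP; split=> [[z t] /= Yz|[z t] [j _ [/= Yz ->]]//].
by exists (Num.floor (t * 2 ^+ n)).
Qed.

End borel_measurability.

Section separable_space.
Context {R : realType} {X : completeMetricType R}.
Hypothesis sX : separable X.

Lemma separable_seq : exists u : nat -> X, dense (range u).
Proof.
have [D cD dD] := sX.
have [x [_ Dx]] : [set: X] `&` D !=set0 by apply: dD; [exists point|exact: openT].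
have /pfcard_geP [D0|[f]] := cD; first by move: Dx; rewrite D0.
exists f; rewrite (_ : range f = D)//.
apply/seteqP; split=> [_ [n _ <-]|y Dy]; first exact: funS.
by have /(_ y Dy) [n _ fn] := @surj _ _ _ _ f; exists n.
Qed.

Definition dense_seq : nat -> X := sval (cid separable_seq).

Lemma dense_seqP : dense (range dense_seq).
Proof. by rewrite /dense_seq; case: cid. Qed.

Lemma open_bigcup_ball (U : set X) : open U ->
  U = \bigcup_(nk in [set nk : nat * nat |
         ball (dense_seq nk.1) (nk.2.+1%:R^-1) `<=` U])
      ball (dense_seq nk.1) (nk.2.+1%:R^-1).
Proof.
move=> oU; apply/seteqP; split=> [x Ux|x [nk /= nkU xB]]; last exact: nkU.
have /nbhs_ballP[e /= e0 eU] : nbhs x U by exact: open_nbhs_nbhs.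
have [k ke] : exists k : nat, k.+1%:R^-1 < e / 2.
  have e2 : 0 < e / 2 by rewrite divr_gt0.
  exists (Num.truncn (e / 2)^-1).
  rewrite invf_plt ?posrE//; exact: truncnS_gt.
have k0 : 0 < k.+1%:R^-1 :> R by rewrite invr_gt0.
have [|y [xy [n _ ny]]] := @dense_seqP (ball x k.+1%:R^-1) _ (mball_open x _).
  by exists x; exact: ballxx.
subst y; exists (n, k) => /=; last exact: ball_sym.
move=> z nz; apply: eU; apply: (@le_ball _ _ _ (k.+1%:R^-1 + k.+1%:R^-1)).
  by rewrite (splitr e) lerD// ltW.
exact: ball_triangle xy nz.
Qed.

(** Open sets are countable unions of balls around points of the dense sequence. *)
Lemma measurable_borel_mdist d (Z : measurableType d) (f : Z -> borel X) :
  (forall n, measurable_fun setT (fun z => mdist (f z : X) (dense_seq n))) ->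
  measurable_fun setT f.
Proof.
move=> mf; apply: (@measurability _ _ Z (borel X) setT f (@open X)) => //.
move=> _ [U oU <-]; rewrite setTI (open_bigcup_ball oU) preimage_bigcup.
rewrite bigcup_mkcond; apply: bigcup_countable_measurable => nk.
case: ifPn => // _.
rewrite ballEmdist; have := mf nk.1 measurableT _ (measurable_itv `]-oo, (nk.2.+1%:R^-1)[).
rewrite setTI; congr measurable; apply/seteqP; split => z /=;
  by rewrite in_itv/= metric_sym.
Qed.

Lemma mdist_continuous_l (y : X) : continuous (fun x : X => mdist x y).
Proof.
move=> x; apply/cvgrPdist_lt => e e0; apply/nbhs_ballP; exists e => //= z.
by rewrite ballEmdist/=; apply: le_lt_trans; exact: ler_dist_mdist.
Qed.

Lemma measurable_mdist d (Z : measurableType d) (f g : Z -> borel X) :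
  measurable_fun setT f -> measurable_fun setT g ->
  measurable_fun setT (fun z => mdist (f z : X) (g z)).
Proof.
move=> mf mg.
have mc (h : Z -> borel X) n : measurable_fun setT h ->
    measurable_fun setT (fun z => mdist (h z : X) (dense_seq n)).
  move=> mh; apply: (@measurableT_comp _ _ _ _ _ _
    (fun x : borel X => mdist (x : X) (dense_seq n)) _ h) => //.
  by apply: continuous_borel_measurableR; exact: mdist_continuous_l.
pose k n z := `|mdist (f z : X) (dense_seq n) - mdist (g z : X) (dense_seq n)|.
have kub z : has_ubound (range (k^~ z)).
  by exists (mdist (f z : X) (g z)) => _ [n _ <-]; exact: ler_dist_mdist.
rewrite (_ : (fun z => _) = (fun z => sups (k^~ z) 0)).
  apply: measurable_fun_sups => // n; apply: measurableT_comp => //.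
  by apply: measurable_funB; exact: mc.
apply/funext => z.
have -> : sups (k^~ z) 0%N = sup (range (k^~ z)).
  by rewrite /sups/=; congr sup; apply/seteqP; split => _ [n _ <-]; exists n.
apply/eqP; rewrite eq_le; apply/andP; split.
  apply: (@mdist_le_dense _ _ dense_seq _ _ _ (@dense_seqP)) => n.
  apply: ub_le_sup => //.
by apply: ge_sup; [exists (k 0%N z); exists 0%N|move=> _ [n _ <-]; exact: ler_dist_mdist].
Qed.

Lemma measurable_cev_eval t :
  measurable_fun setT (fun g : borel (curve X) => cev g t : borel X).
Proof.
apply: (@continuous_borel_measurable (curve X) X (fun g => cev g t)).
exact: cev_eval_continuous.
Qed.

Lemma measurable_cev :
  measurable_fun setT (fun gt : borel (curve X) * R => cev gt.1 gt.2 : borel X).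
Proof.
apply: measurable_borel_mdist => n.
apply: (@measurable_caratheodory R _ (borel (curve X)) (fun g t => mdist (cev g t) (dense_seq n))).
  move=> t; apply: measurable_mdist; last exact: measurable_cst.
  exact: measurable_cev_eval.
move=> g t; apply: (@continuous_comp _ _ _ (cev g) (fun x => mdist x (dense_seq n))).
  exact: cev_continuous.
exact: mdist_continuous_l.
Qed.

End separable_space.

(** * Measurability of the metric speed *)

Section punctured_limit.
Context {R : realType}.

Let small (n : nat) (a : rat) := 0 < `|ratr a : R| < n.+1%:R^-1.

Lemma invS_lt (e : R) : 0 < e -> exists n : nat, n.+1%:R^-1 < e.
Proof.
move=> e0; exists (Num.truncn e^-1).
by rewrite invf_plt ?posrE//; exact: truncnS_gt.
Qed.

(** Existence of a limit at 0 is a countable condition, as needed for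
    measurability. *)
Lemma is_cvg_dnbhs0_ratP (q : R -> R) : (forall h, h != 0 -> {for h, continuous q}) ->
  cvg (q h @[h --> 0^']) <->
  forall k : nat, exists n : nat, forall ab : rat * rat,
    small n ab.1 -> small n ab.2 ->
    `|q (ratr ab.1) - q (ratr ab.2)| <= k.+1%:R^-1.
Proof.
move=> cq; split=> [/cvg_ex[l /cvgrPdist_lt ql] k|H].
  have k0 : 0 < k.+1%:R^-1 / 2 :> R by rewrite divr_gt0// invr_gt0.
  have [d /= d0 dP] := ql _ k0; have [n nd] := invS_lt d0.
  exists n => -[a b] /=.
  have aux (c : rat) : small n c -> `|l - q (ratr c)| < k.+1%:R^-1 / 2.
    move=> /andP[c0 cn]; apply: dP; last by rewrite -normr_gt0.
    by rewrite /= sub0r normrN (lt_trans cn).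
  move=> /aux a1 /aux b1; rewrite (splitr k.+1%:R^-1).
  by rewrite (le_trans (ler_distD l _ _))// distrC lerD// ltW.
apply/cauchy_cvgP/cauchy_exP => e e0.
have [k ke] := invS_lt e0; have [n nP] := H k.
have n0 : 0 < n.+1%:R^-1 :> R by rewrite invr_gt0.
have [a] := rat_in_itvoo n0; rewrite in_itv/= => /andP[a0 an].
have sa : small n a by rewrite /small gtr0_norm// a0.
exists (q (ratr a)).
have dn : \forall h \near (0:R)^', h != 0 /\ `|h| < n.+1%:R^-1.
  exists n.+1%:R^-1 => //= h /=; rewrite sub0r normrN => hn h0.
  by split.
rewrite /= /nbhs /=; apply: filterS dn => h [hn0 hn].
rewrite /= /ball/=; apply: le_lt_trans ke; rewrite leNgt; apply/negP => qh.
have hh : {for h, continuous q} by exact: cq.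
have : \forall x \near h, k.+1%:R^-1 < `|q (ratr a) - q x|.
  have cc : `|q (ratr a) - q x| @[x --> h] --> `|q (ratr a) - q h|.
    by apply: cvg_norm; apply: cvgB; [exact: cvg_cst|exact: hh].
  exact: (cvgr_gt _ cc).
have nh : `|x| @[x --> (h : R)] --> `|h : R| by apply: cvg_norm; exact: cvg_id.
have : \forall x \near (h : R), 0 < `|x|.
  by apply: (cvgr_gt _ nh); rewrite normr_gt0.
have : \forall x \near (h : R), `|x| < n.+1%:R^-1 by exact: (cvgr_lt _ nh).
move=> A B C.
have : nbhs (h : R) ([set x | `|x| < n.+1%:R^-1] `&` ([set x | 0 < `|x|] `&`
    [set x | k.+1%:R^-1 < `|q (ratr a) - q x|])).
  exact: filterI A (filterI B C).
move=> /nbhs_ballP[d /= d0 dP].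
have hd : (h : R) < h + d by rewrite ltrDl.
have [b] := rat_in_itvoo hd; rewrite in_itv/= => /andP[b1 b2].
have [|H1 [H2]] := dP (ratr b).
  by rewrite /ball/= ltr0_norm ?subr_lt0//; lra.
apply/negP; rewrite -leNgt; apply: (nP (a, b)) => //=.
by rewrite /small H1 H2.
Qed.

End punctured_limit.

Section speed_on_line.
Context {R : realType} {X : completeMetricType R}.
Implicit Types (g : curve X) (s t : R).

Definition speed_quotient g t h := mdist (cev g (t + h)) (cev g t) / `|h|.

Lemma metric_speedE g t : 0 < t < 1 ->
  metric_speed g t = lim (speed_quotient g t h @[h --> 0^']).
Proof.
move=> /andP[t0 t1]; rewrite /metric_speed; congr (lim _).
have in01 : \forall h \near (0:R)^', 0 <= t + h <= 1.
  have d0 : 0 < Num.min t (1 - t) by rewrite lt_min t0 subr_gt0.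
  exists (Num.min t (1 - t)) => //= h /=.
  by rewrite sub0r normrN lt_min !ltr_norml => /andP[/andP[? ?] /andP[? ?]] _; apply/andP; split; lra.
have tt : 0 <= t <= 1 by rewrite !ltW.
apply/seteqP; split=> [A|A] /=; rewrite /nbhs/= /within/=.
  move=> H; apply: filterS2 in01 H => h h01 /(_ _)/=.
  rewrite /unit_itv/= in_itv/= => /(_ h01).
  by rewrite !curve_evalE.
move=> H; apply: filterS2 in01 H => h h01 + _.
by rewrite !curve_evalE.
Qed.

(** The metric speed on ]0, 1[ only: there the increments stay in [0, 1], and the
    value 0 elsewhere turns integrals over [0, 1] into integrals over the line. *)
Definition speed g t : R := if 0 < t < 1 then metric_speed g t else 0.

Lemma speed_quotient_ge0 g t h : 0 <= speed_quotient g t h.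
Proof. by rewrite divr_ge0// mdist_ge0. Qed.

Lemma speed_ge0 g t : 0 <= speed g t.
Proof.
rewrite /speed; case: ifPn => // t01; rewrite metric_speedE//.
have [c|nc] := pselect (cvg (speed_quotient g t h @[h --> 0^'])).
  by apply: limr_ge => //; near=> h; exact: speed_quotient_ge0.
by rewrite dvgP.
Unshelve. all: by end_near. Qed.

Lemma speed_quotient_continuous g t h : h != 0 ->
  {for h, continuous (speed_quotient g t)}.
Proof.
move=> h0; apply: cvgM.
  have cth : {for h, continuous (fun h => cev g (t + h))}.
    apply: (@continuous_comp _ _ _ (fun h => t + h) (cev g)).
      by apply: cvgD; [exact: cvg_cst|exact: cvg_id].
    exact: cev_continuous.
  apply: (@continuous_comp _ _ _ (fun h => cev g (t + h)) (fun x => mdist x (cev g t))).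
    exact: cth.
  exact: mdist_continuous_l.
by apply: cvgV; [rewrite normr_eq0|apply: cvg_norm; exact: cvg_id].
Qed.

Hypothesis sX : separable X.

Lemma measurable_speed_quotient h :
  measurable_fun setT (fun gt : borel (curve X) * R => speed_quotient gt.1 gt.2 h).
Proof.
apply: measurable_funM; last exact: measurable_cst.
apply: (measurable_mdist sX); last exact: measurable_cev.
apply: (@measurableT_comp _ _ _ _ _ _
  (fun gt : borel (curve X) * R => cev gt.1 gt.2 : borel X) _
  (fun gt : borel (curve X) * R => (gt.1, gt.2 + h))).
  exact: measurable_cev.
apply/measurable_fun_pairP; split; first exact: measurable_fst.
by apply: measurable_funD; [exact: measurable_snd|exact: measurable_cst].
Qed.

(** The difference quotients along 1/(n+1) converge to the speed on the measurable
    set where the limit exists; elsewhere the limit has a constant junk value. *)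
Lemma measurable_speed :
  measurable_fun setT (fun gt : borel (curve X) * R => speed gt.1 gt.2).
Proof.
pose E := [set gt : borel (curve X) * R |
  cvg (speed_quotient gt.1 gt.2 h @[h --> 0^'])].
pose I := (snd @^-1` `]0, 1[%classic : set (borel (curve X) * R)).
have mI : measurable I.
  by rewrite -[X in measurable X]setTI; apply: measurable_snd.
have mE : measurable E.
  rewrite [X in measurable X](_ : _ = \bigcap_(k : nat) \bigcup_(n : nat)
    \bigcap_(ab : rat * rat) [set gt | 0 < `|ratr ab.1 : R| < n.+1%:R^-1 ->
    0 < `|ratr ab.2 : R| < n.+1%:R^-1 ->
    `|speed_quotient gt.1 gt.2 (ratr ab.1) - speed_quotient gt.1 gt.2 (ratr ab.2)|
      <= k.+1%:R^-1]); last first.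
    apply/seteqP; split=> [gt|gt] H /=.
      move=> k _; have /is_cvg_dnbhs0_ratP := H.
      move=> /(_ (@speed_quotient_continuous gt.1 gt.2) k)[n nP].
      by exists n => // ab _; exact: nP.
    apply/is_cvg_dnbhs0_ratP; first exact: speed_quotient_continuous.
    by move=> k; have [n _ nP] := H k Logic.I; exists n => ab; exact: nP.
  apply: bigcap_countable_measurable => k; apply: bigcup_countable_measurable => n.
  apply: bigcap_countable_measurable => -[a b] /=.
  have [an|] := boolP (0 < `|ratr a : R| < n.+1%:R^-1); last first.
    move=> an; rewrite [X in measurable X](_ : _ = setT)//.
    exact/seteqP.
  have [bn|] := boolP (0 < `|ratr b : R| < n.+1%:R^-1); last first.
    move=> bn; rewrite [X in measurable X](_ : _ = setT)//.
    exact/seteqP.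
  pose f := fun gt : borel (curve X) * R =>
     `|speed_quotient gt.1 gt.2 (ratr a) - speed_quotient gt.1 gt.2 (ratr b)|.
  have mf : measurable_fun setT f.
    apply: measurableT_comp => //.
    by apply: measurable_funB; exact: measurable_speed_quotient.
  have := mf measurableT _ (measurable_itv `]-oo, (k.+1%:R^-1)]).
  rewrite setTI; congr measurable; apply/seteqP; split => gt /=; rewrite in_itv/= => H.
    by [].
  exact: H.
pose d (n : nat) : R := n.+1%:R^-1.
pose F n (gt : borel (curve X) * R) : R :=
  speed_quotient gt.1 gt.2 (d n) * \1_(E `&` I) gt.
apply: (@measurable_fun_cvg _ _ R _ F) => /=.
  move=> n; apply: measurable_funM; first exact: measurable_speed_quotient.
  by apply: measurable_indic; exact: measurableI.
move=> [g t] _ /=; rewrite /F indicE /speed /=.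
have [t01|t01] := boolP (0 < t < 1); last first.
  rewrite memNset ?mulr0; last first.
    by move=> -[_]; rewrite /I/= in_itv/=; exact/negP.
  by under eq_fun do rewrite mulr0; exact: cvg_cst.
rewrite metric_speedE//.
have [c|nc] := pselect (E (g, t)); last first.
  rewrite memNset; last by move=> -[].
  by under eq_fun do rewrite mulr0; rewrite dvgP//; exact: cvg_cst.
rewrite mem_set; last by split => //; rewrite /I/= in_itv.
under eq_fun do rewrite mulr1.
have dcvg : d n @[n --> \oo] --> (0 : R)^'.
  move=> A [e /= e0 eA]; have [n nd] := invS_lt e0.
  exists n => // m /= nm; apply: eA => /=.
    rewrite sub0r normrN gtr0_norm ?invr_gt0//; apply: le_lt_trans nd.
    by rewrite lef_pV2 ?posrE// ler_nat.
  by rewrite /d invr_eq0 pnatr_eq0.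
by move: c; rewrite /E/= => /cvg_ex[l ql]; rewrite (cvg_lim _ ql)//; apply: cvg_comp dcvg ql.
Qed.

End speed_on_line.

(** * Energy and length of a curve *)

Section lower_integral.
Context d (T : measurableType d) {R : realType} (mu : {measure set T -> \bar R}).
Local Open Scope ereal_scope.
Import HBNNSimple.

(** The integral of a nonnegative function that need not be measurable is a
    supremum over measurable functions below it. *)
Lemma ge0_le_integral_lower (f1 f2 : T -> \bar R) : (forall x, 0 <= f1 x) ->
  (forall x, f1 x <= f2 x) -> \int[mu]_x f1 x <= \int[mu]_x f2 x.
Proof.
move=> f10 f12; have f20 x : 0 <= f2 x by exact: le_trans (f12 x).
rewrite !ge0_integralTE//; apply: le_ereal_sup => _ [h hf <-].
by exists h => // x; exact: le_trans (f12 x).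
Qed.

(** Used for the energy of curves, which is treated as a possibly nonmeasurable
    function. *)
Lemma integral_lower_ub (f : T -> \bar R) (c : \bar R) : (forall x, 0 <= f x) ->
  (forall g : T -> R, measurable_fun setT g -> (forall x, (0 <= g x)%R) ->
    (forall x, (g x)%:E <= f x) -> \int[mu]_x (g x)%:E <= c) ->
  \int[mu]_x f x <= c.
Proof.
move=> f0 H; rewrite ge0_integralTE//; apply: ge_ereal_sup => _ [h hf <-].
rewrite -integralT_nnsfun; apply: H => // x.
Qed.

End lower_integral.

Section plan_map.
Context {R : realType} {X Y : completeMetricType R}.
Local Open Scope ereal_scope.
Variables (pi : probability (borel (curve X)) R)
  (F : borel (curve X) -> borel (curve Y)) (mF : measurable_fun setT F).

Definition plan_map : probability (borel (curve Y)) R :=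
  distribution pi (HB.pack F (isMeasurableFun.Build _ _ _ _ F mF)
    : {mfun borel (curve X) >-> borel (curve Y)}).

Lemma plan_mapE A : plan_map A = pi (F @^-1` A).
Proof. by []. Qed.

Lemma ge0_integral_plan_map (f : borel (curve Y) -> \bar R) :
  measurable_fun setT f -> (forall y, 0 <= f y) ->
  \int[plan_map]_y f y = \int[pi]_x f (F x).
Proof. by move=> mf f0; rewrite ge0_integral_pushforward. Qed.

Lemma integral_plan_map_lower (f : borel (curve Y) -> \bar R) :
  (forall y, 0 <= f y) -> \int[plan_map]_y f y <= \int[pi]_x f (F x).
Proof.
move=> f0; apply: integral_lower_ub => // g mg g0 gf.
rewrite ge0_integral_plan_map//; last exact/measurable_EFinP.
by apply: ge0_le_integral_lower => // x; rewrite lee_fin.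
Qed.

End plan_map.

Section energy.
Context {R : realType} {X : completeMetricType R}.
Hypothesis sX : separable X.
Local Notation mu := (@lebesgue_measure R).

Lemma measurable_speed1 (g : curve X) : measurable_fun setT (speed g).
Proof. exact: (measurable_fun_pair2 (g : borel (curve X)) (measurable_speed sX)). Qed.

Lemma integral_unit_itvE (f1 f2 : R -> \bar R) : measurable_fun setT f2 ->
  (forall t, 0 < t < 1 -> f1 t = f2 t) -> (forall t, ~~ (0 < t < 1) -> f2 t = 0%E) ->
  (\int[mu]_(t in unit_itv R) f1 t = \int[mu]_t f2 t)%E.
Proof.
move=> mf2 f12 f20.
have mf1 : measurable_fun (`]0%R, 1%R[ : set R) f1.
  apply: (@eq_measurable_fun _ _ _ _ _ f2); last exact: measurable_funTS.
  by move=> t; rewrite inE/= in_itv/= => t01; rewrite f12.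
rewrite /unit_itv (@integral_itv_bndoo _ 0 1 f1 true false mf1).
rewrite [RHS](_ : _ = \int[mu]_t (f2 \_ (`]0%R, 1%R[ : set R)) t)%E.
  rewrite -integral_mkcond; apply: eq_integral => t.
  by rewrite inE/= in_itv/= => t01; rewrite f12.
apply: eq_integral => t _; rewrite patchE; case: ifPn => //.
by rewrite notin_setE/= in_itv/= => /negP; exact: f20.
Qed.

Lemma speed_out (g : curve X) t : ~~ (0 < t < 1) -> speed g t = 0.
Proof. by rewrite /speed => /negbTE ->. Qed.

Lemma speed_in (g : curve X) t : 0 < t < 1 -> speed g t = metric_speed g t.
Proof. by rewrite /speed => ->. Qed.

Lemma energyE (g : curve X) : abs_cont g ->
  (energy g = \int[mu]_t ((speed g t) ^+ 2)%:E)%E.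
Proof.
move=> ac; rewrite /energy asboolT//; apply: integral_unit_itvE.
- by apply/measurable_EFinP; apply: measurable_funX; exact: measurable_speed1.
- by move=> t t01; rewrite speed_in.
- by move=> t t01; rewrite speed_out// expr0n.
Qed.

Lemma energy_ge_speed (g : curve X) : (\int[mu]_t ((speed g t) ^+ 2)%:E <= energy g)%E.
Proof.
have [/energyE ->//|nac] := pselect (abs_cont g).
by rewrite /energy asboolF// leey.
Qed.

Lemma measurable_cev1 (g : curve X) : measurable_fun setT (cev g : R -> borel X).
Proof. exact: (measurable_fun_pair2 (g : borel (curve X)) (measurable_cev sX)). Qed.

Lemma curve_integralE (G : borel X -> R) (g : curve X) : measurable_fun setT G ->
  (\int[mu]_(t in unit_itv R) (G (curve_eval t g) * metric_speed g t)%:E =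
   \int[mu]_t (G (cev g t) * speed g t)%:E)%E.
Proof.
move=> mG; apply: integral_unit_itvE.
- apply/measurable_EFinP; apply: measurable_funM; last exact: measurable_speed1.
  exact: (measurableT_comp mG (measurable_cev1 g)).
- move=> t t01; rewrite speed_in// curve_evalE//.
  by case/andP : t01 => *; rewrite !ltW.
- by move=> t t01; rewrite speed_out// mulr0.
Qed.

(** Almost everywhere the metric speed is the density of metric_derivative_ae. *)
Lemma abs_cont_mdist_le (g : curve X) : abs_cont g ->
  ((mdist (cev g 0) (cev g 1))%:E <= \int[mu]_t (speed g t)%:E)%E.
Proof.
move=> [h [ih hP]].
have FF := ae_filter_ringOfSetsType mu.
pose k := (fun t => `|h t|) \_ (unit_itv R).
have mI : measurable (unit_itv R) by exact: measurable_itv.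
have k0 t : 0 <= k t by rewrite /k patchE; case: ifPn.
have ik : mu.-integrable setT (EFin \o k).
  rewrite /k -restrict_EFin; apply/integrable_restrict => //; rewrite setTI.
  exact: integrable_norm.
have ck s t : s <= t -> mdist (cev g s) (cev g t) <= \int[mu]_(x in `]s, t]) k x.
  move=> st; rewrite -lee_fin.
  have cst := le_clamp01 st.
  have /andP[s0 s1] := clamp01_itv s; have /andP[t0 t1] := clamp01_itv t.
  rewrite -(cev_clamp g s) -(cev_clamp g t).
  rewrite -!curve_evalE ?clamp01_itv//.
  apply: (le_trans (hP _ _ s0 cst t1)).
  have sub01 : `[clamp01 s, clamp01 t]%classic `<=` unit_itv R.
    move=> x; rewrite /unit_itv/= !in_itv/= => /andP[sx xt].
    by rewrite (le_trans s0)//= (le_trans xt).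
  have ih' : mu.-integrable `[clamp01 s, clamp01 t] (EFin \o h) by exact: integrableS ih.
  apply: (@le_trans _ _ (\int[mu]_(r in `[clamp01 s, clamp01 t]) `|h r|%:E)%E).
    apply: (le_trans (lee_abs _)).
    by apply: (le_abse_integral _ _ _) => //; exact: measurable_int ih'.
  rewrite /Rintegral fineK; last first.
    by apply: integrable_fin_num => //; exact: integrableS ik.
  have subst : `]clamp01 s, clamp01 t]%classic `<=` `]s, t]%classic.
    move=> x; rewrite /= !in_itv/= => /andP[sx xt]; move: sx xt.
    rewrite /clamp01 gt_max gt_min le_max le_min => /andP[x0].
    move=> sx /orP[x0'|/andP[x1 xt]]; first by move: x0; rewrite ltNge x0'.
    by case/orP: sx => [x1'|->//]; move: x1'; rewrite ltNge x1.
  rewrite [leLHS](_ : _ =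
      \int[mu]_(x in `]clamp01 s, clamp01 t]) (k x)%:E)%E; last first.
    rewrite integral_itv_obnd_cbnd; last first.
      by apply: measurable_funTS; exact: measurable_int ik.
    apply: eq_integral => x; rewrite inE/= => xst.
    by rewrite /k patchE mem_set//; apply: sub01.
  apply: ge0_subset_integral => //.
  - by apply: measurable_funTS; exact: measurable_int ik.
  - by move=> x _; rewrite lee_fin.
have [m [im m0 mP mS]] := metric_derivative_ae (dense_seqP sX) k0 ik ck.
have := mP _ _ ler01; rewrite -lee_fin => /le_trans; apply.
rewrite /Rintegral fineK; last by apply: integrable_fin_num => //; exact: integrableS im.
have mm : measurable_fun setT m by apply/measurable_EFinP; exact: measurable_int im.
have ms := measurable_speed1 g.
rewrite (@integral_itv_bndoo _ 0 1 _ false false); last first.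
  by apply/measurable_EFinP; exact: measurable_funTS.
apply: (@le_trans _ _ (\int[mu]_(t in `]0%R, 1%R[) (speed g t)%:E)%E).
  apply: ae_ge0_le_integral => //.
  - by move=> t _; rewrite lee_fin.
  - by apply/measurable_EFinP; exact: measurable_funTS.
  - by move=> t _; rewrite lee_fin speed_ge0.
  - by apply/measurable_EFinP; exact: measurable_funTS.
  - apply: filterS mS => t mt; rewrite /= in_itv/= => t01.
    rewrite speed_in// metric_speedE// lee_fin.
    by rewrite (cvg_lim _ mt).
apply: ge0_subset_integral => //; first exact/measurable_EFinP.
by move=> t _; rewrite lee_fin speed_ge0.
Qed.

End energy.

(** * Stopped curves *)

Section stopping.
Context {R : realType} {X : completeMetricType R}.
Implicit Types (g : curve X) (s t r : R).
Local Notation mu := (@lebesgue_measure R).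

Definition clamp s t r := Num.max s (Num.min t r).

Lemma clamp_continuous s t : continuous (clamp s t).
Proof.
move=> r; rewrite /clamp.
have c0 : {for r, continuous (cst s : R -> R^o)} by exact: cvg_cst.
have c1 : {for r, continuous (cst t : R -> R^o)} by exact: cvg_cst.
have ci : {for r, continuous (id : R -> R^o)} by exact: cvg_id.
exact: (continuous_max c0 (continuous_min c1 ci)).
Qed.

Lemma clamp_itv s t r : s <= t -> s <= clamp s t r <= t.
Proof. by move=> st; rewrite /clamp le_max lexx ge_max st ge_min lexx. Qed.

Lemma clamp_in s t r : s <= r <= t -> clamp s t r = r.
Proof. by move=> /andP[sr rt]; rewrite /clamp (min_idPr rt) (max_idPr sr). Qed.

Lemma clamp_lo s t r : s <= t -> r <= s -> clamp s t r = s.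
Proof.
move=> st rs; rewrite /clamp (min_idPr _) ?(le_trans rs)//.
exact/max_idPl.
Qed.

Lemma clamp_hi s t r : s <= t -> t <= r -> clamp s t r = t.
Proof. by move=> st tr; rewrite /clamp (min_idPl tr); exact/max_idPr. Qed.

Lemma le_clamp s t : {homo clamp s t : x y / x <= y}.
Proof.
move=> x y xy; rewrite /clamp ge_max le_max lexx/= le_max.
by apply/orP; right; rewrite le_min !ge_min lexx xy !orbT.
Qed.

Lemma clamp_sub_itv s t x y :
  `]clamp s t x, clamp s t y]%classic `<=` `]x, y]%classic.
Proof.
move=> z; rewrite /= !in_itv/= => /andP[sx xt]; move: sx xt.
rewrite /clamp gt_max gt_min le_max le_min => /andP[z0].
move=> sx /orP[z0'|/andP[z1 zt]]; first by move: z0; rewrite ltNge z0'.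
by case/orP: sx => [z1'|->//]; move: z1'; rewrite ltNge z1.
Qed.

Lemma stop_curve_subproof s t g : continuous (fun r => cev g (clamp s t r)).
Proof.
move=> r; apply: (@continuous_comp _ _ _ (clamp s t) (cev g)).
  exact: clamp_continuous.
exact: cev_continuous.
Qed.

(** The curve that rests until time s, follows g on [s, t] and rests again:
    restricting g to [s, t] in this way needs no change of variables. *)
Definition stop_curve s t g : curve X := mkcurve (@stop_curve_subproof s t g).

Lemma cev_stop_curve s t g r : cev (stop_curve s t g) r = cev g (clamp s t (clamp01 r)).
Proof. exact: cev_mkcurve. Qed.

Lemma stop_curve_continuous s t : continuous (stop_curve s t).
Proof.
by apply: curve_nbhs_continuous => g g' e H r; rewrite !cev_stop_curve.
Qed.

Lemma cev_stop_curve0 s t g : 0 <= s <= t -> cev (stop_curve s t g) 0 = cev g s.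
Proof.
move=> /andP[s0 st]; have h0 : 0 <= (0:R) <= 1 by rewrite lexx ler01.
by rewrite cev_stop_curve (clamp01_id h0) clamp_lo.
Qed.

Lemma cev_stop_curve1 s t g : s <= t <= 1 -> cev (stop_curve s t g) 1 = cev g t.
Proof.
move=> /andP[st t1]; have h1 : 0 <= (1:R) <= 1 by rewrite lexx ler01.
by rewrite cev_stop_curve (clamp01_id h1) clamp_hi.
Qed.

Lemma stop_curve_abs_cont s t g : 0 <= s -> s <= t -> t <= 1 ->
  abs_cont g -> abs_cont (stop_curve s t g).
Proof.
move=> s0 st t1 [h [ih hP]].
have mI : measurable (unit_itv R) by exact: measurable_itv.
exists (fun r => `|h r|); split; first exact: integrable_norm.
move=> x y x0 xy y1.
have x01 : 0 <= x <= 1 by rewrite x0 (le_trans xy).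
have y01 : 0 <= y <= 1 by rewrite y1 (le_trans x0).
have cxy := le_clamp s t xy.
have /andP[sx xt] := clamp_itv x st; have /andP[sy yt] := clamp_itv y st.
have cx0 : 0 <= clamp s t x by exact: le_trans sx.
have cy1 : clamp s t y <= 1 by exact: le_trans t1.
have cx01 : 0 <= clamp s t x <= 1 by rewrite cx0 (le_trans xt).
have cy01 : 0 <= clamp s t y <= 1 by rewrite cy1 (le_trans s0).
rewrite !curve_evalE// !cev_stop_curve (clamp01_id x01) (clamp01_id y01).
rewrite -!curve_evalE//.
apply: (le_trans (hP _ _ cx0 cxy cy1)).
have ih1 : mu.-integrable `[clamp s t x, clamp s t y] (EFin \o h).
  apply: (@integrableS _ _ _ mu (unit_itv R)) => //.
  by move=> z; rewrite /unit_itv/= !in_itv/= => /andP[sz zt];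
     rewrite (le_trans cx0)//= (le_trans zt).
have ih2 : mu.-integrable `[x, y] (EFin \o (fun r => `|h r|)).
  apply: (@integrableS _ _ _ mu (unit_itv R)) => //; last exact: integrable_norm.
  by move=> z; rewrite /unit_itv/= !in_itv/= => /andP[sz zt];
     rewrite (le_trans x0)//= (le_trans zt).
have ih1' := integrable_norm ih1.
apply: (@le_trans _ _ (\int[mu]_(r in `[clamp s t x, clamp s t y]) `|h r|%:E)%E).
  apply: (le_trans (lee_abs _)).
  by apply: (le_abse_integral _ _ _) => //; exact: measurable_int ih1.
rewrite -[leLHS]integral_itv_obnd_cbnd; last first.
  apply: (measurable_funS _ _ (measurable_int _ ih1')) => //.
  by apply: subset_itvr; rewrite bnd_simp.
rewrite -[leRHS]integral_itv_obnd_cbnd; last first.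
  apply: (measurable_funS _ _ (measurable_int _ ih2)) => //.
  by apply: subset_itvr; rewrite bnd_simp.
apply: ge0_subset_integral => //; last exact: clamp_sub_itv.
apply: (measurable_funS _ _ (measurable_int _ ih2)) => //.
by apply: subset_itvr; rewrite bnd_simp.
Qed.

Lemma speed_eq_near g g' r : 0 < r < 1 ->
  (\forall x \near r, cev g x = cev g' x) -> speed g r = speed g' r.
Proof.
move=> r01 gg'; rewrite !speed_in// !metric_speedE//; congr (lim _).
have gr : cev g r = cev g' r by exact: (nbhs_singleton gg').
have /nbhs_ballP[e /= e0 eP] := gg'.
have H : \forall h \near (0:R)^', speed_quotient g r h = speed_quotient g' r h.
  exists e => //= h /=; rewrite sub0r normrN => he _.
  rewrite /speed_quotient gr (eP (r + h))//.
  by rewrite /ball/= opprD addrA subrr sub0r normrN.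
by apply/seteqP; split=> A /= HA; rewrite /nbhs/=; apply: filterS2 H HA => h /= E;
  rewrite ?E// -?E.
Qed.

Lemma speed_cst_near g (y : X) r : 0 < r < 1 ->
  (\forall x \near r, cev g x = y) -> speed g r = 0.
Proof.
move=> r01 gy; rewrite speed_in// metric_speedE//.
have gr : cev g r = y by exact: (nbhs_singleton gy).
have /nbhs_ballP[e /= e0 eP] := gy.
apply: cvg_lim => //; apply: (cvg_near_cst (0 : R)).
exists e => //= h /=; rewrite sub0r normrN => he _.
rewrite /speed_quotient gr (eP (r + h)) ?mdistxx ?mul0r//.
by rewrite /ball/= opprD addrA subrr sub0r normrN.
Qed.

Lemma speed_stop_curve s t g r : 0 <= s -> s <= t -> t <= 1 -> r != s -> r != t ->
  speed (stop_curve s t g) r = speed g r * \1_(`]s, t[%classic) r.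
Proof.
move=> s0 st t1 rs rt; rewrite indicE.
have [r01|r01] := boolP (0 < r < 1); last by rewrite !speed_out// mul0r.
have near01 : \forall x \near r, 0 <= x <= 1.
  have : r \in `]0, 1[ by rewrite in_itv.
  by move/near_in_itvoo; apply: filterS => x; rewrite in_itv/= => /andP[? ?]; rewrite !ltW.
have [rs'|sr] := ltP r s.
  rewrite memNset ?mulr0; last by rewrite /= in_itv/= ltNge ltW.
  apply: (@speed_cst_near _ (cev g s)) => //.
  have : \forall x \near r, x < s by exact: lt_nbhsl.
  apply: filterS2 near01 => x x01 xs.
  by rewrite cev_stop_curve clamp01_id// clamp_lo// ltW.
have [rt'|tr] := ltP t r.
  rewrite memNset ?mulr0; last by rewrite /= in_itv/= (ltNge r t) (ltW rt') andbF.
  apply: (@speed_cst_near _ (cev g t)) => //.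
  have : \forall x \near r, t < x by exact: lt_nbhsr.
  apply: filterS2 near01 => x x01 xs.
  by rewrite cev_stop_curve clamp01_id// clamp_hi// ltW.
have rst : r \in `]s, t[ by rewrite in_itv/= !lt_neqAle eq_sym rs sr rt tr.
rewrite mem_set ?mulr1//.
apply: speed_eq_near => //.
have := near_in_itvoo rst.
apply: filterS2 near01 => x x01 xst.
rewrite cev_stop_curve clamp01_id// clamp_in//.
by move: xst; rewrite in_itv/= => /andP[sx xt]; rewrite !ltW.
Qed.

Hypothesis sX : separable X.

(** At the two stopping times the speed of the stopped curve is arbitrary. *)
Lemma integral_ignore2 (f1 f2 : R -> \bar R) (s t : R) : measurable_fun setT f1 ->
  measurable_fun setT f2 -> (forall r, r != s -> r != t -> f1 r = f2 r) ->
  (\int[mu]_r f1 r = \int[mu]_r f2 r)%E.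
Proof.
move=> m1 m2 f12; apply: ae_eq_integral => //.
exists ([set s] `|` [set t]); split.
- exact: measurableU.
- apply/eqP; rewrite -measure_le0.
  rewrite (le_trans (measureU2 _ _ _))//=.
  by rewrite !lebesgue_measure_set1 adde0.
- move=> r /= H; apply: contrapT => /not_orP[/eqP rs /eqP rt].
  by apply: H => _; exact: f12.
Qed.

Lemma energy_stop_curve s t g : 0 <= s -> s <= t -> t <= 1 ->
  (energy (stop_curve s t g) <= energy g)%E.
Proof.
move=> s0 st t1; have [ac|nac] := pselect (abs_cont g); last first.
  by rewrite [leRHS]/energy asboolF// leey.
have m2 (g' : curve X) : measurable_fun setT (fun r => ((speed g' r) ^+ 2)%:E).
  by apply/measurable_EFinP; apply: measurable_funX; exact: measurable_speed1.
rewrite (energyE sX ac) (energyE sX (stop_curve_abs_cont s0 st t1 ac)).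
have mI : measurable_fun setT (\1_(`]s, t[%classic) : R -> R) by exact: measurable_indic.
have m3 : measurable_fun setT (fun r => ((speed g r * \1_(`]s, t[%classic) r) ^+ 2)%:E).
  apply/measurable_EFinP; apply: measurable_funX; apply: measurable_funM => //.
  exact: measurable_speed1.
rewrite (@integral_ignore2 _ _ s t (m2 _) m3); last first.
  by move=> r rs rt; rewrite speed_stop_curve.
apply: ge0_le_integral; [exact: measurableT| |exact: m3|exact: m2|].
  by move=> r _; rewrite lee_fin sqr_ge0.
by move=> r _; rewrite lee_fin exprMn -[leRHS]mulr1 ler_wpM2l ?sqr_ge0//.
Qed.

End stopping.

(** * Test plans and the upper gradient inequality *)

Section square_integrable.
Context d (T : measurableType d) {R : realType} (m : {measure set T -> \bar R}).
Local Open Scope ereal_scope.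

Lemma poweR2_sqr (x : \bar R) : 0 <= x -> x `^ 2%R = x ^+ 2.
Proof.
case: x => [r||//]; last by rewrite poweRyr ?pnatr_eq0// expe2 mulyy.
by rewrite lee_fin => r0; rewrite poweR_EFin powR_mulrn// -EFin_expe.
Qed.

Lemma poweR_Lnorm2 (f : T -> R) :
  'N[m]_2%:E [EFin \o f] `^ 2%R = \int[m]_x ((f x) ^+ 2)%:E.
Proof.
rewrite poweR_Lnorm ?pnatr_eq0//; apply: eq_integral => x _ /=.
by rewrite powR_mulrn// -normrX ger0_norm ?sqr_ge0.
Qed.

Lemma Lnorm2_sqr (f : T -> R) :
  'N[m]_2%:E [EFin \o f] ^+ 2 = \int[m]_x ((f x) ^+ 2)%:E.
Proof. by rewrite -poweR_Lnorm2 poweR2_sqr// Lnorm_ge0. Qed.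

Lemma Lfun2P (f : T -> R) : f \in Lfun m 2%:E <->
  measurable_fun setT f /\ \int[m]_x ((f x) ^+ 2)%:E < +oo.
Proof.
rewrite -poweR_Lnorm2; split=> [fL|[mf fL]].
  have /[!inE] mf := sub_Lfun_mfun fL.
  have /[!inE] nf := sub_Lfun_finLfun fL.
  by split => //; exact: poweR_lty.
rewrite inE/=; apply/andP; split; rewrite inE/=; first exact: mf.
by apply: lty_poweRy fL; rewrite pnatr_eq0.
Qed.

End square_integrable.

Section plans.
Context {R : realType} (X : mmSpace R).
Local Open Scope ereal_scope.
Local Notation mu := (@lebesgue_measure R).
Let sX : separable X := mms_separable X.
Implicit Types (pi : probability (borel (curve X)) R) (G f : borel X -> R).

Definition plan_time pi : {measure set (borel (curve X) * measurableTypeR R)%type -> \bar R} :=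
  (pi \x mu)%E.

Definition integrand G (z : borel (curve X) * R) : R :=
  (G (cev z.1 z.2) * speed z.1 z.2)%R.

(** The right-hand side of the weak upper gradient inequality, as an integral
    over the product of the plan with time. *)
Definition flow pi G : \bar R := \int[plan_time pi]_z (integrand G z)%:E.

Lemma measurable_integrand G : measurable_fun setT G ->
  measurable_fun setT (integrand G).
Proof.
move=> mG; apply: measurable_funM; last exact: measurable_speed.
exact: (measurableT_comp mG (measurable_cev sX)).
Qed.

Lemma integrand_ge0 G z : (forall x, 0 <= G x)%R -> (0 <= integrand G z)%R.
Proof. by move=> G0; rewrite mulr_ge0// speed_ge0. Qed.

Lemma flow_curves pi G : measurable_fun setT G -> (forall x, 0 <= G x)%R ->
  \int[pi]_g \int[mu]_(t in unit_itv R) (G (curve_eval t g) * metric_speed g t)%:E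
  = flow pi G.
Proof.
move=> mG G0.
have mI : measurable_fun setT
    (fun z : borel (curve X) * measurableTypeR R => (integrand G z)%:E).
  by apply/measurable_EFinP; exact: measurable_integrand.
have I0 z : 0 <= (integrand G z)%:E by rewrite lee_fin integrand_ge0.
rewrite /flow /plan_time (fubini_tonelli1 _ mI I0) /fubini_F /=.
by apply: eq_integral => g _; rewrite (curve_integralE sX).
Qed.

Lemma test_plan_speed pi : test_plan pi ->
  \int[plan_time pi]_z ((speed z.1 z.2) ^+ 2)%:E < +oo.
Proof.
move=> [_]; apply: le_lt_trans; rewrite /plan_time fubini_tonelli1/=; last 2 first.
- apply/measurable_EFinP; apply: measurable_funX; exact: measurable_speed.
- by move=> z; rewrite lee_fin sqr_ge0.
apply: ge0_le_integral_lower => g.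
  by apply: integral_ge0 => t _; rewrite lee_fin sqr_ge0.
exact: energy_ge_speed.
Qed.

(** The bound on the marginals, for functions instead of sets. *)
Lemma test_plan_marginal pi : test_plan pi -> exists2 C : R, (0 < C)%R &
  forall (u : borel X -> \bar R) t, measurable_fun setT u -> (forall x, 0 <= u x) ->
    \int[pi]_g u (cev g t) <= C%:E * \int[\m_X]_x u x.
Proof.
move=> [[C C0 HC] _]; exists C => // u t mu_ u0.
have mt := measurable_cev_eval (X := X) t.
pose C' : {nonneg R} := NngNum (ltW C0).
rewrite -(@ge0_integral_pushforward _ _ _ _ R (fun g : borel (curve X) => cev g t : borel X) mt
   pi setT u measurableT mu_ (fun x _ => u0 x)).
rewrite -[C]/(C'%:num)%R -ge0_integral_mscale//.
apply: ge0_le_measure_integral => // B mB.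
have := HC (clamp01 t) (clamp01_itv t) B mB.
rewrite /pushforward /mscale /=; congr (pi _ <= _).
by apply/seteqP; split=> g /=; rewrite curve_eval_clamp.
Qed.

Lemma test_plan_null pi (N : set (borel X)) : test_plan pi ->
  measurable N -> \m_X N = 0 -> plan_time pi [set z | N (cev z.1 z.2)] = 0.
Proof.
move=> tp mN N0.
have mN' : measurable [set z : borel (curve X) * R | N (cev z.1 z.2)].
  by rewrite -[X in measurable X]setTI; exact: measurable_cev.
rewrite -(setIT [set z | _]) -integral_indic// /plan_time.
rewrite fubini_tonelli2/=; last 2 first.
- by apply/measurable_EFinP; exact: measurable_indic.
- by move=> z; rewrite lee_fin.
have [C C0 HC] := test_plan_marginal tp.
apply: integral0_eq => t _; apply/eqP; rewrite eq_le; apply/andP; split; last first.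
  by apply: integral_ge0 => g _; rewrite lee_fin.
have E : \int[\m_X]_x (\1_N x)%:E = 0 by rewrite integral_indic// setIT.
have := HC (fun x => (\1_N x)%:E) t; rewrite E mule0.
apply; last by move=> x; rewrite lee_fin.
by apply/measurable_EFinP; exact: measurable_indic.
Qed.

Lemma test_plan_ae pi (P : X -> Prop) : test_plan pi ->
  {ae \m_X, forall x, P x} -> {ae plan_time pi, forall z, P (cev z.1 z.2)}.
Proof.
move=> tp [N [mN N0 NP]]; exists [set z | N (cev z.1 z.2)]; split.
- by rewrite -[X in measurable X]setTI; exact: (measurable_cev sX).
- exact: test_plan_null.
- by move=> z /= H; apply: NP.
Qed.

Lemma test_plan_ae_at pi (P : X -> Prop) t : test_plan pi ->
  {ae \m_X, forall x, P x} -> {ae pi, forall g : curve X, P (cev g t)}.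
Proof.
move=> tp [N [mN N0 NP]]; exists [set g : borel (curve X) | N (cev g t)]; split.
- by rewrite -[X in measurable X]setTI; exact: measurable_cev_eval.
- have [[C C0 HC] _] := tp.
  have := HC (clamp01 t) (clamp01_itv t) N mN.
  rewrite N0 mule0 => H; apply/eqP; rewrite -measure_le0; apply: le_trans H.
  rewrite /pushforward le_eqVlt; apply/orP; left; apply/eqP; congr (pi _).
  by apply/seteqP; split=> g /=; rewrite curve_eval_clamp.
- by move=> g /= H; apply: NP.
Qed.

(** From 2 G s <= G^2 + s^2, where s is the speed: the speed is square integrable
    because the plan has finite energy. *)
Lemma flow_sqr_lty pi G (K : \bar R) : test_plan pi -> measurable_fun setT G ->
  (forall x, 0 <= G x)%R -> K < +oo ->
  (forall t, \int[pi]_g (G (cev g t) ^+ 2)%:E <= K) -> flow pi G < +oo.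
Proof.
move=> tp mG G0 Koo GK.
have K0 : 0 <= K.
  by apply: le_trans (GK 0%R); apply: integral_ge0 => g _; rewrite lee_fin sqr_ge0.
pose I := \1_(`]0%R, 1%R[%classic) : R -> R.
have mI : measurable_fun setT (fun z : borel (curve X) * R => I z.2).
  apply: (@measurableT_comp _ _ _ _ _ _ I); last exact: measurable_snd.
  exact: measurable_indic.
have mIe : measurable_fun setT (EFin \o I).
  by apply/measurable_EFinP; exact: measurable_indic.
have mGI : measurable_fun setT
    (fun z : borel (curve X) * R => (G (cev z.1 z.2) ^+ 2 * I z.2)%:E).
  apply/measurable_EFinP; apply: measurable_funM => //; apply: measurable_funX.
  exact: (measurableT_comp mG (measurable_cev sX)).
have I0 t : (0 <= I t)%R by rewrite /I indicE.
have GI0 (z : borel (curve X) * R) : 0 <= (G (cev z.1 z.2) ^+ 2 * I z.2)%:E.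
  by rewrite lee_fin mulr_ge0// sqr_ge0.
have ms2 : measurable_fun setT (fun z : borel (curve X) * R => ((speed z.1 z.2) ^+ 2)%:E).
  by apply/measurable_EFinP; apply: measurable_funX; exact: measurable_speed.
apply: (@le_lt_trans _ _ (\int[plan_time pi]_z
    ((G (cev z.1 z.2) ^+ 2 * I z.2)%:E + ((speed z.1 z.2) ^+ 2)%:E))).
  apply: ge0_le_integral => //.
  - by move=> z _; rewrite lee_fin integrand_ge0.
  - by apply/measurable_EFinP; exact: measurable_integrand.
  - exact: (emeasurable_funD mGI ms2).
  move=> z _; rewrite -EFinD lee_fin /integrand /I indicE.
  have s0 := speed_ge0 z.1 z.2; have G1 := G0 (cev z.1 z.2).
  have [t01|t01] := boolP (0 < z.2 < 1)%R; last first.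
    by rewrite speed_out// mulr0 addr_ge0// ?mulr_ge0// ?sqr_ge0.
  rewrite mem_set/=; last by rewrite in_itv.
  have := sqr_ge0 (G (cev z.1 z.2) - speed z.1 z.2); nra.
rewrite ge0_integralD//; last by move=> z _; rewrite lee_fin sqr_ge0.
rewrite lte_add_pinfty//; last exact: test_plan_speed.
rewrite /plan_time fubini_tonelli2//=.
apply: (@le_lt_trans _ _ (\int[mu]_t ((I t)%:E * K))).
  apply: ge0_le_integral => //.
  - by move=> t _; apply: integral_ge0 => g _; exact: (GI0 (g, t)).
  - exact: (measurable_fun_fubini_tonelli_G _ mGI GI0).
  - exact: emeasurable_funM.
  move=> t _; rewrite [leLHS](_ : _ = (I t)%:E * \int[pi]_g (G (cev g t) ^+ 2)%:E); last first.
    rewrite -ge0_integralZl_EFin//.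
    - by apply: eq_integral => g _ /=; rewrite -EFinM mulrC.
    - by move=> g _; rewrite lee_fin sqr_ge0.
    - apply/measurable_EFinP; apply: measurable_funX.
      exact: (measurableT_comp mG (measurable_cev_eval (X := X) t)).
  by apply: lee_wpmul2l; rewrite ?lee_fin.
rewrite ge0_integralZr//; last by move=> t _; rewrite lee_fin.
rewrite integral_indic//= setIT lebesgue_measure_itv/= lte_fin ltr01.
by rewrite -EFinD subr0 mul1e.
Qed.

Lemma flow_bounded_lty pi G (c : R) : test_plan pi -> measurable_fun setT G ->
  (forall x, 0 <= G x <= c)%R -> flow pi G < +oo.
Proof.
move=> tp mG Gc; have G0 x : (0 <= G x)%R by have /andP[] := Gc x.
apply: (flow_sqr_lty (K := (c ^+ 2)%:E)) => // [|t]; first exact: ltry.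
apply: (@le_trans _ _ (\int[pi]_g cst (c ^+ 2)%:E g)); last first.
  rewrite (integral_cst pi measurableT) -[leRHS]mule1.
  by apply: lee_wpmul2l; [rewrite lee_fin sqr_ge0|exact: probability_le1].
apply: ge0_le_integral => //.
- by move=> g _; rewrite lee_fin sqr_ge0.
- apply/measurable_EFinP; apply: measurable_funX.
  exact: (measurableT_comp mG (measurable_cev_eval (X := X) t)).
move=> g _; have /andP[a b] := Gc (cev g t).
by rewrite lee_fin lerXn2r ?nnegrE//; exact: le_trans b.
Qed.

Lemma flow_L2_lty pi G : test_plan pi -> G \in Lfun \m_X 2%:E ->
  (forall x, 0 <= G x)%R -> flow pi G < +oo.
Proof.
move=> tp /Lfun2P[mG iG] G0; have [C C0 HC] := test_plan_marginal tp.
apply: (flow_sqr_lty (K := C%:E * \int[\m_X]_x (G x ^+ 2)%:E)) => // [|t].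
  by rewrite lte_mul_pinfty// lee_fin ltW.
apply: (HC (fun x => (G x ^+ 2)%:E) t) => [|x]; last by rewrite lee_fin sqr_ge0.
by apply/measurable_EFinP; exact: measurable_funX.
Qed.

(** The weak upper gradient inequality without the square integrability of G;
    it also makes sense for the constant upper gradients of Lipschitz
    functions. *)
Definition plan_gradient f G := [/\ measurable_fun setT G,
  forall x, (0 <= G x)%R & forall pi, test_plan pi -> flow pi G < +oo /\
    \int[pi]_g `|f (cev g 1) - f (cev g 0)|%:E <= flow pi G].

Lemma weak_upper_gradientP f G :
  weak_upper_gradient f G <-> G \in Lfun \m_X 2%:E /\ plan_gradient f G.
Proof.
have h0 : (0 <= (0:R) <= 1)%R by rewrite lexx ler01.
have h1 : (0 <= (1:R) <= 1)%R by rewrite lexx ler01.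
have E pi : \int[pi]_g `|f (curve_eval 1 g) - f (curve_eval 0 g)|%:E =
    \int[pi]_g `|f (cev g 1) - f (cev g 0)|%:E.
  by apply: eq_integral => g _; rewrite !curve_evalE.
split=> [[GL G0 H]|[GL [mG G0 H]]].
  split => //; have [mG _] := (Lfun2P _ _).1 GL; split => // pi tp.
  split; first exact: flow_L2_lty.
  by rewrite -E -flow_curves//; exact: H.
by split => // pi tp; rewrite E flow_curves//; exact: (H pi tp).2.
Qed.

End plans.

(** * The inequality on time intervals and sets of curves *)

Section gate.
Context {R : realType} (X : mmSpace R).
Local Open Scope ereal_scope.
Let sX : separable X := mms_separable X.
Implicit Types (pi : probability (borel (curve X)) R) (G f : borel X -> R)
  (Gam : set (borel (curve X))) (s t : R).

(** Follows a curve of Gam on [s, t] only, and freezes all other curves: pushing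
    a plan by this map both restricts it in time and conditions it to Gam,
    without renormalization. *)
Definition gate Gam s t (g : borel (curve X)) : borel (curve X) :=
  stop_curve s (if g \in Gam then t else s) g.

Lemma measurable_gate Gam s t : measurable Gam ->
  measurable_fun setT (gate Gam s t).
Proof.
move=> mGam _ B mB; rewrite setTI.
have ms t' : measurable_fun setT (stop_curve s t' : borel (curve X) -> borel (curve X)).
  exact: (continuous_borel_measurable (@stop_curve_continuous R X s t')).
rewrite [X in measurable X](_ : _ =
  (Gam `&` stop_curve s t @^-1` B) `|` (~` Gam `&` stop_curve s s @^-1` B)).
  apply: measurableU; apply: measurableI => //; last 2 first.
  - exact: measurableC.
  - by rewrite -[X in measurable X]setTI; exact: ms.
  by rewrite -[X in measurable X]setTI; exact: ms.
apply/seteqP; split=> g /=; rewrite /gate.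
  by have [gG|gG] := pselect (Gam g); [rewrite mem_set//; left|rewrite memNset//; right].
by move=> [[gG]|[gG]]; [rewrite mem_set|rewrite memNset].
Qed.

Lemma energy_gate Gam s t g : (0 <= s)%R -> (s <= t)%R -> (t <= 1)%R ->
  energy (gate Gam s t g : curve X) <= energy (g : curve X).
Proof.
move=> s0 st t1; rewrite /gate; case: ifPn => _; apply: energy_stop_curve => //.
exact: le_trans t1.
Qed.

(** The marginal of the image plan at time r is at most the sum of the marginals
    of pi at the clamped time and at the resting time s, hence the constant 2 C. *)
Lemma test_plan_gate pi Gam s t (mGam : measurable Gam) :
  (0 <= s)%R -> (s <= t)%R -> (t <= 1)%R ->
  test_plan pi -> test_plan (plan_map pi (measurable_gate s t mGam)).
Proof.
move=> s0 st t1 [[C C0 HC] en]; split; last first.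
  apply: le_lt_trans en; apply: (le_trans (integral_plan_map_lower _ _ _)).
    move=> g; rewrite /energy; case: ifPn => // _.
    by apply: integral_ge0 => r _; rewrite lee_fin sqr_ge0.
  apply: ge0_le_integral_lower => g; last exact: energy_gate.
  rewrite /energy; case: ifPn => // _.
  by apply: integral_ge0 => r _; rewrite lee_fin sqr_ge0.
exists (C + C)%R; first by rewrite addr_gt0.
move=> r r01 B mB; rewrite /pushforward plan_mapE.
set c := clamp s t r.
have c01 : (0 <= c <= 1)%R.
  have /andP[sc ct] := clamp_itv r st.
  by rewrite (le_trans s0 sc) (le_trans ct).
have s01 : (0 <= s <= 1)%R by rewrite s0 (le_trans st).
have mev t' : measurable (curve_eval (clamp01 t') @^-1` B : set (borel (curve X))).
  rewrite [X in measurable X](_ : _ = (fun g : borel (curve X) => cev g t') @^-1` B).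
    by rewrite -[X in measurable X]setTI; exact: measurable_cev_eval.
  by apply/seteqP; split=> g /=; rewrite curve_eval_clamp.
apply: (@le_trans _ _ (pi (curve_eval c @^-1` B `|` curve_eval s @^-1` B))).
  apply: le_measure; rewrite ?inE.
  - have mg : measurable_fun setT (fun g => cev (gate Gam s t g) r : borel X).
      apply: (@measurableT_comp _ _ _ _ _ _ (fun g : borel (curve X) => cev g r : borel X)).
        exact: measurable_cev_eval.
      exact: measurable_gate.
    have := mg measurableT _ mB; rewrite setTI; congr measurable.
    by apply/seteqP; split=> g /=; rewrite curve_evalE.
  - by apply: measurableU; [have := mev c|have := mev s]; rewrite clamp01_id.
  move=> g /=; rewrite curve_evalE// /gate cev_stop_curve clamp01_id//.
  case: ifPn => _; first by left; rewrite curve_evalE.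
  rewrite (_ : clamp s s r = s); first by right; rewrite curve_evalE.
  by apply/eqP; rewrite eq_le; have := @clamp_itv R s s r (lexx _); rewrite andbC.
have C0' : 0 <= C%:E by rewrite lee_fin ltW.
rewrite EFinD ge0_muleDl//.
apply: (@le_trans _ _ (pi (curve_eval c @^-1` B) + pi (curve_eval s @^-1` B))).
  by apply: measureU2; [have := mev c|have := mev s]; rewrite clamp01_id.
by apply: leeD; exact: HC.
Qed.

Lemma measurable_increment f s t : measurable_fun setT f ->
  measurable_fun setT (fun g : borel (curve X) => `|f (cev g t) - f (cev g s)|%R).
Proof.
move=> mf; apply: measurableT_comp => //.
by apply: measurable_funB; exact: (measurableT_comp mf (measurable_cev_eval (X := X) _)).
Qed.

Lemma integrand_gate Gam s t G g r : (0 <= s)%R -> (s <= t)%R -> (t <= 1)%R ->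
  r != s -> r != t -> integrand G (gate Gam s t g, r) =
  (\1_Gam g * \1_(`]s, t[%classic) r * integrand G (g, r))%R.
Proof.
move=> s0 st t1 rs rt; rewrite /integrand /gate /= [\1_Gam g]indicE.
case: ifPn => gG; last first.
  rewrite (speed_stop_curve g s0 (lexx s) (le_trans st t1) rs rs) !mul0r.
  by rewrite set_itvoo0 indic0 !mulr0.
rewrite (speed_stop_curve g s0 st t1 rs rt) mul1r indicE.
have [rI|] := boolP (r \in `]s, t[%classic); last by rewrite !mulr0 mul0r.
rewrite mulr1 mul1r cev_stop_curve clamp01_id ?clamp_in//.
  by move: rI; rewrite inE/= in_itv/= => /andP[? ?]; rewrite !ltW.
move: rI; rewrite inE/= in_itv/= => /andP[sr rt'].
by rewrite (le_trans s0 (ltW sr)) (le_trans (ltW rt') t1).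
Qed.

(** The inequality for the plan pushed forward by the gate: a frozen curve
    contributes to neither side. *)
Lemma plan_gradient_gate pi f G Gam s t : plan_gradient f G ->
  measurable_fun setT f -> test_plan pi -> measurable Gam ->
  (0 <= s)%R -> (s <= t)%R -> (t <= 1)%R ->
  \int[pi]_g (\1_Gam g * `|f (cev g t) - f (cev g s)|)%:E <=
  \int[plan_time pi]_z (\1_Gam z.1 * \1_(`]s, t[%classic) z.2 * integrand G z)%:E.
Proof.
move=> [mG G0 H] mf tp mGam s0 st t1.
have [_] := H _ (test_plan_gate mGam s0 st t1 tp).
rewrite ge0_integral_plan_map; last 2 first.
- by apply/measurable_EFinP; exact: measurable_increment.
- by move=> g; rewrite lee_fin.
rewrite (eq_integral (fun g => (\1_Gam g * `|f (cev g t) - f (cev g s)|)%:E)); last first.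
  move=> g _; rewrite /gate indicE; case: ifPn => _.
    by rewrite cev_stop_curve0 ?s0// cev_stop_curve1 ?st// mul1r.
  by rewrite cev_stop_curve0 ?s0 ?lexx// cev_stop_curve1 ?lexx ?(le_trans st)// subrr normr0 mul0r.
move=> /le_trans; apply.
rewrite /flow /plan_time fubini_tonelli1; last 2 first.
- by apply/measurable_EFinP; exact: measurable_integrand.
- by move=> z; rewrite lee_fin integrand_ge0.
have mi : measurable_fun setT (fun z : borel (curve X) * R => (integrand G z)%:E).
  by apply/measurable_EFinP; exact: measurable_integrand.
have mi2 : measurable_fun setT (fun z : borel (curve X) * R =>
    (\1_Gam z.1 * \1_(`]s, t[%classic) z.2 * integrand G z)%:E).
  apply/measurable_EFinP; apply: measurable_funM; last exact: measurable_integrand.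
  apply: measurable_funM.
    apply: (@measurableT_comp _ _ _ _ _ _ (\1_Gam : _ -> R)); last exact: measurable_fst.
    exact: measurable_indic.
  apply: (@measurableT_comp _ _ _ _ _ _ (\1_(`]s, t[%classic) : R -> R)); last exact: measurable_snd.
  exact: measurable_indic.
rewrite ge0_integral_plan_map; last 2 first.
- apply: measurable_fun_fubini_tonelli_F; [exact: mi|by move=> z; rewrite lee_fin integrand_ge0].
- by move=> g; apply: integral_ge0 => r _; rewrite lee_fin integrand_ge0.
rewrite fubini_tonelli1//; last first.
  by move=> z; rewrite lee_fin mulr_ge0// ?integrand_ge0// mulr_ge0.
rewrite le_eqVlt; apply/orP; left; apply/eqP; apply: eq_integral => g _.
rewrite /fubini_F /=; apply: (@integral_ignore2 R _ _ s t).
- exact: (measurable_fun_pair2 (gate Gam s t g) mi).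
- exact: (measurable_fun_pair2 g mi2).
- by move=> r rs rt; rewrite integrand_gate.
Qed.

End gate.

(** * Switching between two upper gradients *)

Section partition.
Context {R : realType} (X : mmSpace R).
Local Open Scope ereal_scope.
Let sX : separable X := mms_separable X.
Implicit Types (pi : probability (borel (curve X)) R) (G f psi phi : borel X -> R).

Definition near_above phi (c : R) n (z : borel (curve X) * R) : bool :=
  (c < phi (cev z.1 (grid n z.2)))%R || (c < phi (cev z.1 (grid n z.2 + 2^-1 ^+ n)))%R.

Lemma measurable_cev_time (tau : R -> R) : measurable_fun setT tau ->
  measurable_fun setT (fun z : borel (curve X) * R => cev z.1 (tau z.2) : borel X).
Proof.
move=> mt; apply: (@measurableT_comp _ _ _ _ _ _
  (fun gt : borel (curve X) * R => cev gt.1 gt.2 : borel X) _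
  (fun gt : borel (curve X) * R => (gt.1, tau gt.2))).
  exact: measurable_cev.
apply/measurable_fun_pairP; split; first exact: measurable_fst.
exact: (measurableT_comp mt measurable_snd).
Qed.

Lemma measurable_near_above phi c n : measurable_fun setT phi ->
  measurable_fun setT (near_above phi c n).
Proof.
move=> mphi; apply: measurable_or.
  apply: measurable_fun_ltr; first exact: measurable_cst.
  exact: (measurableT_comp mphi (measurable_cev_time (measurable_grid n))).
apply: measurable_fun_ltr; first exact: measurable_cst.
apply: (measurableT_comp mphi); apply: (measurable_cev_time (tau := fun t => grid n t + _))%R.
by apply: measurable_funD; [exact: measurable_grid|exact: measurable_cst].
Qed.

Lemma grid_cell n (k : nat) (t : R) :
  (t \in `](k%:R / 2 ^+ n), (k.+1%:R / 2 ^+ n)[)%R -> Num.floor (t * 2 ^+ n)%R = k%:Z.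
Proof.
have p : (0 < 2 ^+ n :> R)%R by exact: exprn_gt0.
rewrite in_itv/= ltr_pdivrMr// ltr_pdivlMr// => /andP[kt tk].
apply/eqP; rewrite floor_eq; apply/andP; split; first by rewrite -pmulrn ltW.
by move: tk; rewrite -[X in (_ < X)%R -> _]natr1 intrD.
Qed.

(** The switching estimate for the partition of [0, 1] into 2^n intervals. *)
Lemma partition_ineq pi psi phi f1 f2 G1 G2 c n : test_plan pi ->
  measurable_fun setT psi -> measurable_fun setT phi ->
  measurable_fun setT f1 -> measurable_fun setT f2 ->
  plan_gradient f1 G1 -> plan_gradient f2 G2 ->
  (forall x y, (c < phi x)%R || (c < phi y)%R -> `|psi y - psi x| <= `|f1 y - f1 x|)%R ->
  (forall x y, (phi x <= c)%R -> (phi y <= c)%R -> `|psi y - psi x| <= `|f2 y - f2 x|)%R ->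
  \int[pi]_g `|psi (cev g 1) - psi (cev g 0)|%:E <=
  \int[plan_time pi]_z
    (if near_above phi c n z then integrand G1 z else integrand G2 z)%:E.
Proof.
move=> tp mpsi mphi mf1 mf2 pg1 pg2 H1 H2.
have [mG1 G10 _] := pg1; have [mG2 G20 _] := pg2.
pose tk (k : nat) : R := (k%:R / 2 ^+ n)%R.
have p : (0 < 2 ^+ n :> R)%R by exact: exprn_gt0.
have tk0 k : (0 <= tk k)%R by rewrite divr_ge0// ltW.
have tkS k : (tk k <= tk k.+1)%R by rewrite ler_wpM2r ?invr_ge0 ?ltW// ltr_nat.
have tk1 k : (k < 2 ^ n)%N -> (tk k.+1 <= 1)%R.
  by move=> kn; rewrite ler_pdivrMr// mul1r -natrX ler_nat.
pose Gam k := [set g : borel (curve X) | (c < phi (cev g (tk k)))%R || (c < phi (cev g (tk k.+1)))%R].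
have mGam k : measurable (Gam k).
  have mb : measurable_fun setT (fun g : borel (curve X) =>
      (c < phi (cev g (tk k)))%R || (c < phi (cev g (tk k.+1)))%R).
    apply: measurable_or; apply: measurable_fun_ltr; try exact: measurable_cst;
    exact: (measurableT_comp mphi (measurable_cev_eval (X := X) _)).
  have := mb measurableT [set true] _; rewrite setTI; exact.
pose inc (f : borel X -> R) k g := `|f (cev g (tk k.+1)) - f (cev g (tk k))|%R.
pose A k (g : borel (curve X)) := (\1_(Gam k) g * inc f1 k g)%R.
pose B k (g : borel (curve X)) := (\1_(~` Gam k) g * inc f2 k g)%R.
have mA k : measurable_fun setT (A k).
  by apply: measurable_funM; [exact: measurable_indic|exact: measurable_increment].
have mB k : measurable_fun setT (B k).
  apply: measurable_funM; last exact: measurable_increment.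
  by apply: measurable_indic; exact: measurableC.
have A0 k g : (0 <= A k g)%R by rewrite /A /inc indicE mulr_ge0.
have B0 k g : (0 <= B k g)%R by rewrite /B /inc indicE mulr_ge0.
(* The triangle inequality along the partition, each increment being estimated by
   f1 or by f2 according to the value of phi at the endpoints of its interval. *)
have step1 : \int[pi]_g `|psi (cev g 1) - psi (cev g 0)|%:E <=
    \int[pi]_g \sum_(k < 2 ^ n) ((A k g)%:E + (B k g)%:E).
  apply: ge0_le_integral => //.
  - by apply/measurable_EFinP; exact: measurable_increment.
  - apply: emeasurable_sum => k; apply: emeasurable_funD; exact/measurable_EFinP.
  move=> g _; under eq_bigr do rewrite -EFinD.
  rewrite sumEFin lee_fin.
  have -> : (psi (cev g 1) - psi (cev g 0))%R =
      (\sum_(k < 2 ^ n) (psi (cev g (tk k.+1)) - psi (cev g (tk k))))%R.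
    rewrite -(big_mkord xpredT (fun k => psi (cev g (tk k.+1)) - psi (cev g (tk k)))%R).
    rewrite telescope_sumr//; congr (psi (cev g _) - psi (cev g _))%R.
      by rewrite /tk natrX divff// gt_eqF.
    by rewrite /tk mul0r.
  apply: (le_trans (ler_norm_sum _ _ _)); apply: ler_sum => k _.
  rewrite /A /B !indicE in_setC.
  have [gk|gk] := pselect (Gam k g).
    by rewrite mem_set//= mul1r mul0r addr0; exact: H1.
  rewrite memNset//= mul0r mul1r add0r.
  by move/negP : gk; rewrite negb_or -!leNgt => /andP[? ?]; exact: H2.
apply: (le_trans step1).
pose C k (z : borel (curve X) * R) :=
  (\1_(Gam k) z.1 * \1_(`]tk k, tk k.+1[%classic) z.2 * integrand G1 z)%R.
pose D k (z : borel (curve X) * R) :=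
  (\1_(~` Gam k) z.1 * \1_(`]tk k, tk k.+1[%classic) z.2 * integrand G2 z)%R.
have mI (E : set (borel (curve X))) k : measurable E ->
    measurable_fun setT (fun z : borel (curve X) * R =>
      \1_E z.1 * \1_(`]tk k, tk k.+1[%classic) z.2 : R)%R.
  move=> mE; apply: measurable_funM.
    apply: (@measurableT_comp _ _ _ _ _ _ (\1_E : _ -> R)); last exact: measurable_fst.
    exact: measurable_indic.
  apply: (@measurableT_comp _ _ _ _ _ _ (\1_(`]tk k, tk k.+1[%classic) : R -> R)); last exact: measurable_snd.
  exact: measurable_indic.
have mC k : measurable_fun setT (C k).
  by apply: measurable_funM; [exact: mI|exact: measurable_integrand].
have mD k : measurable_fun setT (D k).
  by apply: measurable_funM; [apply: mI; exact: measurableC|exact: measurable_integrand].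
have C0 k z : (0 <= C k z)%R by rewrite /C !indicE mulr_ge0 ?integrand_ge0// mulr_ge0.
have D0 k z : (0 <= D k z)%R by rewrite /D !indicE mulr_ge0 ?integrand_ge0// mulr_ge0.
(* The upper gradient inequality on the k-th interval, for the curves of Gam k and
   for the others. *)
have step2 : \int[pi]_g \sum_(k < 2 ^ n) ((A k g)%:E + (B k g)%:E) <=
    \int[plan_time pi]_z \sum_(k < 2 ^ n) ((C k z)%:E + (D k z)%:E).
  rewrite ge0_integral_sum//; last 2 first.
  - by move=> k; apply: emeasurable_funD; exact/measurable_EFinP.
  - by move=> k g _; rewrite adde_ge0// lee_fin.
  rewrite ge0_integral_sum//; last 2 first.
  - by move=> k; apply: emeasurable_funD; apply/measurable_EFinP; [exact: mC|exact: mD].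
  - by move=> k g _; rewrite adde_ge0// lee_fin.
  apply: lee_sum => k _.
  rewrite ge0_integralD//; last 4 first.
  - by move=> g _; rewrite lee_fin.
  - exact/measurable_EFinP.
  - by move=> g _; rewrite lee_fin.
  - exact/measurable_EFinP.
  rewrite ge0_integralD//; last 4 first.
  - by move=> g _; rewrite lee_fin.
  - by apply/measurable_EFinP; exact: mC.
  - by move=> g _; rewrite lee_fin.
  - by apply/measurable_EFinP; exact: mD.
  have kn := tk1 _ (ltn_ord k).
  by apply: leeD; apply: plan_gradient_gate => //; exact: measurableC.
apply: (le_trans step2).
have mR : measurable_fun setT (fun z : borel (curve X) * R =>
    (if near_above phi c n z then integrand G1 z else integrand G2 z)%:E).
  apply/measurable_EFinP; apply: measurable_fun_if => //.
  - exact: measurable_near_above.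
  - by apply: measurable_funTS; exact: measurable_integrand.
  - by apply: measurable_funTS; exact: measurable_integrand.
have R0 z : (0 <= if near_above phi c n z then integrand G1 z else integrand G2 z)%R.
  by case: ifPn => _; exact: integrand_ge0.
apply: ge0_le_integral => //.
- by move=> z _; apply: sume_ge0 => k _; rewrite adde_ge0// lee_fin.
- apply: emeasurable_sum => k; apply: emeasurable_funD; apply/measurable_EFinP.
    exact: mC.
  exact: mD.
move=> z _; under eq_bigr do rewrite -EFinD.
rewrite sumEFin lee_fin.
set V := (if _ then _ else _).
have V0 : (0 <= V)%R by exact: R0.
(* At a given time only the interval that contains it contributes. *)
have term (k : 'I_(2 ^ n)) :
    (C k z + D k z <= (Num.floor (z.2 * 2 ^+ n)%R == k%:Z)%:R * V)%R.
  have [zk|zk] := boolP (z.2 \in `]tk k, tk k.+1[); last first.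
    have z0 : \1_(`]tk k, tk k.+1[%classic) z.2 = 0%R :> R.
      by rewrite indicE memNset//=; exact/negP.
    by rewrite /C /D z0 !mulr0 !mul0r addr0 mulr_ge0.
  have fk := grid_cell zk; rewrite fk eqxx mul1r.
  have gk : grid n z.2 = tk k by rewrite /grid fk.
  have gk1 : (grid n z.2 + 2^-1 ^+ n = tk k.+1)%R.
    by rewrite gk /tk -[k.+1%:R%R]natr1 mulrDl mul1r exprVn.
  have z1 : \1_(`]tk k, tk k.+1[%classic) z.2 = 1%R :> R by rewrite indicE mem_set.
  rewrite /C /D z1 !mulr1 !indicE in_setC /V /near_above gk1 gk.
  have [g1|g1] := pselect (Gam k z.1).
    by rewrite mem_set//= mul1r mul0r addr0 (_ : _ || _).
  by rewrite memNset//= mul0r add0r mul1r ifN//; exact/negP.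
apply: (le_trans (ler_sum _ (fun k _ => term k))).
rewrite -mulr_suml -[leRHS]mul1r ler_wpM2r//.
have [[k0 /eqP fk0]|nk] := pselect (exists k : 'I_(2 ^ n), Num.floor (z.2 * 2 ^+ n)%R == k%:Z).
  rewrite (bigD1 k0)//= fk0 eqxx big1 ?addr0// => k kk0.
  by rewrite eqz_nat eq_sym (negbTE (_ : (k : nat) != k0)).
rewrite big1// => k _; case: eqP => // fk; exfalso; apply: nk; exists k.
exact/eqP.
Qed.

End partition.

Section summable_ae.
Context d (T : measurableType d) {R : realType} (m : {measure set T -> \bar R}).
Local Open Scope ereal_scope.

(** The sum of the D n is integrable, hence finite almost everywhere. *)
Lemma ae_cvg0_summable (D : nat -> T -> R) (K : R) :
  (forall n, measurable_fun setT (D n)) -> (forall n x, (0 <= D n x)%R) -> (0 <= K)%R ->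
  (forall n, \int[m]_x (D n x)%:E <= (K / (2 ^ n.+1)%:R)%:E) ->
  {ae m, forall x, (D n x @[n --> \oo] --> 0)%R}.
Proof.
move=> mD D0 K0 DK; pose S x := \sum_(n <oo) (D n x)%:E.
have mDe n : measurable_fun setT (fun x => (D n x)%:E) by exact/measurable_EFinP.
have mS : measurable_fun setT S.
  by apply: ge0_emeasurable_sum => // n x _ _; rewrite lee_fin.
have S0 x : 0 <= S x by apply: nneseries_ge0 => n _ _; rewrite lee_fin.
have Soo : \int[m]_x S x < +oo.
  rewrite integral_nneseries//; last by move=> n x _; rewrite lee_fin.
  apply: (@le_lt_trans _ _ (\sum_(n <oo) (K / (2 ^ n.+1)%:R)%:E)).
    apply: lee_nneseries => // n _ _; apply: integral_ge0 => x _.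
    by rewrite lee_fin.
  by apply: le_lt_trans (epsilon_trick0 xpredT K0) _; rewrite ltry.
have iS : m.-integrable setT S.
  by apply/integrableP; split => //; under eq_integral do rewrite gee0_abs//.
have FF := ae_filter_ringOfSetsType m.
have := integrable_ae measurableT iS; apply: filterS => x /(_ I) Sx.
have Sxoo : S x < +oo by rewrite -ge0_fin_numE.
have tc := nneseries_tail_cvg Sxoo (fun k _ => D0 k x).
have /fine_cvgP[_ //] : (D n x)%:E @[n --> \oo] --> 0.
apply: (@squeeze_cvge _ _ _ _ (cst 0) (fun n => (D n x)%:E)
  (fun N => \sum_(N <= k <oo) (D k x)%:E)) => //; last exact: cvg_cst.
apply: nearW => n; rewrite lee_fin D0/=.
have := @nneseries_lim_ge R (fun k => (D k x)%:E) xpredT n n.+1.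
by rewrite big_nat1; apply => k _ _; rewrite lee_fin.
Qed.

End summable_ae.

Section plan_continuity.
Context {R : realType} (X : mmSpace R).
Local Open Scope ereal_scope.
Local Notation mu := (@lebesgue_measure R).
Let sX : separable X := mms_separable X.
Implicit Types (pi : probability (borel (curve X)) R) (G f : borel X -> R).

(** Moving the time by at most d costs at most the flow through a window of width
    2 d around each time; exchange the order of integration in time. *)
Lemma increment_time_le pi f G (tau : R -> R) (d : R) : plan_gradient f G ->
  measurable_fun setT f -> test_plan pi -> (0 <= d)%R ->
  measurable_fun setT tau -> (forall t, `|tau t - t| <= d)%R ->
  (forall t, 0 < t < 1 -> 0 <= tau t <= 1)%R ->
  \int[plan_time pi]_z (`|f (cev z.1 (tau z.2)) - f (cev z.1 z.2)| *
     \1_(`]0%R, 1%R[%classic) z.2)%:E <= (d *+ 2)%:E * flow pi G.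
Proof.
move=> pg mf tp d0 mtau taud tau01; have [mG G0 _] := pg.
pose J := \1_(`]0%R, 1%R[%classic) : R -> R.
have mJ : measurable_fun setT J by exact: measurable_indic.
have mL : measurable_fun setT (fun z : borel (curve X) * R =>
    (`|f (cev z.1 (tau z.2)) - f (cev z.1 z.2)| * J z.2)%:E).
  apply/measurable_EFinP; apply: measurable_funM; last exact: (measurableT_comp mJ measurable_snd).
  apply: measurableT_comp => //; apply: measurable_funB.
    have mct := @measurable_cev_time R X tau mtau.
    exact: (measurableT_comp mf mct).
  exact: (measurableT_comp mf (measurable_cev sX)).
have J0 t : (0 <= J t)%R by rewrite /J indicE.
have mI : measurable_fun setT (fun z : borel (curve X) * R => (integrand G z)%:E).
  by apply/measurable_EFinP; exact: measurable_integrand.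
have I0 (z : borel (curve X) * R) : 0 <= (integrand G z)%:E by rewrite lee_fin integrand_ge0.
(* w is the flow at time r, and A' the set of pairs of times at distance at most d. *)
pose w r := \int[pi]_g (integrand G (g, r))%:E.
have w0 r : 0 <= w r by apply: integral_ge0 => g _; rewrite lee_fin integrand_ge0.
have mw : measurable_fun setT w.
  exact: (measurable_fun_fubini_tonelli_G _ mI I0).
have wE : flow pi G = \int[mu]_r w r.
  by rewrite /flow /plan_time fubini_tonelli2.
pose A' := [set tr : R * R | (`|tr.2 - tr.1| <= d)%R].
have mA' : measurable A'.
  have md : measurable_fun setT (fun tr : R * R => `|tr.2 - tr.1|%R).
    by apply: measurableT_comp => //; apply: measurable_funB.
  rewrite -[A']setTI (_ : A' = (fun tr : R * R => `|tr.2 - tr.1|%R) @^-1` `]-oo, d]%classic).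
    exact: md.
  by apply/seteqP; split=> tr; rewrite /A'/= in_itv.
have mAw : measurable_fun setT (fun tr : R * R => (\1_A' tr)%:E * w tr.2).
  apply: emeasurable_funM; first by apply/measurable_EFinP; exact: measurable_indic.
  exact: (measurableT_comp mw measurable_snd).
have Aw0 tr : 0 <= (\1_A' tr)%:E * w tr.2 by rewrite mule_ge0// lee_fin.
apply: (@le_trans _ _ (\int[mu]_t \int[mu]_r ((\1_A' (t, r))%:E * w r))).
  have mL0 (z : borel (curve X) * R) :
      0 <= (`|f (cev z.1 (tau z.2)) - f (cev z.1 z.2)| * J z.2)%:E.
    by rewrite lee_fin mulr_ge0.
  rewrite /plan_time fubini_tonelli2//=.
  apply: ge0_le_integral => //.
  - by move=> t _; apply: integral_ge0 => g _; exact: (mL0 (g, t)).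
  - exact: (measurable_fun_fubini_tonelli_G _ mL mL0).
  - exact: (@measurable_fun_fubini_tonelli_F _ _ (measurableTypeR R) (measurableTypeR R) R mu _ mAw Aw0).
  move=> t _; have [t01|t01] := boolP (0 < t < 1)%R; last first.
    have Jt : J t = 0%R.
      by rewrite /J indicE memNset// => /=; rewrite in_itv/=; exact/negP.
    rewrite /fubini_G integral0_eq; last first.
      move=> g _; congr (_%:E).
      by rewrite -[(\1_(`]0%R, 1%R[%classic) _)]/(J t) Jt mulr0.
    by apply: integral_ge0 => r _; exact: (Aw0 (t, r)).
  have t01' : (0 <= t <= 1)%R by case/andP : t01 => *; rewrite !ltW.
  pose a := Num.min (tau t) t; pose b := Num.max (tau t) t.
  have /andP[ta0 ta1] := tau01 _ t01; have /andP[t0 t1] := t01'.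
  have a0 : (0 <= a)%R by rewrite /a le_min ta0 t0.
  have b1 : (b <= 1)%R by rewrite /b ge_max ta1 t1.
  have ab : (a <= b)%R by rewrite /a /b ge_min le_max lexx.
  have := plan_gradient_gate pg mf tp (@measurableT _ (borel (curve X))) a0 ab b1.
  rewrite (eq_integral (fun g : borel (curve X) =>
    (`|f (cev g (tau t)) - f (cev g t)| * J t)%:E)); last first.
    have Jt : J t = 1%R by rewrite /J indicE mem_set//= in_itv.
    move=> g _; rewrite indicT mul1r Jt mulr1.
    by rewrite /a /b; case: (leP (tau t) t) => _ //; rewrite distrC.
  move=> /le_trans; apply.
  have mQ : measurable_fun setT (fun z : borel (curve X) * R =>
      (\1_[set: borel (curve X)] z.1 * \1_(`]a, b[%classic) z.2 * integrand G z)%:E).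
    apply/measurable_EFinP; apply: measurable_funM; last exact: measurable_integrand.
    apply: measurable_funM; first by rewrite indicT; exact: measurable_cst.
    apply: (@measurableT_comp _ _ _ _ _ _ (\1_(`]a, b[%classic) : R -> R)); last exact: measurable_snd.
    exact: measurable_indic.
  have Q0 (z : borel (curve X) * R) :
      0 <= (\1_[set: borel (curve X)] z.1 * \1_(`]a, b[%classic) z.2 * integrand G z)%:E.
    by rewrite lee_fin !indicE mulr_ge0 ?integrand_ge0// mulr_ge0.
  rewrite /plan_time fubini_tonelli2//=.
  apply: ge0_le_integral => //.
  - by move=> r _; apply: integral_ge0 => g _; exact: (Q0 (g, r)).
  - exact: (measurable_fun_fubini_tonelli_G _ mQ Q0).
  - exact: (measurable_fun_pair2 t mAw).
  move=> r _ /=.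
  rewrite [leLHS](_ : _ = (\1_(`]a, b[%classic) r)%:E * w r); last first.
    rewrite -ge0_integralZl_EFin//.
    - by apply: eq_integral => g _; rewrite indicT mul1r EFinM.
    - exact: (measurable_fun_pair1 r mI).
  apply: lee_wpmul2r => //; rewrite lee_fin !indicE.
  have [rab|rab] := boolP (r \in `]a, b[%classic); last by [].
  rewrite mem_set//=; move: rab; rewrite inE/= in_itv/= /A'/= /a /b.
  have := taud t; rewrite ler_norml => /andP[d1 d2] /andP[].
  rewrite gt_min lt_max ler_norml => ? ?.
  by case: (leP (tau t) t) => tt; apply/andP; split; lra.
have -> : \int[mu]_t \int[mu]_r ((\1_A' (t, r))%:E * w r) =
    \int[mu]_r \int[mu]_t ((\1_A' (t, r))%:E * w r).
  exact: (@fubini_tonelli _ _ (measurableTypeR R) (measurableTypeR R) R mu mu _ mAw Aw0).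
rewrite wE.
rewrite -ge0_integralZl_EFin ?mulrn_wge0//.
rewrite le_eqVlt; apply/orP; left; apply/eqP; apply: eq_integral => r _.
have mAr : measurable_fun setT (fun t : measurableTypeR R => (\1_A' (t, r) : R)%:E).
  have mi : measurable_fun setT (\1_A' : R * R -> R) by exact: measurable_indic.
  by apply/measurable_EFinP; exact: (measurable_fun_pair1 r mi).
transitivity ((\int[mu]_t (\1_A' (t, r))%:E) * w r).
  by apply: ge0_integralZr => // t _; rewrite lee_fin.
rewrite (_ : \int[mu]_t (\1_A' (t, r))%:E = (d *+ 2)%:E)//.
transitivity (\int[mu]_t (\1_(`[r - d, r + d]%classic) t)%:E).
  apply: eq_integral => t _; rewrite !indicE; congr ((nat_of_bool _)%:R%:E).
  apply/idP/idP; rewrite !inE /A'/= in_itv/= ler_norml => /andP[? ?]; apply/andP; split; lra.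
rewrite integral_indic//= setIT lebesgue_measure_itv/= lte_fin.
case: ifPn => [_|]; first by rewrite -EFinD; congr (_%:E); rewrite mulr2n; lra.
rewrite -leNgt => rd; congr (_%:E); rewrite mulr2n; lra.
Qed.

End plan_continuity.

Section switching.
Context {R : realType} (X : mmSpace R).
Local Open Scope ereal_scope.
Let sX : separable X := mms_separable X.
Implicit Types (pi : probability (borel (curve X)) R) (G f psi phi : borel X -> R).

(** Along almost every curve, and at almost every time t, the values of phi at
    the grid times next to t converge to its value at t. *)
Definition plan_continuous phi := forall pi, test_plan pi ->
  {ae plan_time pi, forall z : borel (curve X) * measurableTypeR R, (0 < z.2 < 1)%R ->
    (phi (cev z.1 (grid n z.2)) @[n --> \oo] --> phi (cev z.1 z.2))%R /\
    (phi (cev z.1 (grid n z.2 + 2^-1 ^+ n)%R) @[n --> \oo] --> phi (cev z.1 z.2))%R}.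

Lemma half_expn_cvg0 : ((2^-1 : R) ^+ n @[n --> \oo] --> 0)%R.
Proof. by apply: cvg_expr; rewrite ger0_norm ?invr_ge0// invf_lt1// ltr1n. Qed.

Lemma grid_next_cvg (t : R) : (grid n t + 2^-1 ^+ n @[n --> \oo] --> t)%R.
Proof.
rewrite -[X in _ --> X]addr0; apply: cvgD; first exact: grid_cvg.
exact: half_expn_cvg0.
Qed.

Lemma continuous_plan_continuous (phi : X -> R) : continuous phi ->
  plan_continuous phi.
Proof.
move=> cphi pi _; have FF := ae_filter_ringOfSetsType (plan_time pi).
apply: nearW => -[g t] /= _; split.
  apply: continuous_cvg; first exact: cphi.
  by apply: continuous_cvg; [exact: cev_continuous|exact: grid_cvg].
apply: continuous_cvg; first exact: cphi.
by apply: continuous_cvg; [exact: cev_continuous|exact: grid_next_cvg].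
Qed.

Lemma grid_01 n (t : R) : (0 < t < 1)%R ->
  (0 <= grid n t <= 1)%R /\ (0 <= grid n t + 2^-1 ^+ n <= 1)%R.
Proof.
move=> /andP[t0 t1]; have p : (0 < 2 ^+ n :> R)%R by exact: exprn_gt0.
have /andP[gt _] := grid_itv n t.
have g0 : (0 <= grid n t)%R.
  by rewrite /grid divr_ge0 ?(ltW p)// ler0z floor_ge0 mulr_ge0 ?(ltW p)// ltW.
have h0 : (0 <= 2^-1 ^+ n :> R)%R by rewrite exprn_ge0// invr_ge0.
split; first by rewrite g0 (le_trans gt)// ltW.
rewrite addr_ge0//= /grid exprVn -[X in (_ + X)%R]mul1r -mulrDl ler_pdivrMr// mul1r.
have : (Num.floor (t * 2 ^+ n) < (2 ^ n)%N%:Z)%R.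
  by rewrite floor_lt_int -pmulrn natrX -[ltRHS]mul1r ltr_pM2r.
rewrite -lezD1 -(ler_int R) intrD.
by rewrite -pmulrn natrX.
Qed.

(** The increments of f between t and its 2^-n grid times are, on average, at most
    2^(1-n) times the flow: they are summable in n. *)
Lemma plan_gradient_continuous f G : measurable_fun setT f ->
  plan_gradient f G -> plan_continuous f.
Proof.
move=> mf pg pi tp; have FF := ae_filter_ringOfSetsType (plan_time pi).
have [mG G0 /(_ _ tp)[Foo _]] := pg.
have F0 : 0 <= flow pi G by apply: integral_ge0 => z _; rewrite lee_fin integrand_ge0.
have Ffin : flow pi G \is a fin_num by rewrite ge0_fin_numE.
have key (tau : nat -> R -> R) : (forall n, measurable_fun setT (tau n)) ->
  (forall n t, `|tau n t - t| <= 2^-1 ^+ n)%R ->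
  (forall n t, (0 < t < 1) -> (0 <= tau n t <= 1))%R ->
  {ae plan_time pi, forall z : borel (curve X) * measurableTypeR R, (0 < z.2 < 1)%R ->
    (f (cev z.1 (tau n z.2)) @[n --> \oo] --> f (cev z.1 z.2))%R}.
  move=> mtau taud tau01.
  pose D n (z : borel (curve X) * measurableTypeR R) := (`|f (cev z.1 (tau n z.2)) - f (cev z.1 z.2)| *
     \1_(`]0%R, 1%R[%classic) z.2)%R.
  have mD n : measurable_fun setT (D n).
    apply: measurable_funM; last first.
      apply: (@measurableT_comp _ _ _ _ _ _ (\1_(`]0%R, 1%R[%classic) : R -> R)); last exact: measurable_snd.
      exact: measurable_indic.
    apply: measurableT_comp => //; apply: measurable_funB.
      have mct := @measurable_cev_time R X (tau n) (mtau n).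
      exact: (measurableT_comp mf mct).
    exact: (measurableT_comp mf (measurable_cev sX)).
  have D0 n z : (0 <= D n z)%R by rewrite /D indicE mulr_ge0.
  have K0 : (0 <= fine (flow pi G) * 4)%R by rewrite mulr_ge0// fine_ge0.
  have Hb n : \int[plan_time pi]_z (D n z)%:E <=
      (fine (flow pi G) * 4 / (2 ^ n.+1)%:R)%:E.
    have h0 : (0 <= 2^-1 ^+ n :> R)%R by rewrite exprn_ge0// invr_ge0.
    apply: (le_trans (increment_time_le pg mf tp h0 (mtau n) (taud n) (tau01 n))).
    rewrite -(fineK Ffin) -EFinM lee_fin natrX exprVn exprS invfM mulr2n.
    lra.
  have Dae := ae_cvg0_summable mD D0 K0 Hb.
  apply: filterS Dae => -[g t] /= Dz t01; apply/cvgrPdist_lt => e e0.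
  move/cvgrPdist_lt : Dz => /(_ e e0); apply: filterS => n.
  rewrite /D /= indicE mem_set/= ?in_itv//= mulr1 sub0r normrN normr_id.
  by rewrite distrC.
have k1 := key grid; have k2 := key (fun n t => grid n t + 2^-1 ^+ n)%R.
apply: filterS2 (k1 _ _ _) (k2 _ _ _) => //.
- by move=> z H1 H2 z01; split; [exact: H1|exact: H2].
- exact: measurable_grid.
- move=> n t; have /andP[g1 g2] := grid_itv n t.
  by rewrite ler_norml; apply/andP; split; lra.
- by move=> n t t01; have [] := grid_01 n t01.
- by move=> n; apply: measurable_funD; [exact: measurable_grid|exact: measurable_cst].
- move=> n t; have /andP[g1 g2] := grid_itv n t.
  by rewrite ler_norml; apply/andP; split; lra.
- by move=> n t t01; have [] := grid_01 n t01.
Qed.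

(** At the level c itself both gradients are used, because the grid values can
    approach c from both sides. *)
Definition switch phi (c : R) G1 G2 : borel X -> R :=
  fun x => ((if (c <= phi x)%R then G1 x else 0) + (if (phi x <= c)%R then G2 x else 0))%R.

Lemma measurable_switch phi c G1 G2 : measurable_fun setT phi ->
  measurable_fun setT G1 -> measurable_fun setT G2 ->
  measurable_fun setT (switch phi c G1 G2).
Proof.
move=> mphi mG1 mG2; apply: measurable_funD; apply: measurable_fun_if => //;
  try (by apply: measurable_funTS); try (by apply: measurable_fun_ler => //).
Qed.

(** The central estimate. Cut [0, 1] into 2^n intervals, and on each of them use
    the increments of f1 for the curves on which phi exceeds c at an endpoint, and
    those of f2 for the other curves; as n grows, the upper gradient in use at
    time t is eventually G1 if phi > c there and G2 if phi < c. *)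
Lemma plan_gradient_switch psi phi f1 f2 G1 G2 c :
  measurable_fun setT psi -> measurable_fun setT phi ->
  measurable_fun setT f1 -> measurable_fun setT f2 ->
  plan_gradient f1 G1 -> plan_gradient f2 G2 -> plan_continuous phi ->
  (forall x y, (c < phi x)%R || (c < phi y)%R -> `|psi y - psi x| <= `|f1 y - f1 x|)%R ->
  (forall x y, (phi x <= c)%R -> (phi y <= c)%R -> `|psi y - psi x| <= `|f2 y - f2 x|)%R ->
  plan_gradient psi (switch phi c G1 G2).
Proof.
move=> mpsi mphi mf1 mf2 pg1 pg2 cphi H1 H2.
have [mG1 G10 F1] := pg1; have [mG2 G20 F2] := pg2.
have mK := measurable_switch c mphi mG1 mG2.
have K0 x : (0 <= switch phi c G1 G2 x)%R.
  by rewrite /switch addr_ge0//; case: ifPn.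
split => // pi tp; have FF := ae_filter_ringOfSetsType (plan_time pi).
have [F1oo _] := F1 _ tp; have [F2oo _] := F2 _ tp.
pose K := switch phi c G1 G2.
have mi G : measurable_fun setT G ->
    measurable_fun setT (fun z : borel (curve X) * measurableTypeR R => (integrand G z)%:E).
  by move=> mG; apply/measurable_EFinP; exact: measurable_integrand.
have KG z : (integrand K z <= integrand G1 z + integrand G2 z)%R.
  rewrite /integrand -mulrDl ler_wpM2r ?speed_ge0// /K /switch lerD//; by case: ifPn.
pose B (z : borel (curve X) * measurableTypeR R) := (integrand G1 z)%:E + (integrand G2 z)%:E.
have mB : measurable_fun setT B by apply: emeasurable_funD; exact: mi.
have B0 z : 0 <= B z by rewrite adde_ge0// lee_fin integrand_ge0.
have iB : (plan_time pi).-integrable setT B.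
  apply/integrableP; split => //; under eq_integral do rewrite gee0_abs//.
  rewrite ge0_integralD//; first by rewrite lte_add_pinfty.
  - by move=> z _; rewrite lee_fin integrand_ge0.
  - exact: mi.
  - by move=> z _; rewrite lee_fin integrand_ge0.
  - exact: mi.
pose u n (z : borel (curve X) * measurableTypeR R) : R :=
  (if near_above phi c n z then integrand G1 z else integrand G2 z)%R.
pose v n (z : borel (curve X) * measurableTypeR R) : \bar R := (Num.max (u n z) (integrand K z))%:E.
have u0 n z : (0 <= u n z)%R by rewrite /u; case: ifPn => _; exact: integrand_ge0.
have mu_ n : measurable_fun setT (u n).
  apply: measurable_fun_if => //.
  - exact: measurable_near_above.
  - by apply: measurable_funTS; exact: measurable_integrand.
  - by apply: measurable_funTS; exact: measurable_integrand.
have mv n : measurable_fun setT (v n).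
  by apply/measurable_EFinP; apply: measurable_maxr => //; exact: measurable_integrand.
have vcvg : {ae plan_time pi, forall z, setT z ->
    v n z @[n --> \oo] --> (integrand K z)%:E}.
  apply: filterS (cphi _ tp) => z Hz _; apply: cvg_EFin.
    by apply: nearW.
  apply: cvg_near_cst.
  have [z01|z01] := boolP (0 < z.2 < 1)%R; last first.
    apply: nearW => n; rewrite /= /u /integrand speed_out// !mulr0.
    by rewrite if_same maxxx.
  have [A1 A2] := Hz z01.
  have [lt|gt|eq] := ltgtP (phi (cev z.1 z.2)) c.
  - have E1 := cvgr_lt _ A1 _ lt; have E2 := cvgr_lt _ A2 _ lt.
    near=> n.
    have e1 : (phi (cev z.1 (grid n z.2)) < c)%R by near: n; exact: E1.
    have e2 : (phi (cev z.1 (grid n z.2 + 2^-1 ^+ n)%R) < c)%R by near: n; exact: E2.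
    rewrite /= /u /near_above ltNge (ltW e1) ltNge (ltW e2)/=.
    by rewrite /integrand /K /switch leNgt lt/= (ltW lt) add0r maxxx.
  - have E1 := cvgr_gt _ A1 _ gt.
    near=> n; have e1 : (c < phi (cev z.1 (grid n z.2)))%R by near: n; exact: E1.
    rewrite /= /u /near_above e1/=.
    by rewrite /integrand /K /switch (ltW gt) leNgt gt/= addr0 maxxx.
  - apply: nearW => n /=; apply/max_idPr.
    rewrite /u /integrand /K /switch eq lexx.
    by case: ifPn => _; rewrite ler_wpM2r ?speed_ge0// ?lerDl ?lerDr.
have vB : {ae plan_time pi, forall z, forall n, setT z -> `|v n z| <= B z}.
  apply: nearW => z n _; rewrite gee0_abs; last by rewrite lee_fin le_max u0.
  rewrite /B -EFinD lee_fin ge_max KG andbT /u.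
  by case: ifPn => _; rewrite ?lerDl ?lerDr integrand_ge0.
have [iK _ vlim] := dominated_convergence measurableT mv (mi _ mK) vcvg iB vB.
split.
  move/integrableP : iK => [_]; apply: le_lt_trans.
  by under [leRHS]eq_integral do rewrite gee0_abs ?lee_fin ?integrand_ge0//.
apply: (cvge_to_ge vlim); apply: nearW => n /=.
apply: (le_trans (partition_ineq n tp mpsi mphi mf1 mf2 pg1 pg2 H1 H2)).
apply: ge0_le_integral => //.
- by move=> z _; rewrite lee_fin; exact: u0.
- by apply/measurable_EFinP; exact: mu_.
- by move=> z _; rewrite lee_fin le_max lexx.
Unshelve. all: by end_near. Qed.

End switching.

(** * Stability of upper gradients *)

Section calculus.
Context {R : realType} (X : mmSpace R).
Local Open Scope ereal_scope.
Implicit Types (pi : probability (borel (curve X)) R) (G F K f g psi phi : borel X -> R).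

Lemma measurable_integrandE G : measurable_fun setT G ->
  measurable_fun setT (fun z : borel (curve X) * measurableTypeR R => (integrand G z)%:E).
Proof. by move=> mG; apply/measurable_EFinP; exact: measurable_integrand. Qed.

Lemma le_flow pi F G : measurable_fun setT F -> measurable_fun setT G ->
  (forall x, 0 <= F x)%R -> (forall x, F x <= G x)%R -> flow pi F <= flow pi G.
Proof.
move=> mF mG F0 FG; apply: ge0_le_integral => //.
- by move=> z _; rewrite lee_fin integrand_ge0.
- exact: measurable_integrandE.
- exact: measurable_integrandE.
- by move=> z _; rewrite lee_fin ler_wpM2r// speed_ge0.
Qed.

Lemma flowD pi F G : measurable_fun setT F -> measurable_fun setT G ->
  (forall x, 0 <= F x)%R -> (forall x, 0 <= G x)%R ->
  flow pi (F \+ G)%R = flow pi F + flow pi G.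
Proof.
move=> mF mG F0 G0; rewrite /flow -ge0_integralD//.
- by apply: eq_integral => z _; rewrite -EFinD /integrand /= mulrDl.
- by move=> z _; rewrite lee_fin integrand_ge0.
- exact: measurable_integrandE.
- by move=> z _; rewrite lee_fin integrand_ge0.
- exact: measurable_integrandE.
Qed.

Lemma measurable_incr f : measurable_fun setT f ->
  measurable_fun setT (fun g : borel (curve X) => `|f (cev g 1) - f (cev g 0)|%:E).
Proof. by move=> mf; apply/measurable_EFinP; exact: measurable_increment. Qed.

(** Covers sums, and also minima and maxima of two functions. *)
Lemma plan_gradient_le_add f g psi F G : measurable_fun setT f -> measurable_fun setT g ->
  measurable_fun setT psi ->
  (forall x y, `|psi y - psi x| <= `|f y - f x| + `|g y - g x|)%R ->
  plan_gradient f F -> plan_gradient g G -> plan_gradient psi (F \+ G)%R.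
Proof.
move=> mf mg mpsi H [mF F0 HF] [mG G0 HG]; split.
- exact: measurable_funD.
- by move=> x /=; rewrite addr_ge0.
move=> pi tp; have [f1 f2] := HF _ tp; have [g1 g2] := HG _ tp.
rewrite (flowD pi mF mG F0 G0); split; first exact: (lte_add_pinfty f1 g1).
have if1 := measurable_incr mf; have ig1 := measurable_incr mg.
have ip1 := measurable_incr mpsi.
apply: le_trans (leeD f2 g2); rewrite -ge0_integralD//.
apply: ge0_le_integral => //; first exact: emeasurable_funD.
by move=> c _; rewrite -EFinD lee_fin.
Qed.

Lemma plan_gradientD f g F G : measurable_fun setT f -> measurable_fun setT g ->
  plan_gradient f F -> plan_gradient g G ->
  plan_gradient (f \+ g)%R (F \+ G)%R.
Proof.
move=> mf mg; apply: plan_gradient_le_add => //; first exact: measurable_funD.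
by move=> x y; rewrite /= opprD addrACA ler_normD.
Qed.

Lemma plan_gradient_contraction f psi G : measurable_fun setT f ->
  measurable_fun setT psi -> (forall x y, `|psi y - psi x| <= `|f y - f x|)%R ->
  plan_gradient f G -> plan_gradient psi G.
Proof.
move=> mf mpsi H [mG G0 HG]; split => // pi tp; have [f1 f2] := HG _ tp.
split => //; apply: le_trans f2; apply: ge0_le_integral => //.
- exact: measurable_incr.
- exact: measurable_incr.
- by move=> c _; rewrite lee_fin.
Qed.

Lemma plan_gradient_cst (c : R) : plan_gradient (cst c : borel X -> R) (cst 0%R).
Proof.
split=> [|//|pi tp]; first exact: measurable_cst.
have -> : flow pi (cst 0%R) = 0.
  by apply: integral0_eq => z _; rewrite /integrand mul0r.
split => //; rewrite integral0_eq// => g _.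
by rewrite /= subrr normr0.
Qed.

Lemma plan_gradient_le f F G : plan_gradient f F -> measurable_fun setT G ->
  (forall x, F x <= G x)%R -> (forall pi, test_plan pi -> flow pi G < +oo) ->
  plan_gradient f G.
Proof.
move=> [mF F0 HF] mG FG Goo; split => //.
  by move=> x; exact: le_trans (FG x).
move=> pi tp; split; first exact: Goo.
by apply: le_trans ((HF _ tp).2) _; exact: le_flow.
Qed.

Lemma plan_gradient_cvg f (G_ : nat -> borel X -> R) G K :
  (forall n, plan_gradient f (G_ n)) -> measurable_fun setT K ->
  (forall pi, test_plan pi -> flow pi K < +oo) -> (forall n x, G_ n x <= K x)%R ->
  (forall x, G_ n x @[n --> \oo] --> G x)%R -> plan_gradient f G.
Proof.
move=> H mK Koo GK Gcvg.
have mG_ n : measurable_fun setT (G_ n) by have [] := H n.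
have G_0 n x : (0 <= G_ n x)%R by have [_ + _] := H n; exact.
have mG : measurable_fun setT G by exact: measurable_fun_cvg (fun x _ => Gcvg x).
have G0 x : (0 <= G x)%R.
  by apply: (cvgr_to_ge (Gcvg x)); exact: nearW.
split => // pi tp.
have K0 x : (0 <= K x)%R by exact: le_trans (GK 0%N x).
have iK : (plan_time pi).-integrable setT (fun z => (integrand K z)%:E).
  apply/integrableP; split; first exact: measurable_integrandE.
  under eq_integral do rewrite gee0_abs ?lee_fin ?integrand_ge0//.
  exact: Koo.
have vcvg : {ae plan_time pi, forall z, setT z ->
    (integrand (G_ n) z)%:E @[n --> \oo] --> (integrand G z)%:E}.
  apply: nearW => z _; apply: cvg_EFin; first exact: nearW.
  by apply: cvgM; [exact: Gcvg|exact: cvg_cst].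
have vB : {ae plan_time pi, forall z, forall n, setT z ->
    `|(integrand (G_ n) z)%:E| <= (integrand K z)%:E}.
  apply: nearW => z n _; rewrite gee0_abs ?lee_fin ?integrand_ge0//.
  by rewrite ler_wpM2r// speed_ge0.
have [iG _ vlim] := dominated_convergence measurableT
  (fun n => measurable_integrandE (mG_ n)) (measurable_integrandE mG) vcvg iK vB.
split.
  move/integrableP : iG => [_]; apply: le_lt_trans.
  by under [leRHS]eq_integral do rewrite gee0_abs ?lee_fin ?integrand_ge0//.
apply: (cvge_to_ge vlim); apply: nearW => n /=.
by have [_ _ Hn] := H n; have [] := Hn _ tp.
Qed.

(** Lower semicontinuity in f, by Fatou. *)
Lemma plan_gradient_cvgf (f_ : nat -> borel X -> R) f G :
  (forall n, measurable_fun setT (f_ n)) -> (forall n, plan_gradient (f_ n) G) ->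
  (forall x, f_ n x @[n --> \oo] --> f x)%R -> plan_gradient f G.
Proof.
move=> mf_ H fcvg; have [mG G0 HG] := H 0%N; split => // pi tp.
split; first by have [] := HG _ tp.
have mi n : measurable_fun setT
    (fun g : borel (curve X) => `|f_ n (cev g 1) - f_ n (cev g 0)|%:E).
  exact: measurable_incr.
have -> : \int[pi]_g `|f (cev g 1) - f (cev g 0)|%:E =
    \int[pi]_g limn_einf (fun n => `|f_ n (cev g 1) - f_ n (cev g 0)|%:E).
  apply: eq_integral => g _.
  have /cvg_limn_einf_sup[-> //] : `|f_ n (cev g 1) - f_ n (cev g 0)|%:E @[n --> \oo] -->
      `|f (cev g 1) - f (cev g 0)|%:E.
  apply: cvg_EFin; first exact: nearW.
  by apply: cvg_norm; apply: cvgB; exact: fcvg.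
apply: le_trans (@fatou _ _ _ pi setT measurableT _ mi _) _.
  by move=> n g _; rewrite lee_fin.
rewrite limn_einf_lim; apply: lime_le; first exact: is_cvg_einfs.
apply: nearW => n; apply: ge_ereal_inf.
exists (\int[pi]_g `|f_ n (cev g 1) - f_ n (cev g 0)|%:E) => /=; first by exists n => /=.
by have [_ _ Hn] := H n; have [] := Hn _ tp.
Qed.

End calculus.

(** * Mixing two upper gradients along a Borel set *)

Section mixing.
Context {R : realType} (X : mmSpace R).
Local Open Scope ereal_scope.
Let sX : separable X := mms_separable X.
Implicit Types (pi : probability (borel (curve X)) R) (G F K f g psi phi : borel X -> R).

Lemma flow_ae_eq pi F G : test_plan pi -> measurable_fun setT F -> measurable_fun setT G ->
  {ae \m_X, forall x, F x = G x} -> flow pi F = flow pi G.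
Proof.
move=> tp mF mG FG; have FF := ae_filter_ringOfSetsType (plan_time pi).
apply: ae_eq_integral => //; [exact: measurable_integrandE|exact: measurable_integrandE|].
by apply: filterS (test_plan_ae tp FG) => z H _; rewrite /integrand H.
Qed.

Lemma plan_gradient_ae f g F G : plan_gradient f F -> measurable_fun setT f ->
  measurable_fun setT g -> measurable_fun setT G -> (forall x, 0 <= G x)%R ->
  {ae \m_X, forall x, f x = g x} -> {ae \m_X, forall x, F x = G x} ->
  plan_gradient g G.
Proof.
move=> [mF F0 HF] mf mg mG G0 fg FG; split => // pi tp; have [H1 H2] := HF _ tp.
rewrite -(flow_ae_eq tp mF mG FG); split => //; apply: le_trans H2.
have FF := ae_filter_ringOfSetsType pi.
rewrite le_eqVlt; apply/orP; left; apply/eqP; apply: ae_eq_integral => //.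
- exact: measurable_incr.
- exact: measurable_incr.
have := test_plan_ae_at (0:R) tp fg; have := test_plan_ae_at (1:R) tp fg.
by apply: filterS2 => g' E1 E0 _; rewrite E1 E0.
Qed.

Definition mix (A : set X) G1 G2 : borel X -> R :=
  fun x => if x \in A then G1 x else G2 x.

Lemma measurable_mix (A : set (borel X)) G1 G2 : measurable A ->
  measurable_fun setT G1 -> measurable_fun setT G2 ->
  measurable_fun setT (mix A G1 G2).
Proof.
move=> mA m1 m2; apply: measurable_fun_if => //.
- apply: (measurable_fun_bool true); rewrite setTI.
  have -> // : (fun x : borel X => x \in A) @^-1` [set true] = A.
  by apply/seteqP; split=> x /=; [move/set_mem|move/mem_set].
- exact: measurable_funTS.
- exact: measurable_funTS.
Qed.

Lemma mix_in (A : set X) G1 G2 x : A x -> mix A G1 G2 x = G1 x.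
Proof. by move=> Ax; rewrite /mix mem_set. Qed.

Lemma mix_out (A : set X) G1 G2 x : ~ A x -> mix A G1 G2 x = G2 x.
Proof. by move=> Ax; rewrite /mix memNset. Qed.

Lemma mix_le_add (A : set X) G1 G2 x : (forall x, 0 <= G1 x)%R ->
  (forall x, 0 <= G2 x)%R -> (mix A G1 G2 x <= G1 x + G2 x)%R.
Proof. by move=> h1 h2; rewrite /mix; case: ifPn; rewrite (lerDl, lerDr). Qed.

Definition mixes (A : set X) := forall f G1 G2, measurable_fun setT f ->
  plan_gradient f G1 -> plan_gradient f G2 -> plan_gradient f (mix A G1 G2).

Lemma plan_gradient_pair f1 f2 G1 G2 : plan_gradient f1 G1 -> plan_gradient f2 G2 ->
  forall pi, test_plan pi -> flow pi (G1 \+ G2)%R < +oo.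
Proof.
move=> [m1 p1 H1] [m2 p2 H2] pi tp; rewrite flowD// lte_add_pinfty//.
- by have [] := H1 _ tp.
- by have [] := H2 _ tp.
Qed.

(** The switching estimate at the levels 1/(n+1), in the limit. *)
Lemma mixes_gt0 phi : measurable_fun setT phi -> plan_continuous phi ->
  mixes [set x | (0 < phi x)%R].
Proof.
move=> mphi cphi f G1 G2 mf p1 p2; have [m1 h1 _] := p1; have [m2 h2 _] := p2.
apply: (@plan_gradient_cvg _ _ _ (fun n => switch phi (n.+1%:R^-1) G1 G2) _ (G1 \+ G2)%R).
- by move=> n; apply: (plan_gradient_switch mf mphi mf mf p1 p2 cphi).
- exact: measurable_funD.
- exact: plan_gradient_pair p1 p2.
- by move=> n x; rewrite /switch /= lerD//; case: ifPn.
move=> x; apply: cvg_near_cst; rewrite /switch.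
have [x0|x0] := ltP 0%R (phi x).
  rewrite mix_in//=.
  near=> n; have H : (n.+1%:R^-1 < phi x)%R by near: n; exact: near_infty_natSinv_lt (PosNum x0).
  by rewrite (ltW H) leNgt H/= addr0.
rewrite mix_out/=; last by rewrite ltNge x0.
apply: nearW => n.
have H : (phi x < n.+1%:R^-1)%R by apply: le_lt_trans x0 _; rewrite invr_gt0.
by rewrite (ltW H) leNgt H/= add0r.
Unshelve. all: by end_near. Qed.

Lemma mixes0 : mixes set0.
Proof.
move=> f G1 G2 _ _ H; rewrite [mix _ _ _](_ : _ = G2)//.
by apply/funext => x; rewrite mix_out.
Qed.

Lemma mixesC A : mixes A -> mixes (~` A).
Proof.
move=> H f G1 G2 mf p1 p2; rewrite [mix _ _ _](_ : _ = mix A G2 G1); first exact: H.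
by apply/funext => x; rewrite /mix in_setC; case: (x \in A).
Qed.

Lemma mixesU A B : mixes A -> mixes B -> mixes (A `|` B).
Proof.
move=> HA HB f G1 G2 mf p1 p2.
rewrite [mix _ _ _](_ : _ = mix A G1 (mix B G1 G2)); first by apply: HA => //; exact: HB.
by apply/funext => x; rewrite /mix in_setU; case: (x \in A).
Qed.

Lemma mixes_bigcup (A_ : nat -> set X) : (forall n, mixes (A_ n)) -> mixes (\bigcup_n A_ n).
Proof.
move=> HA; pose B n := \big[setU/set0]_(i < n) A_ i.
have HB n : mixes (B n).
  elim: n => [|n IH]; rewrite /B ?big_ord0 ?big_ord_recr/=; first exact: mixes0.
  exact: mixesU.
move=> f G1 G2 mf p1 p2; have [m1 h1 _] := p1; have [m2 h2 _] := p2.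
apply: (@plan_gradient_cvg _ _ _ (fun n => mix (B n) G1 G2) _ (G1 \+ G2)%R).
- by move=> n; exact: HB.
- exact: measurable_funD.
- exact: plan_gradient_pair p1 p2.
- by move=> n x; exact: mix_le_add.
move=> x; apply: cvg_near_cst.
have [[k _ kx]|nx] := pselect ((\bigcup_n A_ n) x).
  rewrite mix_in; last by exists k.
  exists k.+1 => // n /= kn; apply: mix_in; rewrite /B -bigcup_mkord.
  by exists k.
rewrite mix_out//; apply: nearW => n; apply: mix_out; rewrite /B -bigcup_mkord.
by move=> [k _ kx]; apply: nx; exists k.
Qed.

Lemma mixes_ball (x : X) (r : R) : mixes (ball x r).
Proof.
have c : continuous (fun y : X => r - mdist y x)%R.
  by move=> y; apply: cvgB; [exact: cvg_cst|exact: mdist_continuous_l].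
have := @mixes_gt0 (fun y => r - mdist y x)%R (continuous_borel_measurableR c)
  (continuous_plan_continuous c).
congr mixes; apply/seteqP; split=> y /=; rewrite ballEmdist/= subr_gt0 metric_sym//.
Qed.

(** The sets along which two gradients can be mixed form a sigma-algebra containing
    the balls. *)
Lemma mixes_measurable (A : set (borel X)) : measurable A -> mixes A.
Proof.
have H : @open X `<=` mixes.
  move=> U oU; rewrite (open_bigcup_ball sX oU) bigcup_mkcond.
  pose u (p : nat * nat) := if p \in [set nk : nat * nat |
         ball (dense_seq sX nk.1) (nk.2.+1%:R^-1) `<=` U]
      then ball (dense_seq sX p.1) (p.2.+1%:R^-1) else set0.
  rewrite -/u.
  have -> : \bigcup_p u p = \bigcup_n (if unpickle n is Some p then u p else set0).
    apply/seteqP; split=> [x [p _ px]|x [n _]].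
      by exists (pickle p) => //; rewrite pickleK.
    by case: (unpickle n) => // p px; exists p.
  apply: mixes_bigcup => n; case: (unpickle n) => [p|]; last exact: mixes0.
  by rewrite /u; case: ifPn => _; [exact: mixes_ball|exact: mixes0].
have K : <<s @open X >> `<=` mixes; last by move=> mA; exact: K.
apply: smallest_sub => //; split.
- exact: mixes0.
- by move=> B HB; rewrite setTD; exact: mixesC.
- exact: mixes_bigcup.
Qed.

Lemma plan_gradient_mix (A : set (borel X)) f G1 G2 : measurable A ->
  measurable_fun setT f -> plan_gradient f G1 -> plan_gradient f G2 ->
  plan_gradient f (mix A G1 G2).
Proof. by move=> mA; exact: mixes_measurable. Qed.

End mixing.

(** * The minimal weak upper gradient *)

Lemma sqr_le_twice_sqrD (R : realFieldType) (k a b : R) : 0 <= k -> k <= a + b ->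
  k ^+ 2 <= 2 * (a ^+ 2 + b ^+ 2).
Proof.
move=> k0 kab; have kk : k * k <= (a + b) * (a + b) by apply: ler_pM.
by have := sqr_ge0 (a - b); rewrite !expr2 in kk *; nra.
Qed.

Section minimal.
Context {R : realType} (X : mmSpace R).
Local Open Scope ereal_scope.
Implicit Types (pi : probability (borel (curve X)) R) (G F K H f g psi phi : borel X -> R).

Lemma measurable_sqr F : measurable_fun setT F ->
  measurable_fun setT (fun x => (F x ^+ 2)%:E).
Proof. by move=> mF; apply/measurable_EFinP; exact: measurable_funX. Qed.

Lemma Lfun2_measurable F : F \in Lfun \m_X 2%:E -> measurable_fun setT F.
Proof. by move=> /Lfun2P[]. Qed.

Lemma Lfun2_dom F G K : measurable_fun setT K ->
  F \in Lfun \m_X 2%:E -> G \in Lfun \m_X 2%:E ->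
  (forall x, `|K x| <= `|F x| + `|G x|)%R -> K \in Lfun \m_X 2%:E.
Proof.
move=> mK /Lfun2P[mF iF] /Lfun2P[mG iG] KFG; apply/Lfun2P; split => //.
have m2 := measurable_sqr.
apply: (@le_lt_trans _ _ (\int[\m_X]_x (2%:E * (F x ^+ 2)%:E + 2%:E * (G x ^+ 2)%:E))).
  apply: ge0_le_integral => //.
  - by move=> x _; rewrite lee_fin sqr_ge0.
  - exact: m2.
  - by apply: emeasurable_funD; apply: measurable_funeM; exact: m2.
  - move=> x _; rewrite -!EFinM -EFinD lee_fin -mulrDr.
    rewrite -(real_normK (num_real (K x))) -(real_normK (num_real (F x)))
      -(real_normK (num_real (G x))).
    by apply: sqr_le_twice_sqrD; [exact: normr_ge0|exact: KFG].
rewrite ge0_integralD//; last 4 first.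
- by move=> x _; rewrite -EFinM lee_fin mulr_ge0// sqr_ge0.
- by apply: measurable_funeM; exact: m2.
- by move=> x _; rewrite -EFinM lee_fin mulr_ge0// sqr_ge0.
- by apply: measurable_funeM; exact: m2.
rewrite !ge0_integralZl_EFin//; try (by move=> x _; rewrite lee_fin sqr_ge0);
  try exact: m2.
by rewrite lte_add_pinfty// lte_mul_pinfty.
Qed.

Lemma Lfun2_le F K : measurable_fun setT K -> F \in Lfun \m_X 2%:E ->
  (forall x, `|K x| <= `|F x|)%R -> K \in Lfun \m_X 2%:E.
Proof.
move=> mK iF H; apply: (Lfun2_dom mK iF iF) => x.
by apply: le_trans (H x) _; rewrite lerDl.
Qed.

Lemma Lfun2_mix (A : set (borel X)) F G : measurable A -> F \in Lfun \m_X 2%:E ->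
  G \in Lfun \m_X 2%:E -> mix A F G \in Lfun \m_X 2%:E.
Proof.
move=> mA iF iG; apply: (Lfun2_dom _ iF iG).
  by apply: measurable_mix => //; exact: Lfun2_measurable.
by move=> x; rewrite /mix; case: ifPn; rewrite ?lerDl ?lerDr.
Qed.

Lemma sqr_integral_le_ae_eq F G : F \in Lfun \m_X 2%:E -> G \in Lfun \m_X 2%:E ->
  (forall x, 0 <= F x <= G x)%R ->
  \int[\m_X]_x (G x ^+ 2)%:E <= \int[\m_X]_x (F x ^+ 2)%:E ->
  {ae \m_X, forall x, F x = G x}.
Proof.
move=> /Lfun2P[mF iF] /Lfun2P[mG iG] FG le.
have m2 := measurable_sqr.
have I H : measurable_fun setT H -> \int[\m_X]_x (H x ^+ 2)%:E < +oo ->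
    (\m_X).-integrable setT (fun x => (H x ^+ 2)%:E).
  move=> mH iH; apply/integrableP; split; first exact: m2.
  by under eq_integral do rewrite gee0_abs ?lee_fin ?sqr_ge0//.
pose d x := ((G x ^+ 2)%:E - (F x ^+ 2)%:E).
have md : measurable_fun setT d by apply: emeasurable_funB; exact: m2.
have d0 x : 0 <= d x.
  by rewrite /d -EFinB lee_fin subr_ge0; have := FG x; nra.
have : \int[\m_X]_x `|d x| = 0.
  under eq_integral do rewrite gee0_abs//.
  rewrite integralB//; [|exact: I|exact: I].
  apply/eqP; rewrite eq_le; apply/andP; split.
    rewrite sube_le0; exact: le.
  rewrite sube_ge0; last first.
    by rewrite ge0_fin_numE ?iF//; apply: integral_ge0 => x _; rewrite lee_fin sqr_ge0.
  apply: ge0_le_integral => //; try (by move=> x _; rewrite lee_fin sqr_ge0); try exact: m2.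
  by move=> x _; rewrite lee_fin; have := FG x; nra.
move/(ae_eq_integral_abs \m_X measurableT md).
have FF := ae_filter_ringOfSetsType \m_X.
apply: filterS => x /(_ Logic.I) d0x; have /andP[F0 FGx] := FG x.
have E : (G x ^+ 2 = F x ^+ 2)%R by apply: subr0_eq; apply: EFin_inj; exact: d0x.
by apply/eqP; rewrite -(@eqrXn2 _ 2)// ?E//; exact: le_trans FGx.
Qed.

Lemma wug_mix (A : set (borel X)) f G1 G2 : measurable A -> measurable_fun setT f ->
  weak_upper_gradient f G1 -> weak_upper_gradient f G2 ->
  weak_upper_gradient f (mix A G1 G2).
Proof.
move=> mA mf /weak_upper_gradientP[i1 p1] /weak_upper_gradientP[i2 p2].
apply/weak_upper_gradientP; split; first exact: Lfun2_mix.
exact: plan_gradient_mix.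
Qed.

Lemma wug_min f G1 G2 : measurable_fun setT f ->
  weak_upper_gradient f G1 -> weak_upper_gradient f G2 ->
  weak_upper_gradient f (fun x => Num.min (G1 x) (G2 x)).
Proof.
move=> mf w1 w2.
have [i1 [m1 _ _]] := (weak_upper_gradientP _ _).1 w1.
have [i2 [m2 _ _]] := (weak_upper_gradientP _ _).1 w2.
have -> : (fun x => Num.min (G1 x) (G2 x)) = mix [set x | (G1 x < G2 x)%R] G1 G2.
  apply/funext => x; rewrite /mix; case: ifPn; rewrite ?notin_setE ?inE/=.
    by move=> lt; rewrite min_l// ltW.
  by move/negP; rewrite -leNgt => le; rewrite min_r.
apply: wug_mix => //.
have := measurable_fun_ltr m1 m2 => /(_ measurableT [set true]).
by rewrite setTI => /(_ I); congr measurable; apply/seteqP; split => x /=.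
Qed.

(** The minimum is attained because weak upper gradients are stable under binary
    minima and dominated limits: a minimizing sequence of the L^2 norm can be
    made decreasing. *)
Lemma min_weak_upper_gradient_exists f : sobolev_class f ->
  exists G, is_min_weak_upper_gradient f G.
Proof.
move=> [mf [G00 wG00]].
pose nrm G := \int[\m_X]_x (G x ^+ 2)%:E.
pose S := [set nrm G | G in [set G | weak_upper_gradient f G]].
have S0 : S !=set0 by exists (nrm G00), G00.
have nrm0 G : 0 <= nrm G by apply: integral_ge0 => x _; rewrite lee_fin sqr_ge0.
have nrmoo G : weak_upper_gradient f G -> nrm G < +oo.
  by move=> /weak_upper_gradientP[/Lfun2P[]].
have inf0 : 0 <= ereal_inf S by apply: le_ereal_inf_tmp => _ [G _ <-].
have inffin : ereal_inf S \is a fin_num.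
  rewrite ge0_fin_numE//; apply: le_lt_trans (nrmoo _ wG00).
  by apply: ereal_inf_lbound; exists G00.
have /choice[G_ HG] : forall n, exists G, weak_upper_gradient f G /\
    nrm G < ereal_inf S + (n.+1%:R^-1)%:E.
  move=> n; have [_ [G wG <-] lt] := @lb_ereal_inf_adherent _ S n.+1%:R^-1
    ltac:(by rewrite invr_gt0) inffin.
  by exists G.
pose H := fix H n x := if n is k.+1 then Num.min (H k x) (G_ k.+1 x) else G_ 0%N x.
have wH n : weak_upper_gradient f (H n).
  elim: n => [|n IH]; first by case: (HG 0%N).
  by have [wG _] := HG n.+1; exact: (wug_min mf IH wG).
have wp n := (weak_upper_gradientP _ _).1 (wH n).
have H0 n x : (0 <= H n x)%R by have [_ []] := wp n.
have HGn n x : (H n x <= G_ n x)%R by case: n => //= n; rewrite ge_min lexx orbT.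
have Hdec x : {homo (H^~ x) : n m / (n <= m)%N >-> (m <= n)%R}.
  by apply/nonincreasing_seqP => n /=; rewrite ge_min lexx.
have Hcvg x : cvgn (H^~ x).
  apply: nonincreasing_is_cvgn; first exact: Hdec.
  by exists 0%R => _ [n _ <-].
pose L x := limn (H^~ x).
have HL x : (H n x @[n --> \oo] --> L x)%R by exact: Hcvg.
have LH n x : (L x <= H n x)%R by apply: nonincreasing_cvgn_ge => //; exact: Hdec.
have L0 x : (0 <= L x)%R by apply: (cvgr_to_ge (HL x)); exact: nearW.
have [i0 [m0 p0 f0]] := wp 0%N.
have pL : plan_gradient f L.
  apply: (@plan_gradient_cvg _ _ _ H _ (H 0%N)) => //.
  - by move=> n; have [] := wp n.
  - by move=> pi tp; have [] := f0 _ tp.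
  - by move=> n x; exact: Hdec.
have mL : measurable_fun setT L by case: pL.
have wL : weak_upper_gradient f L.
  apply/weak_upper_gradientP; split => //; apply: (Lfun2_le mL i0) => x.
  by rewrite !ger0_norm.
have nL : nrm L <= ereal_inf S.
  apply/lee_addgt0Pr => e e0.
  have [n _ ne] := near_infty_natSinv_lt (PosNum e0).
  have lt := (HG n).2; have ne' := ne n (leqnn _).
  apply: le_trans (_ : nrm (G_ n) <= _); last first.
    by apply: le_trans (ltW lt) _; rewrite leeD2l// lee_fin ltW.
  have [/Lfun2P[mGn _] _] := (weak_upper_gradientP _ _).1 (HG n).1.
  apply: ge0_le_integral => //; try exact: measurable_sqr.
  - by move=> x _; rewrite lee_fin sqr_ge0.
  - move=> x _; rewrite lee_fin lerXn2r ?nnegrE//.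
      exact: le_trans (H0 n x) _.
    exact: le_trans (LH n x) _.
exists L; split => // G' wG'.
have wK := wug_min mf wL wG'; set K := (fun x => _) in wK.
have [iK [mK K0 _]] := (weak_upper_gradientP _ _).1 wK.
have iL := ((weak_upper_gradientP _ _).1 wL).1.
have FF := ae_filter_ringOfSetsType \m_X.
have := @sqr_integral_le_ae_eq K L iK iL => HKL.
apply: filterS (HKL _ _) => [x <-||].
- by rewrite /K ge_min lexx orbT.
- by move=> x; rewrite K0 /K ge_min lexx.
- by apply: le_trans nL _; apply: ereal_inf_lbound; exists K.
Qed.
End minimal.

(** * Locality of the minimal weak upper gradient *)

(** The soft thresholding function. *)
Definition shrink (R : realDomainType) (a t : R) : R :=
  Num.max (t - a) 0 + Num.min (t + a) 0.

Lemma shrink_lipschitz (R : realFieldType) (a s t : R) : 0 <= a ->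
  `|shrink a t - shrink a s| <= `|t - s|.
Proof.
move=> a0; rewrite /shrink ler_norml.
have := ler_norm (t - s); have := ler_norm (s - t); rewrite distrC.
by case: (leP (t - a) 0); case: (leP (s - a) 0); case: (leP (t + a) 0);
  case: (leP (s + a) 0) => *; lra.
Qed.

Lemma shrink_near (R : realFieldType) (a t : R) : 0 <= a -> `|shrink a t - t| <= a.
Proof.
move=> a0; rewrite /shrink ler_norml.
by case: (leP (t - a) 0); case: (leP (t + a) 0) => *; lra.
Qed.

Lemma shrink_eq0 (R : realFieldType) (a t : R) : `|t| <= a -> shrink a t = 0.
Proof.
by rewrite /shrink ler_norml => /andP[h1 h2]; rewrite max_r ?min_r ?addr0//; lra.
Qed.

Section locality.
Context {R : realType} (X : mmSpace R).
Local Open Scope ereal_scope.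
Implicit Types (pi : probability (borel (curve X)) R) (G F K H f g psi phi : borel X -> R).
Local Notation Df := (@min_weak_upper_gradient R X).

Lemma min_weak_upper_gradientP f : sobolev_class f -> is_min_weak_upper_gradient f (Df f).
Proof. by move=> /min_weak_upper_gradient_exists; exact: xgetPex. Qed.

Lemma min_wug f : sobolev_class f -> weak_upper_gradient f (Df f).
Proof. by move=> /min_weak_upper_gradientP[]. Qed.

Lemma min_plan_gradient f : sobolev_class f -> plan_gradient f (Df f).
Proof. by move=> /min_wug/weak_upper_gradientP[]. Qed.

Lemma min_Lfun2 f : sobolev_class f -> Df f \in Lfun \m_X 2%:E.
Proof. by move=> /min_wug/weak_upper_gradientP[]. Qed.

Lemma min_wug_ge0 f x : sobolev_class f -> (0 <= Df f x)%R.
Proof. by move=> /min_wug[]. Qed.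

Lemma min_wug_le f G : sobolev_class f -> weak_upper_gradient f G ->
  {ae \m_X, forall x, Df f x <= G x}%R.
Proof. by move=> /min_weak_upper_gradientP[_]; exact. Qed.

Lemma plan_gradient_isometric f psi G : measurable_fun setT f -> measurable_fun setT psi ->
  (forall x y, `|psi y - psi x| = `|f y - f x|)%R ->
  plan_gradient f G <-> plan_gradient psi G.
Proof. by move=> mf mp H; split; apply: plan_gradient_contraction => // x y; rewrite H. Qed.

(** The two functions have the same weak upper gradients, so even the chosen
    minimal ones coincide. *)
Lemma min_wug_isometric f psi : measurable_fun setT f -> measurable_fun setT psi ->
  (forall x y, `|psi y - psi x| = `|f y - f x|)%R -> Df f = Df psi.
Proof.
move=> mf mp H; rewrite /min_weak_upper_gradient; congr xget.
have W : weak_upper_gradient f = weak_upper_gradient psi.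
  by apply/funext => G; apply/propext; rewrite !weak_upper_gradientP (plan_gradient_isometric G mf mp H).
by rewrite /is_min_weak_upper_gradient W.
Qed.

(** Where f vanishes its gradient can be dropped: shrink a o f does not vary along a
    curve while |f| <= a, and it tends to f as a tends to 0. *)
Lemma plan_gradient_support f G : measurable_fun setT f -> plan_gradient f G ->
  plan_gradient f (mix [set x | f x != 0%R] G (cst 0%R)).
Proof.
move=> mf pg; have [mG G0 HG] := pg.
have mfA : measurable_fun setT (fun x => `|f x|)%R by exact: measurableT_comp.
have cfA : plan_continuous (fun x => `|f x|)%R.
  apply: (@plan_gradient_continuous _ _ _ G) => //.
  by apply: (plan_gradient_contraction mf mfA _ pg) => x y; exact: ler_dist_dist.
have mA : measurable ([set x | f x != 0%R] : set (borel X)).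
  rewrite (_ : [set x | _] = ~` (f @^-1` [set 0%R])).
    by apply: measurableC; rewrite -[X in measurable X]setTI; exact: (mf measurableT [set 0%R]).
  by apply/seteqP; split => x /= /eqP.
have mK : measurable_fun setT (mix [set x | f x != 0%R] G (cst 0%R)).
  by apply: measurable_mix => //; exact: measurable_cst.
have K0 x : (0 <= mix [set x | f x != 0%R] G (cst 0%R) x)%R.
  by rewrite /mix; case: ifPn.
pose a (n : nat) : R := (n.+1%:R^-1)%R.
have a0 n : (0 < a n)%R by rewrite invr_gt0.
pose psi n x := shrink (a n) (f x).
have mpsi n : measurable_fun setT (psi n).
  apply: measurable_funD.
    by apply: measurable_maxr => //; exact: measurable_funB.
  by apply: measurable_minr => //; exact: measurable_funD.
apply: (@plan_gradient_cvgf _ _ psi).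
- exact: mpsi.
- move=> n; apply: (@plan_gradient_le _ _ _ (switch (fun x => `|f x|)%R (a n) G (cst 0%R))).
  + apply: (@plan_gradient_switch _ _ _ _ f (cst 0%R)) => //.
    * exact: plan_gradient_cst.
    * by move=> x y _; apply: shrink_lipschitz; exact: ltW.
    * by move=> x y h1 h2; rewrite /psi !shrink_eq0// subrr normr0.
  + exact: mK.
  + move=> x; rewrite /switch /mix; case: ifPn => fa; last by rewrite add0r if_same K0.
    rewrite mem_set/=; last by rewrite -normr_gt0 (lt_le_trans (a0 n)).
    by rewrite if_same addr0.
  + move=> pi tp; have [h _] := HG _ tp; apply: le_lt_trans h; apply: le_flow => // x.
    by rewrite /mix; case: ifPn.
move=> x; apply/cvgrPdist_le => e e0.
near=> n; rewrite distrC; apply: le_trans (shrink_near _ (ltW (a0 n))) _.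
by apply: ltW; near: n; exact: near_infty_natSinv_lt (PosNum e0).
Unshelve. all: by end_near. Qed.

Lemma plan_gradientN f G : measurable_fun setT f -> plan_gradient f G ->
  plan_gradient (\- f)%R G.
Proof.
move=> mf; apply: plan_gradient_contraction => //; first exact: measurable_funN.
by move=> x y /=; rewrite -opprD normrN.
Qed.

(** Apply the previous lemma to f - g. *)
Lemma plan_gradient_local (A : set (borel X)) f g F G : measurable A ->
  measurable_fun setT f -> measurable_fun setT g ->
  plan_gradient f F -> plan_gradient g G -> (forall x, A x -> f x = g x) ->
  plan_gradient f (mix A G F).
Proof.
move=> mA mf mg pf pg fg.
have mh : measurable_fun setT (f \- g)%R by exact: measurable_funB.
have ph : plan_gradient (f \- g)%R (F \+ G)%R.
  by apply: plan_gradientD => //; [exact: measurable_funN|exact: plan_gradientN].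
have pf' : plan_gradient f (G \+ mix [set x | (f \- g)%R x != 0%R] (F \+ G) (cst 0))%R.
  have E : (g \+ (f \- g))%R = f by apply/funext => x /=; rewrite addrC subrK.
  by have := plan_gradientD mg mh pg (plan_gradient_support mh ph); rewrite E.
have := plan_gradient_mix mA mf pf' pf; congr plan_gradient.
apply/funext => x; rewrite /mix; case: ifPn => // /set_mem Ax.
by rewrite /= ifF ?addr0// memNset//= fg// subrr eqxx.
Qed.

Lemma min_wug_local (A : set (borel X)) f g : measurable A ->
  sobolev_class f -> sobolev_class g -> (forall x, A x -> f x = g x) ->
  {ae \m_X, forall x, A x -> Df f x = Df g x}.
Proof.
move=> mA sf sg fg; have FF := ae_filter_ringOfSetsType \m_X.
have half f1 f2 : sobolev_class f1 -> sobolev_class f2 -> (forall x, A x -> f1 x = f2 x) ->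
    {ae \m_X, forall x, A x -> (Df f1 x <= Df f2 x)%R}.
  move=> s1 s2 f12.
  have w : weak_upper_gradient f1 (mix A (Df f2) (Df f1)).
    apply/weak_upper_gradientP; split; first by apply: Lfun2_mix => //; exact: min_Lfun2.
    by apply: (plan_gradient_local mA s1.1 s2.1 _ _ f12); exact: min_plan_gradient.
  by apply: filterS (min_wug_le s1 w) => x + Ax; rewrite mix_in.
have fg' x : A x -> g x = f x by move/fg.
apply: filterS2 (half _ _ sf sg fg) (half _ _ sg sf fg') => x h1 h2 Ax.
by apply/eqP; rewrite eq_le h1 ?h2.
Qed.

Lemma wug_cst (c : R) : weak_upper_gradient (cst c : borel X -> R) (cst 0%R).
Proof.
apply/weak_upper_gradientP; split; last exact: plan_gradient_cst.
apply/Lfun2P; split; first exact: measurable_cst.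
by rewrite integral0_eq// => x _; rewrite expr0n.
Qed.

Lemma sobolev_cst (c : R) : sobolev_class (cst c : borel X -> R).
Proof. by split; [exact: measurable_cst|exists (cst 0%R); exact: wug_cst]. Qed.

Lemma min_wug_level_set (A : set (borel X)) f (c : R) : measurable A -> sobolev_class f ->
  (forall x, A x -> f x = c) -> {ae \m_X, forall x, A x -> Df f x = 0%R}.
Proof.
move=> mA sf fc; have FF := ae_filter_ringOfSetsType \m_X.
apply: filterS2 (min_wug_local mA sf (sobolev_cst c) fc) (min_wug_le (sobolev_cst c) (wug_cst c)).
move=> x H D0 Ax; rewrite H//; apply/eqP; rewrite eq_le D0/=.
exact: min_wug_ge0 (sobolev_cst c).
Qed.

End locality.

(** * Lipschitz functions *)

Section lipschitz.
Context {R : realType} (X : mmSpace R).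
Local Open Scope ereal_scope.
Local Notation mu := (@lebesgue_measure R).
Let sX : separable X := mms_separable X.
Implicit Types (pi : probability (borel (curve X)) R) (G F K H f g psi phi : borel X -> R).
Local Notation Df := (@min_weak_upper_gradient R X).

Lemma energy_ge0 (g : curve X) : 0 <= energy g.
Proof.
by rewrite /energy; case: ifPn => // _; apply: integral_ge0 => r _; rewrite lee_fin sqr_ge0.
Qed.

Lemma measurable_length :
  measurable_fun setT (fun g : borel (curve X) => \int[mu]_t (speed g t)%:E).
Proof.
apply: (@measurable_fun_fubini_tonelli_F _ _ (borel (curve X)) (measurableTypeR R) R mu
  (fun z => (speed z.1 z.2)%:E)).
- by apply/measurable_EFinP; exact: measurable_speed.
- by move=> z; rewrite lee_fin speed_ge0.
Qed.

(** The exceptional curves are not absolutely continuous, so their energy is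
    infinite. *)
Lemma test_plan_mdist_le pi : test_plan pi ->
  {ae pi, forall g : borel (curve X),
    (mdist (cev g 0) (cev g 1))%:E <= \int[mu]_t (speed g t)%:E}.
Proof.
move=> [_ en].
pose N := [set g : borel (curve X) | \int[mu]_t (speed g t)%:E < (mdist (cev g 0) (cev g 1))%:E].
have mN : measurable N.
  rewrite -[N]setTI; apply: emeasurable_fun_lt; first exact: measurableT.
    exact: measurable_length.
  apply/measurable_EFinP; apply: (measurable_mdist sX); exact: measurable_cev_eval.
exists N; split => //; last first.
  by move=> g /= /negP; rewrite -ltNge.
apply/eqP; rewrite -measure_le0 leNgt; apply/negP => N0.
suff : \int[pi]_g energy g = +oo by move=> E; rewrite E ltxx in en.
apply/eqP; rewrite -leye_eq.
apply: (@le_trans _ _ (\int[pi]_g (if g \in N then +oo else 0))).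
  have -> : \int[pi]_g (if g \in N then +oo else 0) = \int[pi]_(g in N) +oo.
    rewrite [RHS]integral_mkcond; apply: eq_integral => g _.
    by rewrite patchE.
  by rewrite (integral_cst pi mN +oo) gt0_mulye.
apply: ge0_le_integral_lower => g; first by case: ifPn.
case: ifPn => [/set_mem Ng|_]; last exact: energy_ge0.
rewrite /energy ifF//; apply/negP => /asboolP /(abs_cont_mdist_le sX).
by rewrite leNgt Ng.
Qed.

Lemma plan_gradient_lipschitz f (c : R) : measurable_fun setT f -> (0 <= c)%R ->
  (forall x y : X, `|f x - f y| <= c * mdist x y)%R -> plan_gradient f (cst c).
Proof.
move=> mf c0 lf; split; first exact: measurable_cst.
  by move=> x.
move=> pi tp; have FF := ae_filter_ringOfSetsType pi; split.
  by apply: (flow_bounded_lty (c := c)) => // x; rewrite lexx c0.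
have -> : flow pi (cst c) = \int[pi]_g (c%:E * \int[mu]_t (speed g t)%:E).
  rewrite /flow /plan_time fubini_tonelli1//=; last 2 first.
  - by apply/measurable_EFinP; apply: measurable_integrand; exact: measurable_cst.
  - by move=> z; rewrite lee_fin integrand_ge0.
  apply: eq_integral => g _; rewrite -ge0_integralZl_EFin//.
  - by move=> t _; rewrite lee_fin speed_ge0.
  - by apply/measurable_EFinP; exact: measurable_speed1.
apply: ae_ge0_le_integral => //.
- exact: measurable_incr.
- move=> g _; rewrite mule_ge0//; apply: integral_ge0 => t _; rewrite lee_fin speed_ge0//.
- by apply: measurable_funeM; exact: measurable_length.
apply: filterS (test_plan_mdist_le tp) => g H _.
apply: (@le_trans _ _ (c%:E * (mdist (cev g 0) (cev g 1))%:E)).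
  by rewrite -EFinM lee_fin distrC; exact: lf.
by apply: lee_wpmul2l; rewrite ?lee_fin.
Qed.

Lemma lipschitz_continuous f (c : R) :
  (forall x y : X, `|f x - f y| <= c * mdist x y)%R -> continuous (f : X -> R).
Proof.
move=> lf x; apply/cvgrPdist_lt => e e0; apply/nbhs_ballP.
exists (e / (`|c| + 1))%R => /=; first by rewrite divr_gt0// ltr_wpDl.
move=> y; rewrite ballEmdist/= => xy; apply: le_lt_trans (lf _ _) _.
have c1 : (0 < `|c| + 1)%R by rewrite ltr_wpDl.
move: xy; rewrite ltr_pdivlMr// => xy; apply: le_lt_trans xy.
rewrite mulrC; apply: ler_wpM2l; first exact: mdist_ge0.
by apply: le_trans (ler_norm _) _; rewrite lerDl.
Qed.

Lemma lipschitz_measurable f (c : R) :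
  (forall x y : X, `|f x - f y| <= c * mdist x y)%R -> measurable_fun setT f.
Proof. by move=> lf; apply: continuous_borel_measurableR; exact: lipschitz_continuous lf. Qed.

Lemma ball_measurable (x : X) (r : R) : measurable (ball x r : set (borel X)).
Proof. by apply: sub_sigma_algebra; exact: mball_open. Qed.

(** By locality the constant gradient c can be replaced with 0 off the ball, which
    makes it square integrable. *)
Lemma W12_lipschitz (x0 : X) (r c M : R) f : finite_on_bounded X -> (0 <= c)%R ->
  (forall x y : X, `|f x - f y| <= c * mdist x y)%R -> (forall x, `|f x| <= M)%R ->
  (forall x, ~ ball x0 r x -> f x = 0%R) ->
  W12 f /\ {ae \m_X, forall x, Df f x <= c}%R.
Proof.
move=> fin c0 lf fM f0; have mf := lipschitz_measurable lf.
have FF := ae_filter_ringOfSetsType \m_X.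
have mB := ball_measurable x0 r.
have LB (k : R) : mix (~` ball x0 r) (cst 0%R) (cst k) \in Lfun \m_X 2%:E.
  apply/Lfun2P; split.
    by apply: measurable_mix; [exact: measurableC|exact: measurable_cst|exact: measurable_cst].
  apply: (@le_lt_trans _ _ (\int[\m_X]_(x in ball x0 r) (k ^+ 2)%:E)).
    rewrite [leRHS]integral_mkcond le_eqVlt; apply/orP; left; apply/eqP.
    apply: eq_integral => x _; rewrite patchE.
    have [xB|xB] := pselect (ball x0 r x).
      by rewrite mem_set// mix_out.
    by rewrite memNset// mix_in// expr0n.
  rewrite integral_cst//; apply: lte_mul_pinfty => //.
  - by rewrite lee_fin sqr_ge0.
  - by apply: fin => //; exists x0, r.
have w : weak_upper_gradient f (mix (~` ball x0 r) (cst 0%R) (cst c)).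
  apply/weak_upper_gradientP; split; first exact: LB.
  apply: (@plan_gradient_local _ _ (~` ball x0 r) f (cst 0%R) (cst c) (cst 0%R)) => //.
  - exact: measurableC.
  - exact: plan_gradient_lipschitz.
  - exact: plan_gradient_cst.
have sf : sobolev_class f by split => //; exists (mix (~` ball x0 r) (cst 0%R) (cst c)).
split.
  split => //; apply: Lfun2_le (LB M) _ => // x.
  have [xB|xB] := pselect (ball x0 r x).
    by rewrite mix_out//; apply: le_trans (fM x) _; exact: ler_norm.
  by rewrite mix_in// f0.
apply: filterS (min_wug_le sf w) => x /le_trans; apply.
by rewrite /mix; case: ifPn.
Qed.

End lipschitz.

(** * Sawtooth functions and the localization of the energy *)

Section sawtooth.
Context {R : realType}.
Implicit Types (d s t : R) (n : nat).

Definition nearest d t : int := Num.floor (t / d + 2^-1).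

(** The distance from t to the lattice d Z. *)
Definition saw d t := `|t - (nearest d t)%:~R * d|.

Lemma dist_lattice_scale d t (k : int) : 0 < d ->
  `|t - k%:~R * d| = `|t / d - k%:~R| * d.
Proof.
move=> d0; rewrite -[X in _ = _ * X](gtr0_norm d0) -normrM mulrBl divfK// gt_eqF//.
Qed.

Lemma saw_le_lattice d t (k : int) : 0 < d -> saw d t <= `|t - k%:~R * d|.
Proof.
move=> d0; rewrite /saw; set m := nearest d t.
rewrite !dist_lattice_scale// ler_pM2r//.
have /andP[m1 m2] := floor_itv (t / d + 2^-1); rewrite -/(nearest d t) -/m in m1 m2.
rewrite intrD in m2.
have [->//|km] := eqVneq k m.
have h : `|t / d - m%:~R| <= 2^-1 by rewrite ler_norml; apply/andP; split; lra.
apply: le_trans h _.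
have [lt|gt|eq] := ltgtP k m; last by rewrite eq eqxx in km.
  have : (k + 1)%:~R <= m%:~R :> R by rewrite ler_int lezD1.
  by rewrite intrD => H; rewrite ler_normr; apply/orP; left; lra.
have : (m + 1)%:~R <= k%:~R :> R by rewrite ler_int lezD1.
by rewrite intrD => H; rewrite ler_normr; apply/orP; right; lra.
Qed.

Lemma saw_ge0 d t : 0 <= saw d t. Proof. exact: normr_ge0. Qed.

Lemma saw_le d t : 0 < d -> saw d t <= d.
Proof.
move=> d0; apply: le_trans (saw_le_lattice t (Num.floor (t / d)) d0) _.
have /andP[m1 m2] := floor_itv (t / d).
rewrite intrD in m2; rewrite dist_lattice_scale// -[leRHS]mul1r ler_pM2r//.
by rewrite ger0_norm; lra.
Qed.

Lemma saw_id_or d t : exists k : int, saw d t = t - k%:~R * d \/ saw d t = k%:~R * d - t.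
Proof.
exists (nearest d t); rewrite /saw; have [h|h] := leP 0 (t - (nearest d t)%:~R * d).
  by left; rewrite ger0_norm.
by right; rewrite ltr0_norm// opprB.
Qed.

Lemma saw_lipschitz d s t : 0 < d -> `|saw d t - saw d s| <= `|t - s|.
Proof.
move=> d0; have H x y : saw d x - saw d y <= `|x - y|.
  rewrite lerBlDr; apply: le_trans (saw_le_lattice x (nearest d y) d0) _.
  by rewrite /saw; apply: le_trans (ler_normD _ _); rewrite addrA subrK.
by rewrite ler_norml lerNl opprB H andbT distrC H.
Qed.

End sawtooth.

Lemma ae_forall_countable d (T : measurableType d) (R : realType)
  (m : {measure set T -> \bar R}) (I : countType) (P : I -> T -> Prop) :
  (forall i, {ae m, forall x, P i x}) -> {ae m, forall x, forall i, P i x}.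
Proof.
move=> H; have FF := ae_filter_ringOfSetsType m.
have : {ae m, forall x, forall n, if unpickle n is Some i then P i x else True}.
  apply/ae_foralln => n; case: (unpickle n) => [i|]; first exact: H.
  exact: filterT.
by apply: filterS => x Hx i; have := Hx (pickle i); rewrite pickleK.
Qed.

Lemma ler_dist_min (R : realFieldType) (a b u v : R) :
  `|Num.min b v - Num.min a u| <= `|b - a| + `|v - u|.
Proof.
have := ler_norm (b - a); have := ler_norm (v - u); have := ler_norm (a - b).
have := ler_norm (u - v); rewrite (distrC u) (distrC a) ler_norml.
by case: (leP b v); case: (leP a u) => *; lra.
Qed.

Section trimming.
Context {R : realType} (X : mmSpace R).
Local Open Scope ereal_scope.
Implicit Types (f g chi G : borel X -> R).
Local Notation Df := (@min_weak_upper_gradient R X).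

(** The square of the W^{1,2} norm. *)
Definition sobolev_energy f : \bar R :=
  \int[\m_X]_x (f x ^+ 2)%:E + \int[\m_X]_x (Df f x ^+ 2)%:E.

Lemma measurable_eq_set f g : measurable_fun setT f -> measurable_fun setT g ->
  measurable ([set x | f x = g x] : set (borel X)).
Proof.
move=> mf mg; have := measurable_funB mf mg => /(_ measurableT [set 0%R] (measurable_set1 _)).
by rewrite setTI; congr measurable; apply/seteqP; split=> x /=;
  [move/eqP; rewrite subr_eq0 => /eqP|move=> ->; rewrite subrr].
Qed.

Lemma saw_measurable f (d : R) : (0 < d)%R -> measurable_fun setT f ->
  measurable_fun setT (saw d \o f).
Proof.
move=> d0 mf; apply: measurableT_comp => //; apply: continuous_measurable_fun => t.
apply/cvgrPdist_lt => e e0; near=> s; apply: le_lt_trans (saw_lipschitz _ _ d0) _.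
by near: s; exact: cvgr_dist_lt.
Unshelve. all: by end_near. Qed.

Lemma wug_contraction f g G : measurable_fun setT f -> measurable_fun setT g ->
  (forall x y, `|g y - g x| <= `|f y - f x|)%R ->
  weak_upper_gradient f G -> weak_upper_gradient g G.
Proof.
move=> mf mg fg /weak_upper_gradientP[iG pG]; apply/weak_upper_gradientP; split => //.
exact: plan_gradient_contraction pG.
Qed.

Lemma sobolev_saw f (d : R) : (0 < d)%R -> sobolev_class f -> sobolev_class (saw d \o f).
Proof.
move=> d0 sf; have mf := sf.1; split; first exact: saw_measurable.
exists (Df f); apply: (wug_contraction mf) (min_wug sf); first exact: saw_measurable.
by move=> x y; exact: saw_lipschitz.
Qed.

(** The graph of the distance to a lattice is made of countably many pieces of
    slope 1 or -1. *)
Lemma min_wug_saw f (d : R) : (0 < d)%R -> sobolev_class f ->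
  {ae \m_X, forall x, Df (saw d \o f) x = Df f x}.
Proof.
move=> d0 sf; have FF := ae_filter_ringOfSetsType \m_X; have mf := sf.1.
have ss := sobolev_saw d0 sf; have ms := ss.1.
have piece (p : borel X -> R) : measurable_fun setT p ->
    (forall x y, `|p y - p x| = `|f y - f x|)%R ->
    {ae \m_X, forall x, saw d (f x) = p x -> Df (saw d \o f) x = Df f x}.
  move=> mp Hp; rewrite (min_wug_isometric mf mp Hp); apply: min_wug_local => //.
  - exact: measurable_eq_set.
  - split => //; exists (Df f); apply: (wug_contraction mf mp) (min_wug sf).
    by move=> x y; rewrite Hp.
have P1 : {ae \m_X, forall x, forall k : int, saw d (f x) = (f x - k%:~R * d)%R ->
    Df (saw d \o f) x = Df f x}.
  apply: ae_forall_countable => k; apply: piece; first exact: measurable_funB.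
  by move=> x y; rewrite opprB addrA subrK.
have P2 : {ae \m_X, forall x, forall k : int, saw d (f x) = (k%:~R * d - f x)%R ->
    Df (saw d \o f) x = Df f x}.
  apply: ae_forall_countable => k; apply: piece; first exact: measurable_funB.
  by move=> x y; rewrite distrC; congr (`| _ |)%R; ring.
apply: filterS2 P1 P2 => x h1 h2.
by have [k [/h1|/h2]] := saw_id_or d (f x).
Qed.

(** A function below chi and below 1/(n+1), which nevertheless has the slope of f
    wherever chi exceeds 1/(n+1). *)
Definition trim f chi n : borel X -> R :=
  fun x => Num.min (saw (n.+1%:R^-1)%R (f x)) (chi x).

Section trim_lemmas.
Variables (f chi : borel X -> R).
Hypotheses (wf : W12 f) (wchi : W12 chi) (chi0 : forall x, (0 <= chi x)%R).
Let d (n : nat) : R := (n.+1%:R^-1)%R.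
Let d0 n : (0 < d n)%R. Proof. by rewrite invr_gt0. Qed.

Lemma trim_ge0 n x : (0 <= trim f chi n x)%R.
Proof. by rewrite /trim le_min saw_ge0 chi0. Qed.

Lemma trim_W12 n : W12 (trim f chi n).
Proof.
have [iL [mf _]] := wf; have [iC [mchi _]] := wchi.
have mt : measurable_fun setT (trim f chi n).
  by apply: measurable_minr => //; exact: saw_measurable.
split; first by apply: (Lfun2_le mt iC) => x; rewrite !ger0_norm ?trim_ge0// ge_min lexx orbT.
split => //; exists (Df f \+ Df chi)%R; apply/weak_upper_gradientP; split.
  apply: Lfun2_dom (min_Lfun2 wf.2) (min_Lfun2 wchi.2) _ => [|x]; last exact: ler_normD.
  by apply: measurable_funD; apply: Lfun2_measurable; apply: min_Lfun2; [case: wf|case: wchi].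
apply: (plan_gradient_le_add mf mchi mt _ (min_plan_gradient wf.2) (min_plan_gradient wchi.2)) => x y.
apply: le_trans (ler_dist_min _ _ _ _) _.
by apply: lerD => //; exact: saw_lipschitz.
Qed.

Lemma trim_gradient n : {ae \m_X, forall x,
  Df (trim f chi n) x = if (chi x == 0)%R then 0%R else
    if (saw (d n) (f x) <= chi x)%R then Df f x else Df chi x}.
Proof.
have FF := ae_filter_ringOfSetsType \m_X.
have st := (trim_W12 n).2; have sc := wchi.2; have mchi := sc.1.
have ms := saw_measurable (d0 n) wf.2.1.
have mt : measurable_fun setT (trim f chi n) by case: st.
have A1 : {ae \m_X, forall x, chi x = 0%R -> Df (trim f chi n) x = 0%R}.
  apply: (@min_wug_level_set _ _ _ _ 0%R) => //.
    by apply: measurable_eq_set => //; exact: measurable_cst.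
  by move=> x /= cx; rewrite /trim cx min_r// saw_ge0.
have A2 : {ae \m_X, forall x, trim f chi n x = chi x -> Df (trim f chi n) x = Df chi x}.
  by apply: min_wug_local => //; exact: measurable_eq_set.
have A3 : {ae \m_X, forall x, trim f chi n x = saw (d n) (f x) ->
    Df (trim f chi n) x = Df (saw (d n) \o f) x}.
  apply: min_wug_local => //; first exact: measurable_eq_set.
  exact: sobolev_saw wf.2.
have A4 := min_wug_saw (d0 n) wf.2.
have {}A3 : {ae \m_X, forall x, trim f chi n x = saw (d n) (f x) ->
    Df (trim f chi n) x = Df f x}.
  by apply: filterS2 A3 A4 => x H <-.
apply: filterS3 A1 A2 A3 => x h1 h2 h3.
case: ifPn => [/eqP/h1//|_]; case: (leP (saw (d n) (f x)) (chi x)) => h.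
  by apply: h3; rewrite /trim min_l.
by apply: h2; rewrite /trim min_r// ltW.
Qed.

(** The trimmed functions tend to 0 while their slope is that of f on the set
    where chi > 0. *)
Lemma trim_energy : sobolev_energy (trim f chi n) @[n --> \oo] -->
  \int[\m_X]_(x in [set x | (0 < chi x)%R]) (Df f x ^+ 2)%:E.
Proof.
have FF := ae_filter_ringOfSetsType \m_X.
have [/Lfun2P[_ iC] [mchi _]] := wchi.
have st n := (trim_W12 n).2; have mt n : measurable_fun setT (trim f chi n) by case: (st n).
have /Lfun2P[mDf iDf] := min_Lfun2 wf.2; have /Lfun2P[mDc iDc] := min_Lfun2 wchi.2.
have mDt n : measurable_fun setT (Df (trim f chi n)).
  by have /Lfun2P[] := min_Lfun2 (st n).
have m2 := @measurable_sqr R X.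
have sq0 (F : borel X -> R) x : 0 <= (F x ^+ 2)%:E by rewrite lee_fin sqr_ge0.
pose e n x := (trim f chi n x ^+ 2)%:E + (Df (trim f chi n) x ^+ 2)%:E.
have me n : measurable_fun setT (e n)
  by exact: (emeasurable_funD (m2 _ (mt n)) (m2 _ (mDt n))).
have -> : (fun n => sobolev_energy (trim f chi n)) = (fun n => \int[\m_X]_x e n x).
  apply/funext => n; rewrite ge0_integralD//; [exact: (m2 _ (mt n))|exact: (m2 _ (mDt n))].
rewrite integral_mkcond; set L := (_ \_ _).
have mA : measurable ([set x | (0 < chi x)%R] : set (borel X)).
  exact: measurable_gt_set.
have mL : measurable_fun setT L.
  by apply/(measurable_restrictT _ mA); apply: measurable_funTS; exact: (m2 _ mDf).
pose B x := (chi x ^+ 2)%:E + ((Df f x ^+ 2)%:E + (Df chi x ^+ 2)%:E).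
have mB : measurable_fun setT B.
  exact: (emeasurable_funD (m2 _ mchi) (emeasurable_funD (m2 _ mDf) (m2 _ mDc))).
have B0 x : 0 <= B x by rewrite !adde_ge0.
have iB : (\m_X).-integrable setT B.
  apply/integrableP; split => //; under eq_integral do rewrite gee0_abs//.
  rewrite ge0_integralD//; last 3 first.
  - exact: (m2 _ mchi).
  - by move=> x _; rewrite adde_ge0.
  - exact: (emeasurable_funD (m2 _ mDf) (m2 _ mDc)).
  rewrite ge0_integralD//; [|exact: (m2 _ mDf)|exact: (m2 _ mDc)].
  exact: (lte_add_pinfty iC (lte_add_pinfty iDf iDc)).
have G : {ae \m_X, forall x, forall n, Df (trim f chi n) x = if (chi x == 0)%R then 0%R else
    if (saw (d n) (f x) <= chi x)%R then Df f x else Df chi x}.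
  by apply/ae_foralln => n; exact: trim_gradient.
have ecvg : {ae \m_X, forall x, setT x -> e n x @[n --> \oo] --> L x}.
  apply: filterS G => x Gx _.
  pose t n : R := trim f chi n x.
  have t0 : t @ \oo --> (0 : R)%R.
    apply/cvgrPdist_le => r r0; near=> n.
    rewrite sub0r normrN ger0_norm ?trim_ge0// /t /trim ge_min.
    apply/orP; left; apply: le_trans (saw_le _ (d0 n)) _.
    by apply: ltW; near: n; exact: near_infty_natSinv_lt (PosNum r0).
  have t1 : (t n ^+ 2)%R @[n --> \oo] --> (0 : R)%R.
    by under eq_fun do rewrite expr2; rewrite -(mulr0 (0 : R)%R); exact: cvgM.
  have c1 : (t n ^+ 2)%:E @[n --> \oo] --> 0.
    by apply: cvg_EFin; first exact: nearW.
  have c2 : (Df (trim f chi n) x ^+ 2)%:E @[n --> \oo] --> L x.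
    apply: cvg_near_cst; rewrite /L patchE.
    have := chi0 x; rewrite le_eqVlt eq_sym => /orP[/eqP cx|cx].
      rewrite memNset/=; last by rewrite cx ltxx.
      by apply: nearW => n; rewrite Gx cx eqxx expr0n.
    rewrite mem_set//; near=> n; rewrite Gx gt_eqF// ifT//.
    apply: le_trans (saw_le _ (d0 n)) _.
    by apply: ltW; near: n; exact: near_infty_natSinv_lt (PosNum cx).
  rewrite -[L x]add0e; apply: cvgeD => //.
have eB : {ae \m_X, forall x, forall n, setT x -> `|e n x| <= B x}.
  apply: filterS G => x Gx n _; rewrite gee0_abs; last by rewrite adde_ge0.
  rewrite /e /B; apply: leeD.
    rewrite lee_fin lerXn2r ?nnegrE ?trim_ge0// /trim ge_min lexx orbT//.
  rewrite Gx; case: ifPn => _; first by rewrite expr0n adde_ge0.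
  by case: ifPn => _; rewrite ?leeDl ?leeDr.
by have [_ _] := dominated_convergence measurableT me mL ecvg iB eB.
Unshelve. all: by end_near. Qed.

End trim_lemmas.
End trimming.

(** * Bumps and the uniqueness of measures *)

Section measure_constructions.
Local Open Scope ereal_scope.
Context d d' (T : measurableType d) (U : measurableType d') (R : realType)
  (m : {measure set T -> \bar R}).

Section density.
Variable f : T -> \bar R.
Hypotheses (mf : measurable_fun setT f) (f0 : forall x, 0 <= f x).

Definition density (A : set T) := \int[m]_(x in A) f x.

Let density0 : density set0 = 0. Proof. exact: integral_set0. Qed.

Let density_ge0 A : 0 <= density A. Proof. exact: integral_ge0. Qed.

Let density_sigma_additive : semi_sigma_additive density.
Proof. exact: semi_sigma_additive_nng_induced. Qed.

HB.instance Definition _ := isMeasure.Build _ _ _ density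
  density0 density_ge0 density_sigma_additive.

Definition density_measure : {measure set T -> \bar R} := density.
End density.

Section image.
Variable F : T -> U.
Hypothesis mF : measurable_fun setT F.

Definition image_measure : {measure set U -> \bar R}.
Proof. by unshelve refine (pushforward m F : {measure set U -> \bar R}). Defined.

End image.
End measure_constructions.

Section bumps.
Context {R : realType} (X : mmSpace R).
Let sX : separable X := mms_separable X.
Implicit Types (u v : borel X -> R).

(** Bumps are stable under minima, so that the sets where they are positive form a
    pi-system; tents put the balls among these sets. *)
Definition bump u : Prop := [/\ forall x, 0 <= u x,
  exists2 c, 0 <= c & forall x y : X, `|u x - u y| <= c * mdist x y,
  exists M, forall x, u x <= M &
  exists (x0 : X) (r : R), forall x, ~ ball x0 r x -> u x = 0].

Definition tent (z : X) (r : R) : borel X -> R := fun x => Num.max (r - mdist x z) 0.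

Lemma tent_lipschitz z r (x y : X) : `|tent z r x - tent z r y| <= mdist x y.
Proof.
apply: le_trans (ler_dist_mdist x y z).
rewrite /tent distrC; set a := mdist x z; set b := mdist y z.
have := ler_norm (a - b); have := ler_norm (b - a); rewrite (distrC b a) ler_norml.
by case: (leP (r - a) 0); case: (leP (r - b) 0) => *; lra.
Qed.

Lemma tent_gt0 z r : [set x | 0 < tent z r x] = ball z r.
Proof.
apply/seteqP; split => x; rewrite ballEmdist/= /tent lt_max ltxx orbF subr_gt0 metric_sym//.
Qed.

Lemma tent_ge0 z r x : 0 <= tent z r x.
Proof. by rewrite /tent le_max lexx orbT. Qed.

Lemma tent_out z r x : ~ ball z r x -> tent z r x = 0.
Proof.
by rewrite -tent_gt0 /= => /negP; rewrite -leNgt => h; apply/eqP; rewrite eq_le h tent_ge0.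
Qed.

Lemma tent_le z r x : tent z r x <= `|r|.
Proof.
rewrite /tent ge_max normr_ge0 andbT; apply: le_trans (ler_norm r).
by rewrite lerBlDr lerDl mdist_ge0.
Qed.

Lemma tent_bump z r : bump (tent z r).
Proof.
split; first exact: tent_ge0.
- by exists 1 => // x y; rewrite mul1r tent_lipschitz.
- by exists `|r| => x; exact: tent_le.
- by exists z, r => x; exact: tent_out.
Qed.

Lemma bump_min u v : bump u -> bump v -> bump (fun x => Num.min (u x) (v x)).
Proof.
move=> [u0 [c c0 lu] [M uM] [x0 [r ur]]] [v0 [c' c'0 lv] _ _]; split.
- by move=> x; rewrite le_min u0 v0.
- exists (c + c'); first by rewrite addr_ge0.
  by move=> x y; apply: le_trans (ler_dist_min _ _ _ _) _; rewrite mulrDl lerD.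
- by exists M => x; rewrite ge_min uM.
- by exists x0, r => x /ur ->; apply/min_idPl.
Qed.

Lemma bump_scale_cap u (k : nat) : bump u -> bump (fun x => Num.min (k%:R * u x) 1).
Proof.
move=> [u0 [c c0 lu] [M uM] [x0 [r ur]]]; split.
- by move=> x; rewrite le_min ler01 mulr_ge0.
- exists (k%:R * c); first by rewrite mulr_ge0.
  move=> x y; apply: le_trans (ler_dist_min _ _ _ _) _.
  rewrite subrr normr0 addr0 -mulrBr normrM ger0_norm// -mulrA.
  by apply: ler_wpM2l.
- by exists 1 => x; rewrite ge_min lexx orbT.
- by exists x0, r => x /ur ->; rewrite mulr0 min_l.
Qed.

Lemma bump_W12 u : finite_on_bounded X -> bump u -> W12 u.
Proof.
move=> fin [u0 [c c0 lu] [M uM] [x0 [r ur]]].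
by have [] := W12_lipschitz fin c0 lu (M := M) (x0 := x0) (r := r) _ ur => // x;
  rewrite ger0_norm.
Qed.

Lemma tent_min_le1 z r : finite_on_bounded X ->
  {ae \m_X, forall x, min_weak_upper_gradient (tent z r) x <= 1}.
Proof.
move=> fin; have := @W12_lipschitz _ X z r 1 `|r| (tent z r) fin ler01 _ _ (@tent_out z r).
case=> // [x y|x]; first by rewrite mul1r; exact: tent_lipschitz.
by rewrite ger0_norm ?tent_ge0// tent_le.
Qed.

Lemma bump_generate :
  measurable = <<s [set [set x | 0 < u x] | u in bump] >> :> set (set (borel X)).
Proof.
apply/seteqP; split.
  apply: smallest_sub; first exact: smallest_sigma_algebra.
  move=> U oU; rewrite (open_bigcup_ball sX oU) bigcup_mkcond.
  apply: (@bigcup_countable_measurable _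
    (g_sigma_algebraType [set [set x | 0 < u x] | u in bump])) => nk.
  case: ifPn => _; last exact: measurable0.
  by apply: sub_sigma_algebra; exists (tent (dense_seq sX nk.1) (nk.2.+1%:R^-1));
    [exact: tent_bump|rewrite tent_gt0].
apply: smallest_sub; first exact: smallest_sigma_algebra.
move=> _ [u [_ [c _ lu] _ _] <-].
exact: measurable_gt_set (lipschitz_measurable lu).
Qed.

Lemma bump_measure_unique (m1 m2 : {measure set (borel X) -> \bar R}) :
  (forall (x : X) r, m1 (ball x r) < +oo)%E ->
  (forall u, bump u -> m1 [set x | 0 < u x] = m2 [set x | 0 < u x]) ->
  forall B : set (borel X), measurable B -> m1 B = m2 B.
Proof.
move=> fin H.
apply: (measure_unique [set [set x | 0 < u x] | u in bump] (fun k => ball (point : X) k%:R)).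
- exact: bump_generate.
- move=> _ _ [u bu <-] [v bv <-]; exists (fun x => Num.min (u x) (v x)).
    exact: bump_min.
  by apply/seteqP; split => x /=; rewrite lt_min => /andP.
- by move=> k; exists (tent point k%:R); [exact: tent_bump|rewrite tent_gt0].
- apply/seteqP; split => // x _; exists (Num.truncn (mdist (point : X) x)).+1 => //.
  by rewrite ballEmdist/=; exact: truncnS_gt.
- by move=> _ [u bu <-]; exact: H.
- by move=> k; exact: fin.
Qed.

End bumps.

(** * Isometric composition preserves slopes and measures *)

Section energy.
Context {R : realType} (X : mmSpace R).
Local Open Scope ereal_scope.
Implicit Types (f g G : borel X -> R).
Local Notation Df := (@min_weak_upper_gradient R X).

Lemma sobolev_energy_ge0 f : 0 <= sobolev_energy f.
Proof. by rewrite adde_ge0// integral_ge0// => x _; rewrite lee_fin sqr_ge0. Qed.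

Lemma W12_normE f : W12_norm f = (sobolev_energy f) `^ 2^-1%R.
Proof. by rewrite /W12_norm !Lnorm2_sqr. Qed.

Lemma sobolev_energyE f : sobolev_energy f = (W12_norm f) `^ 2%R.
Proof. by rewrite W12_normE -poweRrM mulVf// poweRe1// sobolev_energy_ge0. Qed.

Lemma wug_ae f g G : measurable_fun setT f -> measurable_fun setT g ->
  {ae \m_X, forall x, f x = g x} -> weak_upper_gradient f G -> weak_upper_gradient g G.
Proof.
move=> mf mg fg /weak_upper_gradientP[iG pG]; apply/weak_upper_gradientP; split => //.
have [mG G0 _] := pG; apply: (plan_gradient_ae pG) => //.
exact: (@nearW _ _ _ (ae_filter_ringOfSetsType \m_X)).
Qed.

Lemma min_wug_ae f g : measurable_fun setT f -> measurable_fun setT g ->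
  {ae \m_X, forall x, f x = g x} -> Df f = Df g.
Proof.
move=> mf mg fg; have FF := ae_filter_ringOfSetsType \m_X.
have gf : {ae \m_X, forall x, g x = f x} by apply: filterS fg.
have W : weak_upper_gradient f = weak_upper_gradient g.
  by apply/funext => G; apply/propext; split; exact: wug_ae.
rewrite /min_weak_upper_gradient; congr xget.
by apply/funext => G; rewrite /is_min_weak_upper_gradient W.
Qed.

Lemma sqr_integral_ae f g : measurable_fun setT f -> measurable_fun setT g ->
  {ae \m_X, forall x, f x = g x} ->
  \int[\m_X]_x (f x ^+ 2)%:E = \int[\m_X]_x (g x ^+ 2)%:E.
Proof.
move=> mf mg fg; have FF := ae_filter_ringOfSetsType \m_X.
apply: ae_eq_integral => //; [exact: measurable_sqr|exact: measurable_sqr|].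
by apply: filterS fg => x ->.
Qed.

Lemma W12_ae f g : measurable_fun setT g ->
  {ae \m_X, forall x, f x = g x} -> W12 f -> W12 g.
Proof.
move=> mg fg [/Lfun2P[mf if2] [_ [G wG]]]; split.
  by apply/Lfun2P; split => //; rewrite -(sqr_integral_ae mf mg fg).
by split => //; exists G; exact: wug_ae wG.
Qed.

Lemma sobolev_energy_ae f g : measurable_fun setT f -> measurable_fun setT g ->
  {ae \m_X, forall x, f x = g x} -> sobolev_energy f = sobolev_energy g.
Proof.
by move=> mf mg fg; rewrite /sobolev_energy (min_wug_ae mf mg fg) (sqr_integral_ae mf mg fg).
Qed.

End energy.

Section transfer.
Context {R : realType} (X1 X2 : mmSpace R) (T : borel X1 -> borel X2).
Hypothesis mT : measurable_fun setT T.
Hypothesis isoT : composition_isometry T.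
Hypothesis fin2 : finite_on_bounded X2.
Local Open Scope ereal_scope.
Implicit Types (f chi : borel X2 -> R).
Local Notation Df := min_weak_upper_gradient.

Lemma W12_comp f : W12 f -> W12 (f \o T).
Proof. by move=> wf; have [[H _] _] := isoT wf.2.1; exact: H. Qed.

Lemma sobolev_energy_comp f : W12 f -> sobolev_energy (f \o T) = sobolev_energy f.
Proof. by move=> wf; have [_ H] := isoT wf.2.1; rewrite !sobolev_energyE -H. Qed.

(** The isometry passes from the energy of the trimmed functions to their limit. *)
Lemma slope_energy_gt0 f chi : W12 f -> W12 chi -> (forall x, 0 <= chi x)%R ->
  \int[\m_X1]_(x in [set x | (0 < chi (T x))%R]) (Df (f \o T) x ^+ 2)%:E =
  \int[\m_X2]_(x in [set x | (0 < chi x)%R]) (Df f x ^+ 2)%:E.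
Proof.
move=> wf wchi chi0.
have h2 := trim_energy wf wchi chi0.
have h1 := trim_energy (W12_comp wf) (W12_comp wchi) (fun x => chi0 (T x)).
have E : (fun n => sobolev_energy (trim (f \o T) (chi \o T) n)) =
    (fun n => sobolev_energy (trim f chi n)).
  by apply/funext => n; rewrite -(sobolev_energy_comp (trim_W12 wf wchi chi0 n)).
by rewrite E in h1; exact: (cvg_unique _ h1 h2).
Qed.

(** Both sides are finite measures of B that agree on the sets where a bump is
    positive. *)
Lemma slope_energy f (B : set (borel X2)) : W12 f -> measurable B ->
  \int[\m_X1]_(x in T @^-1` B) (Df (f \o T) x ^+ 2)%:E =
  \int[\m_X2]_(x in B) (Df f x ^+ 2)%:E.
Proof.
move=> wf mB; have wfT := W12_comp wf.
have /Lfun2P[m1 i1] := min_Lfun2 wfT.2; have /Lfun2P[m2 i2] := min_Lfun2 wf.2.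
have p1 x : 0 <= (Df (f \o T) x ^+ 2)%:E by rewrite lee_fin sqr_ge0.
have p2 x : 0 <= (Df f x ^+ 2)%:E by rewrite lee_fin sqr_ge0.
pose nu1 := image_measure (density_measure \m_X1 (measurable_sqr m1) p1) mT.
pose nu2 := density_measure \m_X2 (measurable_sqr m2) p2.
apply: (@bump_measure_unique _ X2 nu1 nu2) => // [x r|u bu].
  apply: le_lt_trans i1; apply: ge0_subset_integral => //.
    by rewrite -[X in measurable X]setTI; apply: mT => //; exact: ball_measurable.
  exact: measurable_sqr.
have [u0 _ _ _] := bu.
exact: (slope_energy_gt0 wf (bump_W12 fin2 bu) u0).
Qed.

Lemma sqr_integral_comp f : W12 f ->
  \int[\m_X1]_x (f (T x) ^+ 2)%:E = \int[\m_X2]_x (f x ^+ 2)%:E.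
Proof.
move=> wf; have E := sobolev_energy_comp wf.
have D := slope_energy wf measurableT; rewrite preimage_setT in D.
move: E; rewrite /sobolev_energy D => E.
have /Lfun2P[m2 i2] := min_Lfun2 wf.2.
have i0 : 0 <= \int[\m_X2]_x (Df f x ^+ 2)%:E.
  by apply: integral_ge0 => x _; rewrite lee_fin sqr_ge0.
have fin : \int[\m_X2]_x (Df f x ^+ 2)%:E \is a fin_num by rewrite ge0_fin_numE.
by rewrite -[LHS](addeK _ fin) E addeK.
Qed.

Lemma measure_gt0_cvg (Y : mmSpace R) (u : borel Y -> R) : measurable_fun setT u ->
  (forall x, 0 <= u x)%R ->
  \int[\m_Y]_x ((Num.min (k%:R * u x) 1) ^+ 2)%:E @[k --> \oo] --> \m_Y [set x | (0 < u x)%R].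
Proof.
move=> mu u0.
have mA : measurable ([set x | (0 < u x)%R] : set (borel Y)).
  exact: measurable_gt_set.
pose g (k : nat) x := ((Num.min (k%:R * u x) 1) ^+ 2)%R%:E.
have m0 k x : (0 <= Num.min (k%:R * u x) 1)%R by rewrite le_min ler01 mulr_ge0.
have mg k : measurable_fun setT (g k).
  apply/measurable_EFinP; apply: measurable_funX; apply: measurable_minr => //.
  exact: measurable_funM.
have := @cvg_monotone_convergence _ _ _ \m_Y setT measurableT g mg.
have -> : \int[\m_Y]_x limn (g^~ x) = \m_Y [set x | (0 < u x)%R].
  rewrite -[RHS]mul1e -integral_cst// [RHS]integral_mkcond; apply: eq_integral => x _.
  apply: cvg_lim => //; rewrite patchE.
  have := u0 x; rewrite le_eqVlt eq_sym => /orP[/eqP ux|ux].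
    rewrite memNset/=; last by rewrite ux ltxx.
    by apply: cvg_near_cst; apply: nearW => k; rewrite /g ux mulr0 min_l// expr0n.
  rewrite mem_set//; apply: cvg_near_cst; near=> k.
  rewrite /g min_r ?expr1n// -ler_pdivrMr// mul1r.
  by apply: ltW; near: k; exact: nbhs_infty_gtr.
apply.
- by move=> k x _; rewrite lee_fin sqr_ge0.
- move=> x _ i j ij; rewrite lee_fin lerXn2r ?nnegrE ?m0//.
  by rewrite le_min !ge_min lexx orbT andbT ler_wpM2r ?ler_nat.
Unshelve. all: by end_near. Qed.

(** Equal energies and equal slope energies leave equal L^2 norms; apply this to
    the bumps increasing to an indicator function. *)
Lemma comp_measure_preserving (B : set (borel X2)) : measurable B ->
  \m_X1 (T @^-1` B) = \m_X2 B.
Proof.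
move=> mB; symmetry; apply: (@bump_measure_unique _ X2 \m_X2 (image_measure \m_X1 mT)) => //.
  by move=> x r; apply: fin2; [exact: ball_measurable|exists x, r].
move=> u bu; have [u0 [c _ lu] _ _] := bu; have mu := lipschitz_measurable lu.
have h2 := measure_gt0_cvg mu u0.
have h1 := measure_gt0_cvg (measurableT_comp mu mT) (fun x => u0 (T x)).
have E : (fun k : nat => \int[\m_X1]_x ((Num.min (k%:R * (u \o T) x) 1) ^+ 2)%:E) =
    (fun k : nat => \int[\m_X2]_x ((Num.min (k%:R * u x) 1) ^+ 2)%:E).
  by apply/funext => k; exact: (sqr_integral_comp (bump_W12 fin2 (bump_scale_cap k bu))).
by rewrite E in h1; exact: (cvg_unique _ h2 h1).
Qed.

End transfer.

(** * Isometric composition preserves distances almost everywhere *)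

Section slopes_at_most_one.
Context {R : realType}.
Local Open Scope ereal_scope.

(** On the set A where F > 1, F and the constant 1 have the same square integral;
    hence A is a null set. *)
Lemma ae_le1_sqr_integral (Y : mmSpace R) (F : borel Y -> R) : F \in Lfun \m_Y 2%:E ->
  (forall x, 0 <= F x)%R ->
  (forall A : set (borel Y), measurable A -> \int[\m_Y]_(x in A) (F x ^+ 2)%:E <= \m_Y A) ->
  {ae \m_Y, forall x, F x <= 1}%R.
Proof.
move=> iF F0 H; have [mF _] := (Lfun2P _ _).1 iF.
have FF := ae_filter_ringOfSetsType \m_Y.
pose A := [set x | (1 < F x)%R].
have mA : measurable (A : set (borel Y)) by exact: measurable_gt_set.
have patchZ (g : borel Y -> R) : \int[\m_Y]_x (mix A g (cst 0%R) x ^+ 2)%:E =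
    \int[\m_Y]_(x in A) (g x ^+ 2)%:E.
  rewrite [RHS]integral_mkcond; apply: eq_integral => x _; rewrite patchE /mix.
  by case: ifPn => // _; rewrite expr0n.
have i2 : mix A F (cst 0%R) \in Lfun \m_Y 2%:E.
  apply: Lfun2_le iF _ => [|x]; first by apply: measurable_mix => //; exact: measurable_cst.
  by rewrite /mix; case: ifPn => // _; rewrite normr0.
have i1 : mix A (cst 1%R) (cst 0%R) \in Lfun \m_Y 2%:E.
  apply: Lfun2_le iF _ => [|x].
    by apply: measurable_mix => //; exact: measurable_cst.
  rewrite /mix; case: ifPn => [/set_mem Ax|_]; last by rewrite normr0.
  by rewrite normr1 ger0_norm// ltW.
have le12 x : (0 <= mix A (cst 1%R) (cst 0%R) x <= mix A F (cst 0%R) x)%R.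
  by rewrite /mix; case: ifPn => [/set_mem /ltW|]; rewrite ?ler01 ?lexx.
have := sqr_integral_le_ae_eq i1 i2 le12; rewrite !patchZ.
have -> : \int[\m_Y]_(x in A) (cst 1%R x ^+ 2)%:E = \m_Y A.
  by under eq_integral do rewrite expr1n; rewrite (integral_cst _ mA 1) mul1e.
move=> /(_ (H _ mA)); apply: filterS => x E.
rewrite leNgt; apply/negP => Ax; move: E; rewrite !mix_in//= => E.
by move: Ax; rewrite -E ltxx.
Qed.

Lemma integral_ae_set d (Y : measurableType d) (m : {measure set Y -> \bar R})
  (A B : set Y) (g : Y -> \bar R) : measurable A -> measurable B ->
  measurable_fun setT g -> {ae m, forall x, A x <-> B x} ->
  \int[m]_(x in A) g x = \int[m]_(x in B) g x.
Proof.
move=> mA mB mg AB; have FF := ae_filter_ringOfSetsType m.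
rewrite integral_mkcond [RHS]integral_mkcond; apply: ae_eq_integral => //.
- by apply/(measurable_restrictT _ mA); exact: measurable_funTS.
- by apply/(measurable_restrictT _ mB); exact: measurable_funTS.
apply: filterS AB => x AB _; rewrite !patchE.
have [Ax|Ax] := pselect (A x); first by rewrite !mem_set//; exact/AB.
by rewrite !memNset// => /AB.
Qed.

Lemma measure_ae_set d (Y : measurableType d) (m : {measure set Y -> \bar R})
  (A B : set Y) : measurable A -> measurable B ->
  {ae m, forall x, A x <-> B x} -> m A = m B.
Proof.
move=> mA mB AB; have := integral_ae_set mA mB (measurable_cst 1) AB.
by rewrite (integral_cst m mA 1) (integral_cst m mB 1) !mul1e.
Qed.

End slopes_at_most_one.

Section almost_isometry.
Context {R : realType} (X1 X2 : mmSpace R) (T : borel X1 -> borel X2).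
Hypothesis mT : measurable_fun setT T.
Hypothesis isoT : composition_isometry T.
Hypothesis fin2 : finite_on_bounded X2.
Variables (N : set (borel X1)) (S : borel X2 -> borel X1).
Hypotheses (mN : measurable N) (N0 : \m_X1 N = 0%E) (mS : measurable_fun setT S).
Hypothesis ST : forall x, ~ N x -> S (T x) = x.
Local Open Scope ereal_scope.
Implicit Types (f : borel X2 -> R).
Local Notation Df := min_weak_upper_gradient.
Let FF1 := ae_filter_ringOfSetsType \m_X1.
Let FF2 := ae_filter_ringOfSetsType \m_X2.

Let preimT (B : set (borel X2)) : measurable B -> measurable (T @^-1` B).
Proof. by move=> mB; rewrite -[X in measurable X]setTI; exact: mT. Qed.

Let preimS (B : set (borel X1)) : measurable B -> measurable (S @^-1` B).
Proof. by move=> mB; rewrite -[X in measurable X]setTI; exact: mS. Qed.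

Lemma ae_STE : {ae \m_X1, forall x, S (T x) = x}.
Proof. by exists N; split => // x /= H; apply: contrapT => /ST. Qed.

Lemma ae_compT (P : X2 -> Prop) : {ae \m_X2, forall y, P y} -> {ae \m_X1, forall x, P (T x)}.
Proof.
move=> [M [mM M0 MP]]; exists (T @^-1` M); split; first exact: preimT.
  by rewrite (comp_measure_preserving mT isoT fin2).
by move=> x /= H; exact: MP.
Qed.

Lemma sqr_integral_le_measure (Y : mmSpace R) (G : borel Y -> R) (A : set (borel Y)) :
  measurable_fun setT G -> (forall y, 0 <= G y)%R ->
  {ae \m_Y, forall y, G y <= 1}%R -> measurable A ->
  \int[\m_Y]_(y in A) (G y ^+ 2)%:E <= \m_Y A.
Proof.
move=> mG G0 G1 mA; rewrite -[leRHS]mul1e -(integral_cst _ mA 1).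
have FF := ae_filter_ringOfSetsType \m_Y.
apply: ae_ge0_le_integral => //.
- by move=> y _; rewrite lee_fin sqr_ge0.
- by apply: measurable_funTS; exact: measurable_sqr.
by apply: filterS G1 => y G1 _; rewrite lee_fin expr_le1.
Qed.

(** Slopes can be compared on the sets T^-1(B); thanks to the left inverse S these
    are all the Borel sets of X1, up to null sets. *)
Lemma slope_le1_comp f : W12 f -> {ae \m_X2, forall y, Df f y <= 1}%R ->
  {ae \m_X1, forall x, Df (f \o T) x <= 1}%R.
Proof.
move=> wf D1; have wfT := W12_comp isoT wf.
have iF := min_Lfun2 wfT.2; have [mF _] := (Lfun2P _ _).1 iF.
have [mD _] := (Lfun2P _ _).1 (min_Lfun2 wf.2).
apply: (ae_le1_sqr_integral iF) => [x|A mA]; first exact: min_wug_ge0 wfT.2.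
have AE : {ae \m_X1, forall x, A x <-> (T @^-1` (S @^-1` A)) x}.
  by apply: filterS ae_STE => x E; rewrite /= E.
have mST := preimT (preimS mA).
rewrite (integral_ae_set mA mST (measurable_sqr mF) AE).
rewrite (slope_energy mT isoT fin2 wf (preimS mA)).
apply: (@le_trans _ _ (\m_X2 (S @^-1` A))).
  apply: sqr_integral_le_measure => //; last exact: preimS.
  by move=> y; exact: min_wug_ge0 wf.2.
rewrite -(comp_measure_preserving mT isoT fin2 (preimS mA)).
by rewrite (measure_ae_set mA mST AE).
Qed.

Lemma slope_comp_le1 f : W12 f -> {ae \m_X1, forall x, Df (f \o T) x <= 1}%R ->
  {ae \m_X2, forall y, Df f y <= 1}%R.
Proof.
move=> wf D1; have wfT := W12_comp isoT wf.
have iF := min_Lfun2 wf.2; have [mF _] := (Lfun2P _ _).1 iF.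
have [mD _] := (Lfun2P _ _).1 (min_Lfun2 wfT.2).
apply: (ae_le1_sqr_integral iF) => [x|A mA]; first exact: min_wug_ge0 wf.2.
rewrite -(slope_energy mT isoT fin2 wf mA) -(comp_measure_preserving mT isoT fin2 mA).
apply: sqr_integral_le_measure => //; last exact: preimT.
by move=> y; exact: min_wug_ge0 wfT.2.
Qed.

(** When z is close to a and k is large, the tent of vertex z and height k varies by
    almost d(a, b) between a and b. *)
Lemma tents_separate (Y : mmSpace R) (a b : Y) (e : R) :
  (forall n k, `|tent (dense_seq (mms_separable Y) n) k%:R a -
     tent (dense_seq (mms_separable Y) n) k%:R b| <= e)%R -> (mdist a b <= e)%R.
Proof.
move=> H; apply/ler_addgt0Pr => r r0.
have r2 : (0 < r / 2)%R by rewrite divr_gt0.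
have [|z [az [n _ nz]]] := @dense_seqP _ _ (mms_separable Y) (ball a (r / 2)%R) _ (mball_open a (r / 2)%R).
  by exists a; exact: ballxx.
move: az; rewrite -nz ballEmdist/= => az.
pose k := (Num.truncn (mdist a z + mdist b z)).+1.
have kb : (mdist a z + mdist b z < k%:R)%R by exact: truncnS_gt.
have := H n k; rewrite /tent nz; rewrite nz in az.
have a0 := mdist_ge0 a z; have b0 := mdist_ge0 b z.
rewrite max_l; last by lra.
rewrite max_l; last by lra.
move=> h; have h' : (mdist b z - mdist a z <= e)%R.
  by apply: le_trans h; apply: le_trans (ler_norm _); lra.
have tri := metric_triangle a z b; rewrite (metric_sym z b) in tri.
by lra.
Qed.

Definition conull (Y : mmSpace R) (E : set (borel Y)) : Prop :=
  measurable E /\ \m_Y (~` E) = 0.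

Lemma ae_conull (Y : mmSpace R) (P : Y -> Prop) : {ae \m_Y, forall y, P y} ->
  exists2 E, conull E & forall y : Y, E y -> P y.
Proof.
move=> [M [mM M0 MP]]; exists (~` M); first by split; [exact: measurableC|rewrite setCK].
by move=> y My; apply: contrapT => nP; apply: My; exact: MP.
Qed.

Lemma conull_bigcap (Y : mmSpace R) (I : countType) (E : I -> set (borel Y)) :
  (forall i, conull (E i)) -> conull (\bigcap_i E i).
Proof.
move=> cE; have mE i : measurable (E i) by case: (cE i).
have mI : measurable (\bigcap_i E i) by exact: bigcap_countable_measurable.
have FF := ae_filter_ringOfSetsType \m_Y.
have H : {ae \m_Y, forall y, forall i, E i y}.
  apply: ae_forall_countable => i; exists (~` E i); split => //; first exact: measurableC.
  by case: (cE i).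
split => //; have [M [mM M0 MP]] := H.
apply: (subset_measure0 (measurableC mI) mM _ M0) => y ny; apply: MP => Ey; apply: ny => i _.
exact: Ey.
Qed.

Lemma tents_ae_mdist_le (Y Z : mmSpace R) (phi : Y -> Z) (D : Y -> Y -> R) :
  (forall n k, exists2 E : set (borel Y), conull E & forall x y, E x -> E y ->
    (`|tent (dense_seq (mms_separable Z) n) k%:R (phi x) -
       tent (dense_seq (mms_separable Z) n) k%:R (phi y)| <= D x y)%R) ->
  exists2 E : set (borel Y), conull E & forall x y, E x -> E y ->
    (mdist (phi x) (phi y) <= D x y)%R.
Proof.
move=> H; have /choice[E HE] : forall nk : nat * nat,
    exists E : set (borel Y), conull E /\ forall x y, E x -> E y ->
    (`|tent (dense_seq (mms_separable Z) nk.1) nk.2%:R (phi x) -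
       tent (dense_seq (mms_separable Z) nk.1) nk.2%:R (phi y)| <= D x y)%R.
  by move=> [n k]; have [E cE HE] := H n k; exists E.
exists (\bigcap_nk E nk); first by apply: conull_bigcap => nk; case: (HE nk).
move=> x y Ex Ey; apply: tents_separate => n k.
by have [_] := HE (n, k); apply; [exact: Ex|exact: Ey].
Qed.

(** The tents of X2 have slope at most 1; so have their compositions with T, which
    are therefore 1-Lipschitz up to a null set. *)
Lemma ae_mdist_le : sobolev_to_lipschitz X1 ->
  exists2 E : set (borel X1), conull E & forall x y : X1, E x -> E y ->
    (mdist (T x : X2) (T y : X2) <= mdist x y)%R.
Proof.
move=> stl1; apply: (@tents_ae_mdist_le X1 X2 T (fun x y => mdist x y)) => n k.
set u := tent _ _; have wu : W12 u by apply: bump_W12 => //; exact: tent_bump.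
have D1 := slope_le1_comp wu (tent_min_le1 _ _ fin2).
have [g lg ug] := stl1 _ (W12_comp isoT wu) D1.
have [E cE HE] := ae_conull ug; exists E => // x y Ex Ey.
by have := HE _ Ex; have := HE _ Ey => /= -> ->; exact: lg.
Qed.

(** A tent v of X1 is almost everywhere the composition with T of v o S, to which
    the Sobolev-to-Lipschitz property of X2 applies. *)
Lemma ae_mdist_ge : finite_on_bounded X1 -> sobolev_to_lipschitz X2 ->
  exists2 E : set (borel X1), conull E & forall x y : X1, E x -> E y ->
    (mdist x y <= mdist (T x : X2) (T y : X2))%R.
Proof.
move=> fin1 stl2.
apply: (@tents_ae_mdist_le X1 X1 id (fun x y => mdist (T x : X2) (T y : X2))) => n k.
set v := tent _ _; have wv : W12 v by apply: bump_W12 => //; exact: tent_bump.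
have mv := wv.2.1.
have mvS : measurable_fun setT (v \o S) by exact: measurableT_comp.
have mvST : measurable_fun setT ((v \o S) \o T) by exact: measurableT_comp.
have vE : {ae \m_X1, forall x, v x = ((v \o S) \o T) x}.
  by apply: filterS ae_STE => x /= ->.
have wvS : W12 (v \o S) by have [[_ H] _] := isoT mvS; apply: H; exact: W12_ae vE wv.
have D1 : {ae \m_X2, forall y, Df (v \o S) y <= 1}%R.
  by apply: slope_comp_le1 => //; rewrite -(min_wug_ae mv mvST vE); exact: tent_min_le1.
have [g lg vg] := stl2 _ wvS D1.
have G : {ae \m_X1, forall x, v x = g (T x)}.
  by apply: filterS2 (ae_compT vg) ae_STE => x /= + E; rewrite E.
have [E cE HE] := ae_conull G; exists E => // x y Ex Ey.
by rewrite (HE _ Ex) (HE _ Ey); exact: lg.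
Qed.

Lemma ae_isometric : finite_on_bounded X1 -> sobolev_to_lipschitz X1 ->
  sobolev_to_lipschitz X2 ->
  exists2 E : set (borel X1), conull E & forall x y : X1, E x -> E y ->
    mdist (T x : X2) (T y : X2) = mdist x y.
Proof.
move=> fin1 stl1 stl2.
have [E cE HE] := ae_mdist_le stl1; have [E' cE' HE'] := ae_mdist_ge fin1 stl2.
exists (\bigcap_b (if b then E else E')); first by apply: conull_bigcap; case.
move=> x y Ex Ey; have := Ex true Logic.I; have := Ex false Logic.I.
have := Ey true Logic.I; have := Ey false Logic.I => /= e1 e2 e3 e4.
by apply/eqP; rewrite eq_le HE// HE'.
Qed.

End almost_isometry.

(** * Extension of an isometry to the support *)

Section support.
Context {R : realType} (Y : mmSpace R).
Let sY : separable Y := mms_separable Y.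

Lemma not_supp_ball : ~` supp (X := Y) = \bigcup_(nk in [set nk : nat * nat |
    \m_Y (ball (dense_seq sY nk.1) (nk.2.+1%:R^-1)) = 0%E])
    ball (dense_seq sY nk.1) (nk.2.+1%:R^-1).
Proof.
apply/seteqP; split=> [x nx|x [nk /= m0 xB] sx]; last first.
  have /sx : open_nbhs x (ball (dense_seq sY nk.1) (nk.2.+1%:R^-1)).
    by split => //; exact: mball_open.
  by rewrite m0 ltxx.
have [U [[oU Ux] U0]] : exists U, open_nbhs x U /\ ~ (0 < \m_Y U)%E.
  by apply: contrapT => H; apply: nx => U xU; apply: contrapT => nU; apply: H; exists U.
move: Ux; rewrite {1}(open_bigcup_ball sY oU) => -[nk /= sub xB]; exists nk => //=.
have mU : measurable (U : set (borel Y)) by exact: sub_sigma_algebra.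
apply/eqP; rewrite -measure_le0; apply: (@le_trans _ _ (\m_Y U)).
  by apply: le_measure => //; rewrite inE//; exact: ball_measurable.
by rewrite leNgt; apply/negP.
Qed.

Lemma supp_measurable : measurable (supp (X := Y) : set (borel Y)).
Proof.
rewrite -[X in measurable X]setCK not_supp_ball; apply: measurableC.
rewrite bigcup_mkcond; apply: (@bigcup_countable_measurable _ (borel Y)) => nk.
by case: ifPn => // _; exact: ball_measurable.
Qed.

Lemma supp_conull : conull (supp (X := Y) : set (borel Y)).
Proof.
split; first exact: supp_measurable.
have FF := ae_filter_ringOfSetsType \m_Y.
have H : {ae \m_Y, forall x, forall nk : nat * nat,
   \m_Y (ball (dense_seq sY nk.1) (nk.2.+1%:R^-1)) = 0%E ->
   ~ ball (dense_seq sY nk.1) (nk.2.+1%:R^-1) x}.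
  apply: ae_forall_countable => nk.
  have [m0|m0] := pselect (\m_Y (ball (dense_seq sY nk.1) (nk.2.+1%:R^-1)) = 0%E); last first.
    by apply: nearW => x /m0.
  exists (ball (dense_seq sY nk.1) (nk.2.+1%:R^-1)); split => //.
    exact: ball_measurable.
  by move=> x /= H; apply: contrapT => nB; apply: H.
have [M [mM M0 MP]] := H.
apply: (subset_measure0 (measurableC supp_measurable) mM _ M0).
by rewrite not_supp_ball => x [nk /= m0 xB]; apply: MP => /(_ nk m0).
Qed.

(** A ball centred in the support has positive measure. *)
Lemma conull_dense (E : set (borel Y)) (x : Y) (e : R) : conull E -> supp x -> 0 < e ->
  exists2 z : Y, E z & mdist z x < e.
Proof.
move=> [mE E0] sx e0; apply: contrapT => H.
have /sx : open_nbhs x (ball x e) by split; [exact: mball_open|exact: ballxx].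
apply/negP; rewrite -leNgt -E0; apply: le_measure; rewrite ?inE//.
- exact: ball_measurable.
- exact: measurableC.
by move=> z; rewrite ballEmdist/= metric_sym => xz Ez; apply: H; exists z.
Qed.

End support.

Section extension.
Context {R : realType} (Y Z : completeMetricType R) (T : Y -> Z).
Variable E : set Y.
Hypothesis TE : forall x y : Y, E x -> E y -> mdist (T x) (T y) = mdist x y.

(** The image of x under the isometric extension of T to the closure of E. *)
Lemma extension_point (x : Y) : (forall e, 0 < e -> exists2 z : Y, E z & mdist z x < e) ->
  exists y : Z, forall z : Y, E z -> mdist (T z) y = mdist z x.
Proof.
move=> sx.
have /choice[u Hu] : forall n : nat, exists z : Y, E z /\ mdist z x < n.+1%:R^-1.
  move=> n; have [|z Ez zx] := sx n.+1%:R^-1; first by rewrite invr_gt0.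
  by exists z.
have uE n : E (u n) := (Hu n).1.
have ux e : 0 < e -> \forall n \near \oo, mdist (u n) x < e.
  move=> e0; near=> n; apply: lt_trans (Hu n).2 _.
  by near: n; exact: near_infty_natSinv_lt (PosNum e0).
have /cauchy_cvg : cauchy (T (u n) @[n --> \oo]).
  apply/cauchy_ballP => e e0.
  have e2 : 0 < e / 2 by rewrite divr_gt0.
  near_simpl; have N := ux _ e2.
  exists ([set n | mdist (u n) x < e / 2], [set n | mdist (u n) x < e / 2]) => //=.
  move=> [n m] /= [h1 h2]; rewrite ballEmdist/= TE//.
  have := metric_triangle (u n) x (u m); rewrite (metric_sym x (u m)); lra.
move=> /cvg_ex[/= y Ty]; exists y => z Ez.
apply/eqP; rewrite -subr_eq0 -normr_le0; apply/ler_addgt0Pr => e e0; rewrite add0r.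
have e2 : 0 < e / 2 by rewrite divr_gt0.
have N1 := ux _ e2.
have N2 : \forall n \near \oo, ball y (e / 2) (T (u n)).
  by move/cvg_ballP : Ty; exact.
near \oo => n.
have h1 : mdist (u n) x < e / 2 by near: n.
have h2 : ball y (e / 2) (T (u n)) by near: n.
move: h2; rewrite ballEmdist/= => h2.
have a1 := ler_dist_mdist y (T (u n)) (T z).
have a2 := ler_dist_mdist (u n) x z.
rewrite (metric_sym y) (metric_sym _ (T z)) TE// in a1.
rewrite (metric_sym x) in a2.
move: a1 a2; rewrite (metric_sym (u n) z) => a1 a2.
apply: le_trans (ler_distD (mdist z (u n)) _ _) _.
lra.
Unshelve. all: by end_near. Qed.

End extension.

Section isometric_extension.
Context {R : realType} (Y Z : mmSpace R).
Implicit Types (phi psi : borel Y -> borel Z).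

(** On A the preimage of an open set is the trace of a union of open balls. *)
Lemma measurable_isometric_piece (A : set (borel Y)) phi psi : measurable A ->
  measurable_fun setT psi ->
  (forall x y : Y, A x -> A y -> mdist (phi x : Z) (phi y : Z) = mdist x y) ->
  (forall x, ~ A x -> phi x = psi x) -> measurable_fun setT phi.
Proof.
move=> mA mpsi iso out.
apply: (@measurability _ _ (borel Y) (borel Z) setT phi (@open Z)) => //.
move=> _ [U oU <-]; rewrite setTI.
pose V : set Y := \bigcup_(p in [set p : Y * R | A p.1 /\ ball (phi p.1 : Z) p.2 `<=` U]) ball p.1 p.2.
have oV : open V by apply: bigcup_open => p _; exact: mball_open.
have mV : measurable (V : set (borel Y)) by exact: sub_sigma_algebra.
have mU : measurable (U : set (borel Z)) by exact: sub_sigma_algebra.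
rewrite [X in measurable X](_ : _ = (A `&` V) `|` (~` A `&` psi @^-1` U)).
  apply: measurableU; apply: measurableI => //; first exact: measurableC.
  by rewrite -[X in measurable X]setTI; exact: mpsi.
apply/seteqP; split=> x /=.
  move=> Ux; have [Ax|Ax] := pselect (A x); last by right; rewrite -out.
  left; split => //; have /nbhs_ballP[e /= e0 eU] : nbhs (phi x : Z) U by exact: open_nbhs_nbhs.
  by exists (x, e) => //=; exact: ballxx.
case=> [[Ax [[y e] /= [Ay sub] xB]]|[Ax]]; last by rewrite out.
by apply: sub; move: xB; rewrite !ballEmdist/= iso.
Qed.

(** The extended value at x is the point whose distances to T z are those of x to z,
    for z in E; outside the support T is left as it is. *)
Lemma isometric_extension (T : borel Y -> borel Z) (E : set (borel Y)) :
  measurable_fun setT T -> conull E ->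
  (forall x y : Y, E x -> E y -> mdist (T x : Z) (T y : Z) = mdist x y) ->
  exists phi, [/\ measurable_fun setT phi, {ae \m_Y, forall x, phi x = T x} &
    forall x y : Y, supp x -> supp y -> mdist (phi x : Z) (phi y : Z) = mdist x y].
Proof.
move=> mT cE TE; have FF := ae_filter_ringOfSetsType \m_Y.
have /choice[phi Hphi] : forall x : borel Y, exists y : borel Z,
    (supp (x : Y) -> forall z : Y, E z -> mdist (T z : Z) (y : Z) = mdist z x) /\
    (~ supp (x : Y) -> y = T x).
  move=> x; have [sx|sx] := pselect (supp (x : Y)); last by exists (T x).
  have [|y Hy] := @extension_point _ Y Z T E TE x; last by exists y.
  by move=> e; exact: conull_dense.
have iso x y : supp x -> supp y -> mdist (phi x : Z) (phi y : Z) = mdist x y.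
  move=> sx sy; apply/eqP; rewrite -subr_eq0 -normr_le0.
  apply/ler_addgt0Pr => e e0; rewrite add0r.
  have e2 : 0 < e / 2 by rewrite divr_gt0.
  have [z Ez zx] := conull_dense cE sx e2.
  have a1 := ler_dist_mdist (phi x : Z) (T z : Z) (phi y : Z).
  have a2 := ler_dist_mdist z x y.
  have [Hx _] := Hphi x; have [Hy _] := Hphi y.
  rewrite (metric_sym (phi x : Z) (T z : Z)) (Hx sx z Ez) (Hy sy z Ez) in a1.
  apply: le_trans (ler_distD (mdist z y) _ _) _.
  lra.
exists phi; split => //.
  apply: (@measurable_isometric_piece (supp (X := Y)) phi T _ mT iso).
    exact: supp_measurable.
  by move=> x nx; have [_ H] := Hphi x; exact: H.
have HE : {ae \m_Y, forall x, E x}.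
  exists (~` E); split => //; [by apply: measurableC; case: cE|by case: cE].
have [mE E0] := cE; apply: filterS HE => x Ex.
have [sx|sx] := pselect (supp (x : Y)); last by have [_] := Hphi x; apply.
by have [/(_ sx x Ex) + _] := Hphi x; rewrite mdistxx => /mdist_positivity ->.
Qed.

End isometric_extension.

Section composition_isometry_isomorphism.
Context {R : realType} (X1 X2 : mmSpace R) (T : borel X1 -> borel X2).

Lemma iso_of_composition_isometry : measurable_fun setT T ->
  sobolev_to_lipschitz X1 -> sobolev_to_lipschitz X2 ->
  finite_on_bounded X1 -> finite_on_bounded X2 ->
  ae_left_invertible T -> composition_isometry T -> iso_up_to_negligible T.
Proof.
move=> mT stl1 stl2 fin1 fin2 [N [S [mN N0 mS ST]]] isoT.
have [E cE TE] := ae_isometric mT isoT fin2 mN N0 mS ST fin1 stl1 stl2.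
have [phi [mphi phiT iso]] := isometric_extension mT cE TE.
exists phi; split => //; split => // B mB.
rewrite -(comp_measure_preserving mT isoT fin2 mB) /pushforward.
have pre (F : borel X1 -> borel X2) : measurable_fun setT F -> measurable (F @^-1` B).
  by move=> mF; rewrite -[X in measurable X]setTI; exact: mF.
have AE : {ae \m_X1, forall x, (phi @^-1` B) x <-> (T @^-1` B) x}.
  have FF := ae_filter_ringOfSetsType \m_X1.
  by apply: filterS phiT => x /= ->.
exact: (measure_ae_set (pre _ mphi) (pre _ mT) AE).
Qed.

End composition_isometry_isomorphism.

(** * The inverse of an isomorphism *)

Section inverse_isomorphism.
Context {R : realType} (X1 X2 : mmSpace R) (phi : borel X1 -> borel X2).
Hypotheses (mphi : measurable_fun setT phi) (iphi : mm_isomorphism phi).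

Lemma supp_closed (Y : mmSpace R) (x : Y) :
  (forall e, 0 < e -> exists2 z : Y, supp z & mdist z x < e) -> supp x.
Proof.
move=> H U [oU Ux].
have /nbhs_ballP[e /= e0 eU] : nbhs x U by exact: open_nbhs_nbhs.
have [z sz zx] := H e e0; apply: sz; split => //; apply: eU.
by rewrite ballEmdist/= metric_sym.
Qed.

Lemma isomorphism_supp (x : X1) : supp x -> supp (phi x : X2).
Proof.
move=> sx U [oU Ux]; have [push iso] := iphi.
have mU : measurable (U : set (borel X2)) by exact: sub_sigma_algebra.
rewrite -push// /pushforward.
have /nbhs_ballP[e /= e0 eU] : nbhs (phi x : X2) U by exact: open_nbhs_nbhs.
have /sx : open_nbhs x (ball x e) by split; [exact: mball_open|exact: ballxx].
move/lt_le_trans; apply.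
have [ms s0] := supp_conull X1.
have mp : measurable (phi @^-1` U) by rewrite -[X in measurable X]setTI; exact: mphi.
have msC : measurable (~` supp (X := X1) : set (borel X1)) by exact: measurableC.
rewrite -(measureU0 mp msC s0); apply: le_measure; rewrite ?inE.
- exact: ball_measurable.
- exact: measurableU.
move=> z; rewrite ballEmdist/= => xz; have [sz|sz] := pselect (supp z); last by right.
by left; apply: eU; rewrite ballEmdist/= iso.
Qed.

(** A support point of X2 is a limit of images of support points, whose preimages
    form a Cauchy sequence. *)
Lemma isomorphism_supp_onto (y : X2) : supp y -> exists2 x : X1, supp x & phi x = y.
Proof.
move=> sy; have [push iso] := iphi.
have near_y e : 0 < e -> exists2 x : X1, supp x & mdist (phi x : X2) y < e.
  move=> e0; apply: contrapT => H.
  have /sy : open_nbhs y (ball y e) by split; [exact: mball_open|exact: ballxx].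
  have mB := ball_measurable y e.
  have [ms s0] := supp_conull X1.
  rewrite -push// /pushforward; apply/negP; rewrite -leNgt -s0.
  apply: le_measure; rewrite ?inE; last 1 first.
  - by move=> x; rewrite ballEmdist/= metric_sym => yx sx; apply: H; exists x.
  - by rewrite -[X in measurable X]setTI; exact: mphi.
  - exact: measurableC.
pose C := [set y' : X2 | exists2 x : X1, supp x & phi x = y'].
have /choice[S0 HS0] : forall y' : X2, exists x : X1, C y' -> supp x /\ phi x = y'.
  move=> y'; have [[x sx xy]|nC] := pselect (C y'); first by exists x.
  by exists point.
have isoS x x' : C x -> C x' -> mdist (S0 x) (S0 x') = mdist x x'.
  move=> /HS0[s1 e1] /HS0[s2 e2].
  by rewrite -[in RHS]e1 -[in RHS]e2 iso.
have nearC e : 0 < e -> exists2 z : X2, C z & mdist z y < e.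
  by move=> e0; have [x sx xy] := near_y e e0; exists (phi x) => //; exists x.
have [x Hx] := extension_point isoS nearC.
have sx : supp x.
  apply: supp_closed => e e0; have [z Cz zy] := nearC e e0.
  by exists (S0 z); [have [] := HS0 z Cz|rewrite Hx].
exists x => //; apply: (@mdist_positivity _ X2); apply/eqP; rewrite eq_le mdist_ge0 andbT.
apply/ler_addgt0Pr => e e0; rewrite add0r.
have [z Cz zy] := nearC (e / 2) ltac:(by rewrite divr_gt0).
have [sz ez] := HS0 z Cz.
apply: le_trans (metric_triangle (phi x : X2) z y) _.
have -> : mdist (phi x : X2) z = mdist z y by rewrite -[in LHS]ez iso// metric_sym Hx.
lra.
Qed.

(** Off the support of X2, which is a null set, the inverse is constant. *)
Lemma isomorphism_inverse : exists S : borel X2 -> borel X1,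
  [/\ measurable_fun setT S, mm_isomorphism S,
      forall x : X1, supp x -> S (phi x) = x & forall y : X2, supp y -> phi (S y) = y].
Proof.
have [push iso] := iphi.
have /choice[S HS] : forall y : X2, exists x : X1,
    (supp y -> supp x /\ phi x = y) /\ (~ supp y -> x = point).
  move=> y; have [sy|sy] := pselect (supp y); last by exists point.
  by have [x sx xy] := isomorphism_supp_onto sy; exists x.
have isoS y y' : supp y -> supp y' -> mdist (S y) (S y') = mdist y y'.
  move=> /(HS y).1[s1 e1] /(HS y').1[s2 e2].
  by rewrite -[in RHS]e1 -[in RHS]e2 iso.
have mS : measurable_fun setT (S : borel X2 -> borel X1).
  apply: (@measurable_isometric_piece _ _ _ (supp (X := X2)) S (cst point)) => //.
    exact: supp_measurable.
  by move=> y ny; exact: (HS y).2.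
have Sphi (x : X1) : supp x -> S (phi x) = x.
  move=> sx; have [s1 e1] := (HS (phi x)).1 (isomorphism_supp sx).
  by apply: (@mdist_positivity _ X1); rewrite -iso// e1 mdistxx.
exists S; split => //; last by move=> y /(HS y).1[].
split => // B mB; rewrite /pushforward.
have mSB : measurable (S @^-1` B : set (borel X2)).
  by rewrite -[X in measurable X]setTI; exact: mS.
rewrite -push// /pushforward.
have mp : measurable (phi @^-1` (S @^-1` B)).
  by rewrite -[X in measurable X]setTI; exact: mphi.
have FF := ae_filter_ringOfSetsType \m_X1.
have AE : {ae \m_X1, forall x, (phi @^-1` (S @^-1` B)) x <-> B x}.
  exists (~` supp (X := X1)); have [ms s0] := supp_conull X1.
  split => //; first exact: measurableC.
  by move=> x /= H sx; apply: H; rewrite Sphi.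
exact: (measure_ae_set mp mB AE).
Qed.

End inverse_isomorphism.

(** * Test plans transported by an isomorphism *)

Section same_distances.
Context {R : realType} {X Y : completeMetricType R}.
Variables (g : curve X) (g' : curve Y).
Hypothesis gg' : forall s t, mdist (cev g s) (cev g t) = mdist (cev g' s) (cev g' t).

Lemma metric_speed_eq t : 0 <= t <= 1 -> metric_speed g t = metric_speed g' t.
Proof.
move=> t01; rewrite /metric_speed; congr (lim _).
have E h : unit_itv R (t + h) -> mdist (curve_eval (t + h) g) (curve_eval t g) / `|h| =
    mdist (curve_eval (t + h) g') (curve_eval t g') / `|h|.
  by rewrite /unit_itv/= in_itv/= => th; rewrite !curve_evalE// gg'.
apply/seteqP; split=> B /=; rewrite /nbhs/= /within/=; apply: filterS => h H h01;
  have := H h01; rewrite /= E//.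
Qed.

Lemma speed_eq t : speed g t = speed g' t.
Proof.
by rewrite /speed; case: ifPn => // /andP[t0 t1]; rewrite metric_speed_eq// !ltW.
Qed.

Lemma abs_cont_eq : abs_cont g -> abs_cont g'.
Proof.
move=> [h [ih hP]]; exists h; split => // s t s0 st t1.
have s01 : 0 <= s <= 1 by rewrite s0 (le_trans st).
have t01 : 0 <= t <= 1 by rewrite t1 (le_trans s0).
by have := hP s t s0 st t1; rewrite !curve_evalE// gg'.
Qed.
End same_distances.

Lemma energy_eq {R : realType} {X Y : completeMetricType R} (g : curve X) (g' : curve Y) :
  (forall s t, mdist (cev g s) (cev g t) = mdist (cev g' s) (cev g' t)) ->
  energy g = energy g'.
Proof.
move=> gg'; have g'g s t : mdist (cev g' s) (cev g' t) = mdist (cev g s) (cev g t) by [].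
rewrite /energy (_ : `[< abs_cont g >] = `[< abs_cont g' >]); last first.
  by apply: asbool_equiv_eq; split; exact: abs_cont_eq.
case: ifPn => [_|//]; apply: eq_integral => t; rewrite inE /unit_itv/= in_itv/= => t01.
by rewrite (metric_speed_eq gg').
Qed.

Section push_curve.
Context {R : realType} (X1 X2 : mmSpace R) (phi : borel X1 -> borel X2).
Hypotheses (mphi : measurable_fun setT phi) (iphi : mm_isomorphism phi).
Let sX1 : separable X1 := mms_separable X1.
Implicit Types g : curve X1.

Definition supp_curve : set (curve X1) := [set g | forall t, supp (cev g t)].

Lemma push_curve_subproof g : supp_curve g -> continuous (fun t => phi (cev g t) : X2).
Proof.
move=> Kg t A /nbhs_ballP[e /= e0 eA].
have /nbhs_ballP[r /= r0 H] : \forall s \near t, ball (cev g t) e (cev g s).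
  by have /cvg_ballP := @cev_continuous _ _ g t; exact.
apply/nbhs_ballP; exists r => //= s /H; rewrite ballEmdist/= => gst.
by apply: eA; rewrite ballEmdist/= iphi.2.
Qed.

(** Curves that leave the support are sent to a constant curve; they form a null
    set for every test plan. *)
Definition push_curve g : curve X2 :=
  match pselect (supp_curve g) with
  | left Kg => mkcurve (push_curve_subproof Kg)
  | right _ => cst_curve
  end.

Lemma cev_push g t : supp_curve g -> cev (push_curve g) t = phi (cev g t).
Proof.
by move=> Kg; rewrite /push_curve; case: pselect => // Kg'; rewrite cev_mkcurve cev_clamp.
Qed.

Lemma push_curve_out g : ~ supp_curve g -> push_curve g = cst_curve.
Proof. by rewrite /push_curve; case: pselect. Qed.

Lemma supp_curve_ratP g : supp_curve g <-> forall q : rat, supp (cev g (ratr q)).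
Proof.
split=> [Kg q|H t]; first exact: Kg.
apply: supp_closed => e e0.
have /nbhs_ballP[r /= r0 Hr] : \forall s \near t, ball (cev g t) e (cev g s).
  by have /cvg_ballP := @cev_continuous _ _ g t; exact.
have [q] := @rat_in_itvoo R (t - r) (t + r) ltac:(lra).
rewrite in_itv/= => /andP[q1 q2]; exists (cev g (ratr q)) => //.
have /Hr : ball t r (ratr q) by rewrite /ball/= ltr_norml; apply/andP; split; lra.
by rewrite ballEmdist/= metric_sym.
Qed.

Lemma supp_curveE : supp_curve = \bigcap_(q : rat) [set g | supp (cev g (ratr q))].
Proof.
apply/seteqP; split=> g; first by move=> Kg q _; exact: Kg.
by move=> H; apply/supp_curve_ratP => q; exact: (H q Logic.I).
Qed.

Lemma supp_curve_measurable : measurable (supp_curve : set (borel (curve X1))).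
Proof.
rewrite supp_curveE; apply: bigcap_countable_measurable => q.
have mc := measurable_cev_eval (X := X1) (ratr q).
rewrite [X in measurable X](_ : _ = setT `&`
  (fun g : borel (curve X1) => cev g (ratr q) : borel X1) @^-1` supp (X := X1)).
  by apply: mc => //; exact: supp_measurable.
by rewrite setTI.
Qed.

(** The support being closed, it suffices to look at rational times. *)
Lemma supp_curve_ae (pi : probability (borel (curve X1)) R) : test_plan pi ->
  {ae pi, forall g : borel (curve X1), supp_curve g}.
Proof.
move=> tp; have FF := ae_filter_ringOfSetsType pi.
have H : {ae pi, forall g : borel (curve X1), forall q : rat, supp (cev g (ratr q))}.
  apply: ae_forall_countable => q; apply: (test_plan_ae_at (ratr q) tp).
  exists (~` supp (X := X1)); have [ms s0] := supp_conull X1.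
  by split => //; exact: measurableC.
by apply: filterS H => g /supp_curve_ratP.
Qed.

Lemma mdist_push g g' s t : supp_curve g -> supp_curve g' ->
  mdist (cev (push_curve g) s) (cev (push_curve g') t) = mdist (cev g s) (cev g' t).
Proof. by move=> Kg Kg'; rewrite !cev_push// iphi.2. Qed.

Lemma measurable_push_curve :
  measurable_fun setT (push_curve : borel (curve X1) -> borel (curve X2)).
Proof.
apply: (@measurability _ _ (borel (curve X1)) (borel (curve X2)) setT push_curve (@open (curve X2))) => //.
move=> _ [U oU <-]; rewrite setTI.
pose V : set (curve X1) := \bigcup_(p in [set p : curve X1 * R | supp_curve p.1 /\
    [set g' | forall t, mdist (cev (push_curve p.1) t) (cev g' t) < p.2] `<=` U])
  interior [set g' | forall t, mdist (cev p.1 t) (cev g' t) < p.2].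
have mV : measurable (V : set (borel (curve X1))).
  by apply: sub_sigma_algebra; apply: bigcup_open => p _; exact: open_interior.
rewrite [X in measurable X](_ : _ = (supp_curve `&` V) `|`
    (if `[< U cst_curve >] then ~` supp_curve else set0)).
  apply: measurableU; first by apply: measurableI => //; exact: supp_curve_measurable.
  by case: ifPn => // _; apply: measurableC; exact: supp_curve_measurable.
apply/seteqP; split=> g /=.
  move=> Ug; have [Kg|Kg] := pselect (supp_curve g); last first.
    by right; rewrite push_curve_out// in Ug; rewrite asboolT.
  left; split => //.
  have /curve_nbhsP[e e0 eU] : nbhs (push_curve g) U by exact: open_nbhs_nbhs.
  exists (g, e) => //=; apply/curve_nbhsP; exists e => // g' H; exact: H.
case=> [[Kg [[g0 e] /= [Kg0 sub] /interior_subset/= H]]|].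
  by apply: sub => t; rewrite mdist_push.
by case: asboolP => // Uc nK; rewrite push_curve_out.
Qed.

(** The constant curve is compared with the curve stopped at time 0. *)
Lemma energy_push g : (energy (push_curve g) <= energy g)%E.
Proof.
have [Kg|Kg] := pselect (supp_curve g).
  by rewrite (@energy_eq _ _ _ (push_curve g) g)// => s t; rewrite mdist_push.
rewrite (push_curve_out Kg); apply: le_trans (energy_stop_curve sX1 g (lexx 0) (lexx 0) ler01).
rewrite (@energy_eq _ _ _ cst_curve (stop_curve 0 0 g))// => s t.
rewrite !cev_stop_curve /clamp; have E r : Num.max 0 (Num.min 0 (clamp01 r)) = 0 :> R.
  by have /andP[h _] := clamp01_itv r; rewrite min_l// maxxx.
by rewrite !E [RHS]mdistxx; exact: mdistxx.
Qed.

Definition push_plan pi := plan_map pi measurable_push_curve.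

Lemma test_plan_push pi : test_plan pi -> test_plan (push_plan pi).
Proof.
move=> tp; have [[C C0 HC] en] := tp; split; last first.
  apply: le_lt_trans en; apply: (le_trans (integral_plan_map_lower _ _ _)).
    exact: energy_ge0.
  by apply: ge0_le_integral_lower => g; [exact: energy_ge0|exact: energy_push].
exists C => // t t01 B mB; rewrite /pushforward plan_mapE.
have mpB : measurable (phi @^-1` B) by rewrite -[X in measurable X]setTI; exact: mphi.
have := HC t t01 _ mpB; have := iphi.1 B mB; rewrite /pushforward => ->; apply: le_trans.
have FF := ae_filter_ringOfSetsType pi.
have mA : measurable (curve_eval t @^-1` (phi @^-1` B) : set (borel (curve X1))).
  rewrite [X in measurable X](_ : _ = (fun g : borel (curve X1) => cev g t) @^-1` (phi @^-1` B)).
    by rewrite -[X in measurable X]setTI; exact: measurable_cev_eval.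
  by apply/seteqP; split=> g /=; rewrite curve_evalE.
have mA' : measurable (push_curve @^-1` (curve_eval t @^-1` B) : set (borel (curve X1))).
  rewrite -[X in measurable X]setTI; apply: measurable_push_curve => //.
  rewrite [X in measurable X](_ : _ = (fun g : borel (curve X2) => cev g t) @^-1` B).
    by rewrite -[X in measurable X]setTI; exact: measurable_cev_eval.
  by apply/seteqP; split=> g /=; rewrite curve_evalE.
have AE : {ae pi, forall g, (push_curve @^-1` (curve_eval t @^-1` B)) g <->
    (curve_eval t @^-1` (phi @^-1` B)) g}.
  by apply: filterS (supp_curve_ae tp) => g Kg /=; rewrite !curve_evalE// cev_push.
by have := measure_ae_set mA' mA AE => ->.
Qed.

End push_curve.

(** * Invariance of the Sobolev norm *)

Section isomorphism_sobolev.
Context {R : realType} (X1 X2 : mmSpace R) (phi : borel X1 -> borel X2).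
Hypotheses (mphi : measurable_fun setT phi) (iphi : mm_isomorphism phi).
Local Open Scope ereal_scope.
Implicit Types (f G : borel X2 -> R).

Lemma integral_isomorphism (u : borel X2 -> \bar R) : measurable_fun setT u ->
  (forall y, 0 <= u y) -> \int[\m_X1]_x u (phi x) = \int[\m_X2]_y u y.
Proof.
move=> mu u0.
rewrite -(@ge0_integral_pushforward _ _ _ _ R phi mphi \m_X1 setT u measurableT mu
  (fun x _ => u0 x)).
by apply: eq_measure_integral => B mB _; exact: iphi.1.
Qed.

Lemma flow_push pi G : test_plan pi -> measurable_fun setT G -> (forall y, 0 <= G y)%R ->
  flow (push_plan iphi pi) G = flow pi (G \o phi).
Proof.
move=> tp mG G0; have FF := ae_filter_ringOfSetsType pi.
have mGp : measurable_fun setT (G \o phi) by exact: measurableT_comp.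
have sX1 := mms_separable X1; have sX2 := mms_separable X2.
have F (Y : mmSpace R) (p : probability (borel (curve Y)) R) (H : borel Y -> R) :
    measurable_fun setT H -> (forall y, 0 <= H y)%R -> flow p H =
    \int[p]_g \int[lebesgue_measure]_t (integrand H (g, t))%:E.
  move=> mH H0; rewrite /flow /plan_time fubini_tonelli1//=.
  - by apply/measurable_EFinP; exact: measurable_integrand.
  - by move=> z; rewrite lee_fin integrand_ge0.
have mI (Y : mmSpace R) (H : borel Y -> R) :
    measurable_fun setT H -> (forall y, 0 <= H y)%R ->
    measurable_fun setT (fun g : borel (curve Y) =>
      \int[lebesgue_measure]_t (integrand H (g, t))%:E).
  move=> mH H0; apply: (@measurable_fun_fubini_tonelli_F _ _ (borel (curve Y))
    (measurableTypeR R) R lebesgue_measure (fun z => (integrand H z)%:E)).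
  - exact: measurable_integrandE.
  - by move=> z; rewrite lee_fin integrand_ge0.
rewrite (F _ _ _ mG G0) (F _ _ _ mGp (fun x => G0 (phi x))) /push_plan ge0_integral_plan_map; last 2 first.
- exact: mI.
- by move=> g; apply: integral_ge0 => t _; rewrite lee_fin integrand_ge0.
apply: ae_eq_integral => //.
- exact: (measurableT_comp (mI _ _ mG G0) (measurable_push_curve iphi)).
- exact: (mI _ _ mGp (fun x => G0 (phi x))).
apply: filterS (supp_curve_ae tp) => g Kg _; apply: eq_integral => t _.
rewrite /integrand /= cev_push// (@speed_eq _ _ _ (push_curve iphi g) g)// => s r.
by rewrite mdist_push.
Qed.

Lemma plan_gradient_isomorphism f G : measurable_fun setT f ->
  plan_gradient f G -> plan_gradient (f \o phi) (G \o phi).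
Proof.
move=> mf [mG G0 HG]; split; first exact: measurableT_comp.
  by move=> x; exact: G0.
move=> pi tp; have [H1 H2] := HG _ (test_plan_push mphi iphi tp).
rewrite flow_push// in H1 H2; split => //; apply: le_trans H2.
rewrite /push_plan ge0_integral_plan_map//; last exact: measurable_incr.
have FF := ae_filter_ringOfSetsType pi.
rewrite le_eqVlt; apply/orP; left; apply/eqP; apply: ae_eq_integral => //.
- by apply: measurable_incr; exact: measurableT_comp.
- exact: (measurableT_comp (measurable_incr mf) (measurable_push_curve iphi)).
by apply: filterS (supp_curve_ae tp) => g Kg _ /=; rewrite !cev_push.
Qed.

Lemma Lfun2_isomorphism G : G \in Lfun \m_X2 2%:E -> G \o phi \in Lfun \m_X1 2%:E.
Proof.
move=> /Lfun2P[mG iG]; apply/Lfun2P; split; first exact: measurableT_comp.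
rewrite (@integral_isomorphism (fun y => (G y ^+ 2)%:E))//; first exact: measurable_sqr.
by move=> y; rewrite lee_fin sqr_ge0.
Qed.

Lemma wug_isomorphism f G : measurable_fun setT f ->
  weak_upper_gradient f G -> weak_upper_gradient (f \o phi) (G \o phi).
Proof.
move=> mf /weak_upper_gradientP[iG pG]; apply/weak_upper_gradientP; split.
  exact: Lfun2_isomorphism.
exact: plan_gradient_isomorphism.
Qed.

Lemma W12_isomorphism f : W12 f -> W12 (f \o phi).
Proof.
move=> [if2 [mf [G wG]]]; split; first exact: Lfun2_isomorphism.
by split; [exact: measurableT_comp|exists (G \o phi); exact: wug_isomorphism].
Qed.

(** The minimal weak upper gradient of f, composed with phi, is a weak upper gradient
    of f o phi. *)
Lemma sobolev_energy_isomorphism f : W12 f ->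
  sobolev_energy (f \o phi) <= sobolev_energy f.
Proof.
move=> wf; have wfp := W12_isomorphism wf; have mf := wf.2.1.
have /Lfun2P[m1 _] := min_Lfun2 wfp.2; have /Lfun2P[m2 _] := min_Lfun2 wf.2.
have sq0 (Y : mmSpace R) (F : borel Y -> R) y : 0 <= (F y ^+ 2)%:E by rewrite lee_fin sqr_ge0.
rewrite /sobolev_energy; apply: leeD.
  by rewrite (integral_isomorphism (measurable_sqr mf) (sq0 _ _)).
rewrite -(integral_isomorphism (measurable_sqr m2) (sq0 _ _)).
have FF := ae_filter_ringOfSetsType \m_X1.
apply: ae_ge0_le_integral => //.
- exact: measurable_sqr.
- exact: (measurableT_comp (measurable_sqr m2) mphi).
apply: filterS (min_wug_le wfp.2 (wug_isomorphism mf (min_wug wf.2))) => x H _.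
by rewrite lee_fin lerXn2r ?nnegrE// min_wug_ge0//; [exact: wfp.2|exact: wf.2].
Qed.

End isomorphism_sobolev.

Section converse.
Context {R : realType} (X1 X2 : mmSpace R).
Local Open Scope ereal_scope.

(** Composition with an isomorphism does not increase the norm; neither does
    composition with its inverse. *)
Lemma composition_isometry_of_iso (T : borel X1 -> borel X2) : measurable_fun setT T ->
  iso_up_to_negligible T -> ae_left_invertible T /\ composition_isometry T.
Proof.
move=> mT [phi [mphi phiT iphi]].
have [S [mS iS Sphi phiS]] := isomorphism_inverse mphi iphi.
have FF1 := ae_filter_ringOfSetsType \m_X1; have FF2 := ae_filter_ringOfSetsType \m_X2.
have ae_supp (Y : mmSpace R) : {ae \m_Y, forall y, supp (y : Y)}.
  exists (~` supp (X := Y)); have [ms s0] := supp_conull Y.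
  by split => //; exact: measurableC.
split.
  have [N [mN N0 NP]] : {ae \m_X1, forall x, S (T x) = x}.
    by apply: filterS2 phiT (ae_supp X1) => x <- sx; exact: Sphi.
  by exists N, S; split => // x Nx; apply: contrapT => H; apply: Nx; exact: NP.
move=> f mf.
have mfT : measurable_fun setT (f \o T) by exact: measurableT_comp.
have mfp : measurable_fun setT (f \o phi) by exact: measurableT_comp.
have mfpS : measurable_fun setT ((f \o phi) \o S) by exact: measurableT_comp.
have fT : {ae \m_X1, forall x, (f \o phi) x = (f \o T) x}.
  by apply: filterS phiT => x /= ->.
have Tf : {ae \m_X1, forall x, (f \o T) x = (f \o phi) x}.
  by apply: filterS phiT => x /= ->.
have fS : {ae \m_X2, forall y, ((f \o phi) \o S) y = f y}.
  by apply: filterS (ae_supp X2) => y sy /=; rewrite phiS.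
have down : W12 f -> W12 (f \o phi) by exact: W12_isomorphism.
split.
  split=> [/down|/(W12_ae mfp Tf) w]; first exact: W12_ae.
  by apply: (W12_ae mf fS); exact: W12_isomorphism.
move=> wf; rewrite !W12_normE; congr poweR.
rewrite -(sobolev_energy_ae mfp mfT fT); apply/eqP; rewrite eq_le; apply/andP; split.
  rewrite -(sobolev_energy_ae mfpS mf fS).
  by apply: sobolev_energy_isomorphism => //; exact: down.
exact: sobolev_energy_isomorphism.
Qed.

End converse.

Theorem proposition4p20 (R : realType) (X1 X2 : mmSpace R)
  (T : borel X1 -> borel X2)
  (stl1 : sobolev_to_lipschitz X1) (stl2 : sobolev_to_lipschitz X2)
  (mT : measurable_fun [set: borel X1] T)
  (fin1 : finite_on_bounded X1) (fin2 : finite_on_bounded X2) :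
  iso_up_to_negligible T <->
    (ae_left_invertible T /\ composition_isometry T).
Proof.
split; first exact: composition_isometry_of_iso.
by move=> [invT isoT]; exact: iso_of_composition_isometry.
Qed.
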